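(* Let $0 < a < \frac14$. For any $0 < \delta< \frac12\min\{1-4a,a\}$, define $\hat{\psi}_\delta : \mathbb{R}^2 \to \mathbb{R}$ by $\hat{\psi}_\delta(x,y) = f_{([a,2a];\frac{\delta}{2},\delta)}\left(\sqrt{x^2 + y^2}\right)$, and let $\psi_\delta$ be its inverse Fourier transform. Then $\hat{\psi}_\delta\in\mathscr{S}(\mathbb{R}^2)$ and $\mathcal{W}(\psi_\delta)$ is a Parseval frame for $L^2(\mathbb{R}^2)$.
   Context: Fix a function $\theta \in C^\infty(\mathbb{R})$, real-valued, with $\theta(x)=0$ for $x\le -1$, $\theta(x)=1$ for $x \ge 1$, and $\theta(x)^2+\theta(-x)^2=1$ for all $x\in\mathbb{R}$ (such functions exist). For a closed interval $I=[c,d]$ and $\delta_1,\delta_2>0$ with $\delta_1+\delta_2\le d-c$, define $f_{(I;\delta_1,\delta_2)}:\mathbb{R}\to\mathbb{R}$ by $$f_{(I;\delta_1,\delta_2)}(x)=\begin{cases}\theta\left(\frac{x-c}{\delta_1}\right) & x<c+\delta_1,\\ 1 & c+\delta_1\le x\le d-\delta_2,\\ \theta\left(\frac{d-x}{\delta_2}\right) & x>d-\delta_2.\end{cases}$$ $\mathscr{S}(\mathbb{R}^d)$ is the Schwartz space. The Fourier transform is $\hat f(\gamma)=\int_{\mathbb{R}^d} f(x)e^{-2\pi i x\cdot\gamma}\,dx$, extended unitarily to $L^2$. For $\psi\in L^2(\mathbb{R}^d)$, the dyadic wavelet system is $\mathcal{W}(\psi)=\{2^{nd/2}\psi(2^n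 x-k): n\in\mathbb{Z},k\in\mathbb{Z}^d\}$. A family $\{e_j\}_{j\in J}$ in a separable Hilbert space $\mathcal{H}$ is a Parseval frame for $\mathcal{H}$ if $\sum_{j\in J}|\langle f,e_j\rangle|^2=\|f\|^2$ for all $f\in\mathcal{H}$. *)

(* Defs.v *)
From HB Require Import structures.
From mathcomp Require Export all_boot all_order all_algebra.
From mathcomp.real_closed Require Export complex.
From mathcomp Require Export all_classical all_reals all_analysis.
Export Order.TTheory GRing.Theory Num.Theory.
Export numFieldNormedType.Exports.

Set Implicit Arguments.
Unset Strict Implicit.
Unset Printing Implicit Defensive.

Local Open Scope classical_set_scope.
Local Open Scope ring_scope.
Local Open Scope complex_scope.

Section Defs.
Context {R : realType}.

Definition smooth_line (f : R -> R) : Prop :=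
  forall (n : nat) (x : R), derivable (derive1n n f) x 1.

Definition axis (b : bool) : R * R := if b then (0, 1) else (1, 0).

(* Iterated partial derivative along a word of axes, outermost derivative at
   the head; all words occur, so no symmetry of partial derivatives is assumed. *)
Definition partials (w : seq bool) (f : R * R -> R) : R * R -> R :=
  foldr (fun b g => 'D_(axis b) g) f w.

Definition smooth_plane (f : R * R -> R) : Prop :=
  forall w : seq bool, continuous (partials w f) /\
    forall (b : bool) (x : R * R), derivable (partials w f) x (axis b).

Definition real_schwartz (f : R * R -> R) : Prop :=
  smooth_plane f /\
  forall (w : seq bool) (m n : nat), exists M : R, forall x : R * R,
    `|x.1 ^+ m * x.2 ^+ n * partials w f x| <= M.

Definition schwartz (f : R * R -> R[i]) : Prop :=
  real_schwartz (fun x => complex.Re (f x)) /\ real_schwartz (fun x => complex.Im (f x)).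

Definition area := (@lebesgue_measure R \x @lebesgue_measure R)%E.

Definition Cintegral (f : R * R -> R[i]) : R[i] :=
  Rintegral area setT (fun x => complex.Re (f x))
    +i* Rintegral area setT (fun x => complex.Im (f x)).

(* L^2 is handled through representatives, measurable for the Borel
   sigma-algebra: every class of Lebesgue measurable functions has one. *)
Definition L2 (f : R * R -> R[i]) : Prop :=
  (fun x => complex.Re (f x)) \in Lfun area 2%:E /\
  (fun x => complex.Im (f x)) \in Lfun area 2%:E.

Definition L2inner (f g : R * R -> R[i]) : R[i] :=
  Cintegral (fun x => f x * conjc (g x)).

Definition L2normsq (f : R * R -> R[i]) : \bar R :=
  (\int[area]_x (Normc.normc (f x) ^+ 2)%:E)%E.

(* Parseval frame for L^2(R^2): the e_j must themselves lie in L^2(R^2), and the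
   unordered sum of the |<f, e_j>|^2 is taken in the extended reals. *)
Definition parseval_frame (J : choiceType) (e : J -> R * R -> R[i]) : Prop :=
  (forall j : J, L2 (e j)) /\
  forall f : R * R -> R[i], L2 f ->
    \esum_(j in [set: J]) (Normc.normc (L2inner f (e j)) ^+ 2)%:E = L2normsq f.

Definition expi (t : R) : R[i] := cos t +i* sin t.

(* Inverse of the Fourier transform with kernel e^{-2 pi i x.gamma}. *)
Definition inv_fourier (g : R * R -> R[i]) (x : R * R) : R[i] :=
  Cintegral (fun y => g y * expi (2 * pi * (x.1 * y.1 + x.2 * y.2))).

(* In dimension 2 the normalization 2^{nd/2} is 2^n. *)
Definition dyadic_wavelets (psi : R * R -> R[i]) (j : int * (int * int))
    (x : R * R) : R[i] :=
  ((2 : R) ^ j.1)%:C *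
  psi (2 ^ j.1 * x.1 - j.2.1%:~R, 2 ^ j.1 * x.2 - j.2.2%:~R).

(* f_{([c,d]; delta1, delta2)}, meant for 0 < delta1, delta2 and
   delta1 + delta2 <= d - c. *)
Definition window (theta : R -> R) (c d delta1 delta2 x : R) : R :=
  if x < c + delta1 then theta ((x - c) / delta1)
  else if x <= d - delta2 then 1
  else theta ((d - x) / delta2).

Definition psi_hat (theta : R -> R) (a delta : R) (x : R * R) : R :=
  window theta a (2 * a) (delta / 2) delta
    (Num.sqrt (x.1 ^+ 2 + x.2 ^+ 2)).

Definition psi (theta : R -> R) (a delta : R) : R * R -> R[i] :=
  inv_fourier (fun x => (psi_hat theta a delta x)%:C).

End Defs.

(* Main.v *)
(** With [L] the low-pass profile [low_pass], smooth, supported in the open square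
    of side 1 and equal to 1 near 0, one has
    [psi_hat z ^+ 2 = L z - L (2 z)].  Since [psi_hat] is supported in the same
    square, Fejer summation gives [\sum_k psi (x - k) * psi (y - k) = G (x - y)],
    where [G] is the inverse Fourier transform of [psi_hat ^ 2].  Let [A] be the
    autocorrelation of a real [f] and [H] the inverse Fourier transform of [L], so
    that [G s = H s - H (s / 2) / 4].  Dilating [f], the wavelets of scale [n]
    contribute [\int G s * A (2^-n s) = I (2^-n) - I (2^(1 - n))] to the frame sum,
    with [I c = \int H s * A (c s)].  The sum over [n] telescopes to
    [I (0+) - I (+oo)]; as translations are continuous in L2 and [A] vanishes at
    infinity, this is [A 0 * \int H = ||f||^2 * L 0 = ||f||^2].  The wavelet is
    real because [psi_hat] is even, so the real and imaginary parts of a complex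
    [f] can be treated separately. *)

From HB Require Import structures.
Require Import Defs.
From mathcomp Require Import measurable_realfun ring lra.

Set Implicit Arguments.
Unset Strict Implicit.
Unset Printing Implicit Defensive.

Local Open Scope classical_set_scope.
Local Open Scope ring_scope.

(** No Fourier transform of [f] is taken, so neither Plancherel nor an inversion theorem is called
    upon: frequencies occur only in integrals against [psi_hat], its square and [L], which are
    bounded with compact support. The one instance of inversion, [\int H = L 0], comes from the same
    Fejer argument as the reproducing formula. The price is paid on the space side, where the two
    limits of [I] rest on the behaviour of [A] at 0 and at infinity, obtained by measure theory for
    an arbitrary square integrable [f]. The bound on [delta] acts twice. From
    [delta < (1 - 4 * a) / 2] follows [2 * a + delta < 1 / 2]: two points of the support then differ
    by less than 1 in each coordinate, so that among the peaks of the Fejer kernel, which sit at the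
    integer points, only the one at the origin is seen. From [delta < a / 2] the two transitions of
    the window are disjoint. Absolute convergence is needed for every exchange of a lattice sum with
    an integral; it comes from the decay of [psi] like a product of two factors [1 / (1 + t ^ 2)],
    which two integrations by parts in each variable provide. *)

Section SigmaFiniteProduct.
Context d1 d2 (T1 : measurableType d1) (T2 : measurableType d2) {R : realType}.
Variables (m1 : {sigma_finite_measure set T1 -> \bar R})
  (m2 : {sigma_finite_measure set T2 -> \bar R}).

Lemma prod_sigma_finite : sigma_finite setT (m1 \x m2)%E.
Proof.
have /sigma_finiteP[F [TF ndF Foo]] := sigma_finiteT m1.
have /sigma_finiteP[G [TG ndG Goo]] := sigma_finiteT m2.
exists (fun n => F n `*` G n).
 rewrite -setXTT TF TG predeqE => -[x y]; split.
    move=> [/= [n _ Fnx] [k _ Gky]]; exists (maxn n k) => //; split.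
    - by move: x Fnx; exact/subsetPset/ndF/leq_maxl.
    - by move: y Gky; exact/subsetPset/ndG/leq_maxr.
  by move=> [n _ []/= ? ?]; split; exists n.
move=> k; have [? ?] := Foo k; have [? ?] := Goo k.
split; first exact: measurableX.
by rewrite product_measure1E// lte_mul_pinfty// ge0_fin_numE.
Qed.

End SigmaFiniteProduct.

Section Instances.
Context {R : realType}.
HB.instance Definition _ :=
  Measure.copy (@area R) (@lebesgue_measure R \x @lebesgue_measure R)%E.
HB.instance Definition _ := Measure_isSigmaFinite.Build _ _ _ (@area R)
  (prod_sigma_finite (@lebesgue_measure R) (@lebesgue_measure R)).

(** Named so that pairs of points of the plane can in turn be one factor of a product with [cnt], as
    [frame_scale] requires. *)
Definition area2 := (@area R \x @area R)%E.
HB.instance Definition _ := Measure.copy area2 (@area R \x @area R)%E.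
HB.instance Definition _ := Measure_isSigmaFinite.Build _ _ _ area2
  (prod_sigma_finite (@area R) (@area R)).

(* The library registers [counting] on [nat] only as a sigma-finite content. *)
Definition cnt : set nat -> \bar R := counting.
HB.instance Definition _ := Measure.copy cnt (@counting nat R).
HB.instance Definition _ := Measure_isSigmaFinite.Build _ _ _ cnt
  (sigma_finite_counting R).
End Instances.

(** * Real-valued integrals *)

Section RealIntegrable.
Context d (T : measurableType d) {R : realType}.
Variable mu : {measure set T -> \bar R}.
Implicit Types f g h : T -> R.

Definition rint f : Prop := mu.-integrable setT (EFin \o f).

Lemma rint_measurable f : rint f -> measurable_fun setT f.
Proof. by move=> /measurable_int/measurable_EFinP. Qed.

Lemma rint_le f g : measurable_fun setT f -> rint g ->
  (forall x, `|f x| <= g x) -> rint f.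
Proof.
move=> mf ig fg; apply: le_integrable ig => //; first exact/measurable_EFinP.
by move=> x _ /=; rewrite lee_fin (le_trans (fg x))// ler_norm.
Qed.

Lemma rint0 : rint (fun=> 0). Proof. exact: integrable0. Qed.

Lemma rintD f g : rint f -> rint g -> rint (fun x => f x + g x).
Proof. by move=> fi gi; apply: eq_integrable (integrableD _ fi gi). Qed.

Lemma rintB f g : rint f -> rint g -> rint (fun x => f x - g x).
Proof. by move=> fi gi; apply: eq_integrable (integrableB _ fi gi). Qed.

Lemma rintZl k f : rint f -> rint (fun x => k * f x).
Proof. by move=> fi; apply: eq_integrable (integrableZl _ k fi). Qed.

Lemma rintZr k f : rint f -> rint (fun x => f x * k).
Proof. by move=> /(rintZl k); congr rint; apply/funext => x; rewrite mulrC. Qed.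

Lemma rint_norm f : rint f -> rint (fun x => `|f x|).
Proof. exact: integrable_norm. Qed.

Lemma rint_sum (I : Type) (s : seq I) (F : I -> T -> R) :
  (forall i, rint (F i)) -> rint (fun x => \sum_(i <- s) F i x).
Proof.
move=> iF; elim: s => [|i s IH].
  by under eq_fun do rewrite big_nil; exact: rint0.
by under eq_fun do rewrite big_cons; exact: rintD.
Qed.

Lemma rint_fin f : rint f -> (\int[mu]_x (f x)%:E = (\int[mu]_x f x)%:E)%E.
Proof. by move=> fi; rewrite fineK//; exact: integrable_fin_num. Qed.

Lemma int_sum (I : Type) (s : seq I) (F : I -> T -> R) :
  (forall i, rint (F i)) ->
  \int[mu]_x (\sum_(i <- s) F i x) = \sum_(i <- s) \int[mu]_x F i x.
Proof.
move=> iF; elim: s => [|i s IH].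
  by under eq_Rintegral do rewrite big_nil; rewrite Rintegral_cst// mul0r big_nil.
under eq_Rintegral do rewrite big_cons.
by rewrite big_cons -IH -RintegralD//; [exact: iF|exact: (rint_sum s iF)].
Qed.

Lemma rint_of_ge0 f : measurable_fun setT f -> (forall x, 0 <= f x) ->
  (\int[mu]_x (f x)%:E < +oo)%E -> rint f.
Proof.
move=> mf f0 foo; apply/integrableP; split; first exact/measurable_EFinP.
by under eq_integral do rewrite /= ger0_norm//.
Qed.

Lemma rint_dct (F : nat -> T -> R) f g : (forall n, measurable_fun setT (F n)) ->
  (forall x, F ^~ x @ \oo --> f x) -> rint g ->
  (forall n x, `|F n x| <= g x) ->
  rint f /\ (fun n => \int[mu]_x F n x) @ \oo --> \int[mu]_x f x.
Proof.
move=> mF Ff ig Fg.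
have iF n : rint (F n) by apply: rint_le ig _.
have mf : measurable_fun setT f.
  by apply: measurable_fun_cvg => [n|x _]; [exact: mF|exact: Ff].
have [] := @dominated_convergence _ _ _ mu setT measurableT
  (fun n x => (F n x)%:E) (EFin \o f) (EFin \o g).
- by move=> n; exact/measurable_EFinP.
- exact/measurable_EFinP.
- by apply: aeW => x _; apply: cvg_EFin; [exact: nearW|exact: Ff].
- exact: ig.
- by apply: aeW => x n _; rewrite lee_fin.
move=> fi _ cf; split; first exact: fi.
rewrite /Rintegral; apply: fine_cvg.
rewrite fineK; last exact: integrable_fin_num.
exact: cf.
Qed.

End RealIntegrable.

Section RealFubini.
Context d1 d2 (T1 : measurableType d1) (T2 : measurableType d2) {R : realType}.
Variables (m1 : {sigma_finite_measure set T1 -> \bar R})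
  (m2 : {sigma_finite_measure set T2 -> \bar R}).
Implicit Types f : T1 * T2 -> R.

(** Where a section is not integrable, the inner [Rintegral] takes the default value 0. Such points
    form a null set, so the outer integral does not see them. *)
Lemma rint_fubini1 f : rint (m1 \x m2)%E f ->
  rint m1 (fun x => \int[m2]_y f (x, y)) /\
  \int[m1]_x (\int[m2]_y f (x, y)) = \int[(m1 \x m2)%E]_z f z.
Proof.
move=> fi.
have ifF := integrable_fubini_F fi.
have mF : measurable_fun setT (fun x => \int[m2]_y f (x, y)).
  by apply: measurableT_comp => //; exact: (measurable_int m1 ifF).
have ae : {ae m1, forall x, setT x ->
    (EFin \o (fun x => \int[m2]_y f (x, y))) x = fubini_F m2 (EFin \o f) x}.
  apply: filterS (ae_integrable1 fi) => x fx _.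
  by rewrite /= /Rintegral fineK//; exact: integrable_fin_num.
split.
  apply/integrableP; split; first exact/measurable_EFinP.
  rewrite (ae_eq_integral (abse \o (fubini_F m2 (EFin \o f)))) //.
  - by case/integrableP: ifF.
  - by apply: (measurableT_comp (f := abse)) => //; exact/measurable_EFinP.
  - by apply: (measurableT_comp (f := abse)) => //; exact: (measurable_int m1 ifF).
  - by apply: filterS ae => x H Dx; exact: (congr1 abse (H Dx)).
rewrite /Rintegral; congr fine.
rewrite -(integral12_prod_meas1 fi); apply: ae_eq_integral => //.
- exact/measurable_EFinP.
- exact: (measurable_int _ ifF).
Qed.

Lemma rint_prod12 f (g : T1 -> R) : measurable_fun setT f -> rint m1 g ->
  (forall x, rint m2 (fun y => f (x, y)) /\ \int[m2]_y `|f (x, y)| <= g x) ->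
  rint (m1 \x m2)%E f.
Proof.
move=> mf gi fg; apply/integrable12ltyP; first exact/measurable_EFinP.
have /integrableP[_ goo] := gi.
apply: le_lt_trans goo; apply: ge0_le_integral => //.
- by move=> x _; exact: integral_ge0.
- apply: (@measurable_fun_fubini_tonelli_F _ _ _ _ _ m2 (abse \o (EFin \o f))).
    by apply: measurableT_comp => //; exact/measurable_EFinP.
  by move=> z; exact: abse_ge0.
- by apply: (measurableT_comp (f := abse)) => //; exact: (measurable_int m1 gi).
move=> x _; have [fx le] := fg x.
rewrite [leLHS](rint_fin (rint_norm fx)) /= lee_fin.
by apply: le_trans le _; exact: ler_norm.
Qed.

Lemma rint_tensor (f : T1 -> R) (g : T2 -> R) : rint m1 f -> rint m2 g ->
  rint (m1 \x m2)%E (fun z => f z.1 * g z.2).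
Proof.
move=> fi gi; apply: (@rint_prod12 _ (fun x => `|f x| * \int[m2]_y `|g y|)).
- by apply: measurable_funM; [exact: (measurableT_comp (rint_measurable fi) measurable_fst)|exact: (measurableT_comp (rint_measurable gi) measurable_snd)].
- exact/rintZr/rint_norm.
move=> x; split => /=; first exact: rintZl.
under eq_Rintegral do rewrite normrM.
by rewrite RintegralZl//; exact: rint_norm.
Qed.

Lemma int_tensor (f : T1 -> R) (g : T2 -> R) : rint m1 f -> rint m2 g ->
  rint (m1 \x m2)%E (fun z => f z.1 * g z.2) /\
  \int[(m1 \x m2)%E]_z (f z.1 * g z.2) = \int[m1]_x f x * \int[m2]_x g x.
Proof.
move=> fi gi; have ti := rint_tensor fi gi; split=> //.
have [_ <-] := rint_fubini1 ti => /=.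
under eq_Rintegral do rewrite RintegralZl//.
by rewrite RintegralZr.
Qed.

Lemma rint_swap f : rint (m1 \x m2)%E f ->
  rint (m2 \x m1)%E (fun z => f (z.2, z.1)).
Proof.
move=> fi; have mf := rint_measurable fi.
have msw : measurable_fun setT (fun z : T2 * T1 => f (z.2, z.1)).
  apply: (measurableT_comp mf).
  exact: (measurable_fun_pair measurable_snd measurable_fst).
apply/(@integrable12ltyP _ _ _ _ _ m2 m1); first exact/measurable_EFinP.
apply/(@integrable21ltyP _ _ _ _ _ m1 m2 (EFin \o f)) => //.
exact/measurable_EFinP.
Qed.

End RealFubini.

Section RealFubini2.
Context d1 d2 (T1 : measurableType d1) (T2 : measurableType d2) {R : realType}.
Variables (m1 : {sigma_finite_measure set T1 -> \bar R})
  (m2 : {sigma_finite_measure set T2 -> \bar R}).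
Implicit Types f : T1 * T2 -> R.

Lemma rint_fubini2 f : rint (m1 \x m2)%E f ->
  rint m2 (fun y => \int[m1]_x f (x, y)) /\
  \int[m2]_y (\int[m1]_x f (x, y)) = \int[(m1 \x m2)%E]_z f z.
Proof.
move=> fi; have [int e] := rint_fubini1 (rint_swap fi); split=> //.
rewrite e /Rintegral; congr fine.
have := @integral12_prod_meas1 _ _ _ _ _ m2 m1 _ (rint_swap fi).
rewrite /= => <-.
by rewrite -(integral21_prod_meas1 fi).
Qed.

Lemma rint_fubini f : rint (m1 \x m2)%E f ->
  \int[m1]_x (\int[m2]_y f (x, y)) = \int[m2]_y (\int[m1]_x f (x, y)).
Proof. by move=> fi; rewrite (rint_fubini1 fi).2 (rint_fubini2 fi).2. Qed.

End RealFubini2.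

(** * Changes of variables on the line and in the plane *)

Section ScaledChange.
Local Open Scope ereal_scope.
Context d (T : measurableType d) {R : realType}.
Variables (mu : {measure set T -> \bar R}) (phi : T -> T) (c : R).
Hypothesis c0 : (0 < c)%R.
Hypothesis mphi : measurable_fun setT phi.
Hypothesis muphi : forall A, measurable A -> mu A = c%:E * mu (phi @^-1` A).

(** The hypothesis [muphi] says that [mu] is [c] times its own pushforward by [phi]. *)
Lemma ge0_integral_change (f : T -> \bar R) : measurable_fun setT f ->
  (forall x, 0 <= f x) ->
  \int[mu]_x f x = c%:E * \int[mu]_x f (phi x).
Proof.
move=> mf f0.
rewrite (@eq_measure_integral _ _ _ setT (mscale (NngNum (ltW c0)) (pushforward mu phi)) mu).
  by rewrite ge0_integral_mscale// ge0_integral_pushforward.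
by move=> A mA _; rewrite muphi.
Qed.

Lemma rint_change (f : T -> R) : rint mu f ->
  rint mu (f \o phi) /\ Rintegral mu setT f = (c * Rintegral mu setT (f \o phi))%R.
Proof.
move=> fi; have mf := rint_measurable fi.
have fphi : rint mu (f \o phi).
  apply/integrableP; split; first exact/measurable_EFinP/measurableT_comp.
  have /integrableP[_] := fi.
  rewrite (@ge0_integral_change (fun x => `|(EFin \o f) x|)) //; last first.
    by apply: measurableT_comp => //; exact/measurable_EFinP.
  set J := (X in _ * X < _ -> _); move=> h; change (J < +oo).
  rewrite ltey; apply/eqP => Joo; move: h.
  by rewrite Joo gt0_muley ?lte_fin// ltxx.
split=> //; apply: EFin_inj; rewrite EFinM -!rint_fin//.
rewrite integralE [in RHS]integralE muleBr//; last first.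
  exact: (integrable_add_def measurableT fphi).
have mE : measurable_fun setT (fun x => (f x)%:E) by exact/measurable_EFinP.
congr (_ - _); rewrite ge0_integral_change//.
- by congr (_ * _); apply: eq_integral => x _; rewrite !funeposE.
- exact: measurable_funepos.
- by congr (_ * _); apply: eq_integral => x _; rewrite !funenegE.
- exact: measurable_funeneg.
Qed.

End ScaledChange.

Section PlaneChange.
Context {R : realType}.
Local Notation leb := (@lebesgue_measure R).
Local Notation mu := (@area R).
(* [R * R] with the product Borel structure on which [area] is defined. *)
Local Notation pl := (measurableTypeR R * measurableTypeR R)%type.

Lemma measurable_affine (c s : R) :
  measurable_fun (setT : set (measurableTypeR R)) (fun x : measurableTypeR R => c * x + s : measurableTypeR R).
Proof. by apply: measurable_funD => //; exact: measurable_funM. Qed.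

(** Uniqueness of Lebesgue measure: the pushforward by the affine map, scaled by [c], gives
    half-open intervals their length. *)
Lemma leb_affine (c s : R) (c0 : 0 < c) (A : set (measurableTypeR R)) :
  measurable A -> (leb A = c%:E * leb ((fun x => c * x + s)%R @^-1` A))%E.
Proof.
move=> mA.
pose m := mscale (NngNum (ltW c0)) (pushforward leb (fun x : measurableTypeR R => c * x + s : measurableTypeR R)).
have := @lebesgue_measure_unique R (m (measurable_affine c s)); apply => // X [[a b] _ <-].
rewrite /= /mscale /pushforward /=.
rewrite [X in (_ * lebesgue_measure X)%E](_ : _ = `](a - s) / c, (b - s) / c]%classic); last first.
  apply/seteqP; split=> x /=; rewrite !in_itv /= ltr_pdivrMr// ler_pdivlMr// mulrC.
    by rewrite ltrBlDr lerBrDr.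
  by rewrite ltrBlDr lerBrDr.
rewrite !lebesgue_measure_itv /= !lte_fin ltr_pM2r ?invr_gt0// ltrD2r.
case: ifPn => _; last by rewrite mule0.
by rewrite -!EFinB -EFinM; congr EFin; field; rewrite gt_eqF.
Qed.

Lemma leb_opp (A : set (measurableTypeR R)) :
  measurable A -> (leb A = 1%:E * leb ((fun x => - x)%R @^-1` A))%E.
Proof.
move=> mA.
pose m := mscale (NngNum (@ler01 R)) (pushforward leb (fun x : measurableTypeR R => - x : measurableTypeR R)).
have mopp : measurable_fun [set: measurableTypeR R] (fun x : measurableTypeR R => - x : measurableTypeR R).
  exact: (@oppr_measurable R setT).
have := @lebesgue_measure_unique R (m mopp); apply => // X [[a b] _ <-].
rewrite /= /mscale /pushforward /= !mul1e.
(* Reflection exchanges the open and the closed end, without effect on the length. *)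
rewrite [X in (_ = lebesgue_measure X)%E](_ : _ = `[- b, - a[%classic); last first.
  by apply/seteqP; split=> x /=; rewrite !in_itv /= lerNl ltrNr andbC.
rewrite !lebesgue_measure_itv /= !lte_fin ltrN2.
by case: ifPn => // _; rewrite -!EFinB; congr EFin; ring.
Qed.

(** A product measure is determined by its values on rectangles, and there each coordinate
    contributes one factor [c]. *)
Lemma area_change (phi1 phi2 : measurableTypeR R -> measurableTypeR R) (c : R) : 0 < c ->
  measurable_fun setT phi1 -> measurable_fun setT phi2 ->
  (forall A, measurable A -> leb A = c%:E * leb (phi1 @^-1` A))%E ->
  (forall A, measurable A -> leb A = c%:E * leb (phi2 @^-1` A))%E ->
  forall A, measurable A ->
  (mu A = (c ^+ 2)%:E * mu ((fun z => (phi1 z.1, phi2 z.2)) @^-1` A))%E.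
Proof.
move=> c0 m1 m2 h1 h2 A mA.
pose phi (z : measurableTypeR R * measurableTypeR R) := (phi1 z.1, phi2 z.2).
have mphi : measurable_fun setT phi.
  by apply: measurable_fun_pair; apply: measurableT_comp.
pose m := mscale (NngNum (ltW (exprn_gt0 2 c0))) (pushforward mu phi).
have := @product_measure_unique _ _ _ _ _ leb leb (m mphi); apply => // X Y mX mY.
rewrite /= /mscale /pushforward /=.
rewrite [X in (_ * X)%E](_ : _ = (leb \x leb)%E ((phi1 @^-1` X) `*` (phi2 @^-1` Y))) //.
have mX' : measurable (phi1 @^-1` X) by rewrite -[_ @^-1` _]setTI; exact: m1.
have mY' : measurable (phi2 @^-1` Y) by rewrite -[_ @^-1` _]setTI; exact: m2.
rewrite (product_measure1E leb leb) //.
rewrite (h1 X) // (h2 Y) //.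
by rewrite expr2 EFinM muleACA.
Qed.

Definition affine2 (c : R) (s z : pl) : pl := (c * z.1 + s.1, c * z.2 + s.2).
Definition opp2 (z : pl) : pl := (- z.1, - z.2).

Lemma area_affine (c : R) (s : pl) (c0 : 0 < c) A : measurable A ->
  (mu A = (c ^+ 2)%:E * mu (affine2 c s @^-1` A))%E.
Proof.
move=> mA; apply: (area_change c0 (measurable_affine c s.1) (measurable_affine c s.2)) => //.
- exact: leb_affine.
- exact: leb_affine.
Qed.

Lemma area_opp A : measurable A ->
  (mu A = (1 ^+ 2)%:E * mu (opp2 @^-1` A))%E.
Proof.
move=> mA; apply: (@area_change -%R -%R _ (@ltr01 R)) => //; exact: leb_opp.
Qed.

Lemma measurable_affine2 c s : measurable_fun setT (affine2 c s).
Proof.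
by apply: measurable_fun_pair; apply: (measurableT_comp (measurable_affine _ _)).
Qed.

Lemma measurable_opp2 : measurable_fun setT opp2.
Proof. by apply: measurable_fun_pair; apply: measurableT_comp. Qed.

Lemma ge0_integral_affine2 (c : R) s (f : pl -> \bar R) : 0 < c ->
  measurable_fun setT f -> (forall x, 0 <= f x)%E ->
  (\int[mu]_x f (affine2 c s x) = (c ^- 2)%:E * \int[mu]_x f x)%E.
Proof.
move=> c0 mf f0.
rewrite [in RHS](ge0_integral_change (exprn_gt0 2 c0) (measurable_affine2 c s) (area_affine s c0) mf f0).
by rewrite muleA -EFinM /= mulVf ?mul1e// expf_neq0// gt_eqF.
Qed.

Lemma rint_affine2 (c : R) s (f : pl -> R) : 0 < c -> rint mu f ->
  rint mu (fun x => f (affine2 c s x)) /\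
  \int[mu]_x f (affine2 c s x) = c ^- 2 * \int[mu]_x f x.
Proof.
move=> c0 fi.
have [fi' e] := rint_change (exprn_gt0 2 c0) (measurable_affine2 c s) (area_affine s c0) fi.
by split=> //; rewrite e mulrA /= mulVf ?mul1r// expf_neq0// gt_eqF.
Qed.

Lemma rint_opp2 (f : pl -> R) : rint mu f ->
  rint mu (fun x => f (opp2 x)) /\ \int[mu]_x f (opp2 x) = \int[mu]_x f x.
Proof.
move=> fi.
have [fi' e] := rint_change (exprn_gt0 2 ltr01) measurable_opp2 area_opp fi.
by split=> //; rewrite e /= expr1n mul1r.
Qed.

End PlaneChange.

(** * Radial Schwartz functions *)

Section LinearSpan.
Context {R : realType} {T : Type}.
Variable B : (T -> R) -> Prop.

(** Inductive, so that stability of a span under differentiation or under multiplication by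
    monomials need only be verified on generators. *)
Inductive lspan : (T -> R) -> Prop :=
| lspan_base f : B f -> lspan f
| lspan_add f g : lspan f -> lspan g -> lspan (fun x => f x + g x)
| lspan_scale k f : lspan f -> lspan (fun x => k * f x).

End LinearSpan.

Section SmoothLine.
Context {R : realType}.
Implicit Types f g p q : R -> R.

Lemma derive1P f (x : R) d : is_derive x 1 f d -> derive1 f x = d.
Proof. by move=> ?; rewrite derive1E derive_val. Qed.

Lemma is_derive1M f g (x a b : R) : is_derive x 1 f a -> is_derive x 1 g b ->
  is_derive x 1 (fun t => f t * g t) (f x * b + g x * a).
Proof. by move=> fa gb; exact: is_deriveM. Qed.

Lemma is_derive1_chain f g (x a b : R) : is_derive (g x) 1 f a -> is_derive x 1 g b ->
  is_derive x 1 (fun t => f (g t)) (a * b).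
Proof. by move=> fa gb; exact: is_derive1_comp. Qed.

Lemma is_derive1X f m (x a : R) : is_derive x 1 f a ->
  is_derive x 1 (fun t => f t ^+ m) (m%:R * f x ^+ m.-1 * a).
Proof.
move=> fa; rewrite (_ : (fun t => f t ^+ m) = f ^+ m); first exact: is_deriveX.
by apply/funext => y; elim: m => [//|m IH]; rewrite !exprS IH.
Qed.

(** By induction every iterated derivative stays in [P]. With [P] a span stable under
    differentiation, this dispenses with closed formulas for derivatives of order [n]. *)
Lemma smooth_line_closed (P : (R -> R) -> Prop) :
  (forall f, P f -> exists g, P g /\ forall x : R, is_derive x 1 f (g x)) ->
  forall f, P f -> smooth_line f.
Proof.
move=> Pd f Pf n; suff H : P (derive1n n f).
  by move=> x; have [g [_ /(_ x)[]]] := Pd _ H.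
elim: n => [//|n IH]; have [g [Pg dg]] := Pd _ IH.
suff -> : derive1n n.+1 f = g by [].
by apply/funext => x; exact: derive1P.
Qed.

Lemma lspan_derive (B : (R -> R) -> Prop) :
  (forall f, B f -> exists g, lspan B g /\ forall x : R, is_derive x 1 f (g x)) ->
  forall f, lspan B f -> exists g, lspan B g /\ forall x : R, is_derive x 1 f (g x).
Proof.
move=> Bd f; elim => {f} [f /Bd//|f g _ [f' [Pf df]] _ [g' [Pg dg]]|k f _ [f' [Pf df]]].
- exists (fun x => f' x + g' x); split; first exact: lspan_add.
  by move=> x; exact: is_deriveD.
- exists (fun x => k * f' x); split; first exact: lspan_scale.
  by move=> x; exact: is_deriveZ.
Qed.

Lemma smooth_line_derive p (n : nat) (x : R) : smooth_line p ->
  is_derive x 1 (derive1n n p) (derive1n n.+1 p x).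
Proof.
move=> sp; rewrite derive1nS derive1E; apply: derivableP; exact: sp.
Qed.

Lemma smooth_lineM p q : smooth_line p -> smooth_line q ->
  smooth_line (fun x => p x * q x).
Proof.
move=> sp sq.
pose B (f : R -> R) := exists i j, f = fun x => derive1n i p x * derive1n j q x.
apply: (smooth_line_closed (lspan_derive (B := B) _)); last first.
  by apply: lspan_base; exists 0%N, 0%N.
move=> f [i [j ->]].
exists (fun x => derive1n i p x * derive1n j.+1 q x + derive1n i.+1 p x * derive1n j q x).
split; first by apply: lspan_add; apply: lspan_base; [exists i, j.+1|exists i.+1, j].
move=> x; have hp := smooth_line_derive i x sp; have hq := smooth_line_derive j x sq.
refine (is_derive_eq (is_derive1M hp hq) _).
by congr (_ + _); rewrite /= mulrC.
Qed.

Lemma smooth_line_affine p (a b : R) : smooth_line p ->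
  smooth_line (fun x => p (a * x + b)).
Proof.
move=> sp.
pose B (f : R -> R) := exists i, f = fun x => derive1n i p (a * x + b).
apply: (smooth_line_closed (lspan_derive (B := B) _)); last first.
  by apply: lspan_base; exists 0%N.
move=> f [i ->].
exists (fun x => a * derive1n i.+1 p (a * x + b)).
split; first by apply: lspan_scale; apply: lspan_base; exists i.+1.
move=> x; have hp := smooth_line_derive i (a * x + b) sp.
have ha : is_derive x 1 (fun x : R => a * x + b) a.
  refine (is_derive_eq (is_deriveD (is_deriveZ a (is_derive_id x 1)) (is_derive_cst b x 1)) _).
  by rewrite addr0 /GRing.scale /= mulr1.
by refine (is_derive_eq (@is_derive1_chain (derive1n i p) (fun x => a * x + b) _ _ _ hp ha) _); rewrite mulrC.
Qed.

Lemma derive1n_zero_open p (A : set R) : open A -> (forall x, A x -> p x = 0) ->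
  forall n x, A x -> derive1n n p x = 0.
Proof.
move=> oA pA n; elim: n => [|n IH] x Ax; first exact: pA.
rewrite derive1nS; apply: derive1P.
apply: (@near_eq_is_derive _ _ _ (cst 0)).
  by near=> y; rewrite IH//; near: y; exact: open_nbhs_nbhs.
Unshelve. all: by end_near. Qed.

Lemma derive1n_cst_open p (A : set R) (k : R) : open A ->
  (forall x, A x -> p x = k) -> forall n x, A x -> derive1n n.+1 p x = 0.
Proof.
move=> oA pA n x Ax; rewrite derive1Sn; move: x Ax; apply: derive1n_zero_open => // x Ax.
apply: derive1P.
apply: (@near_eq_is_derive _ _ _ (cst k)).
  by near=> y; rewrite pA//; near: y; exact: open_nbhs_nbhs.
Unshelve. all: by end_near. Qed.

(** The square root fails to be smooth at 0 only, and around that point the composite is constant: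
    [Num.sqrt] is 0 on negative numbers, so every [t < r ^+ 2] is sent below [r]. For larger [t] the
    derivatives are combinations of the functions [E n m], which vanish on [t < r ^+ 2] because [p]
    is constant below [r]. *)
Lemma smooth_line_sqrt p (r k : R) : smooth_line p -> 0 < r ->
  (forall x, x < r -> p x = k) -> smooth_line (fun t => p (Num.sqrt t)).
Proof.
move=> sp r0 pk.
have p0 n x : x < r -> derive1n n.+1 p x = 0.
  exact: (@derive1n_cst_open p _ k (@open_lt _ r) pk n x).
have sqrt_lt (t : R) : t < r ^+ 2 -> Num.sqrt t < r.
  move=> tr; have -> : r = Num.sqrt (r ^+ 2) by rewrite sqrtr_sqr gtr0_norm.
  by rewrite ltr_sqrt// exprn_gt0.
pose E n m t := derive1n n.+1 p (Num.sqrt t) * (Num.sqrt t)^-1 ^+ m.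
pose B (f : R -> R) := f = (fun t => p (Num.sqrt t)) \/ exists n m, f = E n m.
have E0 n m t : t < r ^+ 2 -> E n m t = 0.
  by move=> /sqrt_lt tr; rewrite /E p0// mul0r.
have r20 : 0 < r ^+ 2 by rewrite exprn_gt0.
have olt : open [set t : R | t < r ^+ 2] by exact: open_lt.
apply: (smooth_line_closed (lspan_derive (B := B) _)); last first.
  by apply: lspan_base; left.
move=> f [->|[n [m ->]]].
  exists (fun t => 2^-1 * E 0%N 1%N t); split.
    by apply: lspan_scale; apply: lspan_base; right; exists 0%N, 1%N.
  move=> t; have [tr|tr] := ltP t (r ^+ 2).
    rewrite E0// mulr0.
    apply: (@near_eq_is_derive _ _ _ (cst k)).
      near=> y; rewrite pk//; apply: sqrt_lt; near: y.
      exact: (open_nbhs_nbhs (conj olt tr)).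
  have t0 : 0 < t by rewrite (lt_le_trans r20).
  have h1 := is_derive1_sqrt t0.
  have h2 := smooth_line_derive 0 (Num.sqrt t) sp.
  refine (is_derive_eq (@is_derive1_chain _ Num.sqrt _ _ _ h2 h1) _).
  by rewrite /E expr1 invfM; ring.
exists (fun t => 2^-1 * E n.+1 m.+1 t + (- m%:R * 2^-1) * E n m.+2 t); split.
  by apply: lspan_add; apply: lspan_scale; apply: lspan_base; right;
    [exists n.+1, m.+1|exists n, m.+2].
move=> t; have [tr|tr] := ltP t (r ^+ 2).
  rewrite !E0// !mulr0 addr0.
  apply: (@near_eq_is_derive _ _ _ (cst 0)).
    near=> y; rewrite E0//; near: y.
    exact: (open_nbhs_nbhs (conj olt tr)).
have t0 : 0 < t by rewrite (lt_le_trans r20).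
have h1 := is_derive1_sqrt t0.
have s0 : Num.sqrt t != 0 by rewrite gt_eqF// sqrtr_gt0.
have h2 := smooth_line_derive n.+1 (Num.sqrt t) sp.
have h3 : is_derive t 1 (fun t => (Num.sqrt t)^-1) (- (Num.sqrt t) ^- 2 * (2 * Num.sqrt t)^-1).
  exact: (@is_deriveV _ Num.sqrt _ _ _ s0 h1).
have h4 : is_derive t 1 (fun t => (Num.sqrt t)^-1 ^+ m)
   (m%:R * (Num.sqrt t)^-1 ^+ m.-1 * (- (Num.sqrt t) ^- 2 * (2 * Num.sqrt t)^-1)).
  exact: is_derive1X h3.
have h5 : is_derive t 1 (fun t => derive1n n.+1 p (Num.sqrt t))
   (derive1n n.+2 p (Num.sqrt t) * (2 * Num.sqrt t)^-1).
  exact: (@is_derive1_chain _ Num.sqrt _ _ _ h2 h1).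
refine (is_derive_eq (is_derive1M h5 h4) _).
rewrite /E; move: (derive1n n.+1 p _) (derive1n n.+2 p _) => u v.
rewrite !invfM; move: (Num.sqrt t)^-1 => s.
case: m h4 => [|m] _; rewrite ?[0.-1]/= ?[m.+1.-1]/=; first by rewrite !expr0; ring.
by rewrite !exprS; ring.
Unshelve. all: by end_near. Qed.

End SmoothLine.

Section Radial.
Context {R : realType}.
Local Notation pl := (measurableTypeR R * measurableTypeR R)%type.
Variables (q : R -> R) (r : R).
Hypothesis sq : smooth_line q.
Hypothesis r0 : 0 < r.
Hypothesis qr : forall t, r ^+ 2 < t -> q t = 0.
Implicit Types f g : pl -> R.

(* The span is stable under partial derivatives and monomial factors, so that
   continuity, support and boundedness of its elements give the Schwartz bounds. *)
Definition radial_base f := exists n i j, f = fun z : pl =>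
  z.1 ^+ i * z.2 ^+ j * derive1n n q (z.1 ^+ 2 + z.2 ^+ 2).
Definition radial := lspan radial_base.

(** The two difference quotients coincide as functions of [h]; the rules for one variable thus carry
    over to partial derivatives. *)
Lemma is_derive_slice (f : R * R -> R) (b : bool) (z : R * R) (d : R) :
  is_derive (if b then z.2 else z.1) 1
    (fun t => f (if b then (z.1, t) else (t, z.2))) d ->
  is_derive z (axis b) f d.
Proof.
case: z => x y H.
have E : (fun h : R => h^-1 *: ((f \o shift (x, y)) (h *: axis b) - f (x, y))) =
  (fun h : R => h^-1 *: (((fun t => f (if b then (x, t) else (t, y))) \o shift (if b then y else x)) (h *: (1 : R)) -
     f (if b then (x, (if b then y else x)) else ((if b then y else x), y)))).
  apply/funext => h; congr (_ *: (f _ - f _)).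
  - case: (b); rewrite /= /shift.
      transitivity ((h * 0 + x, h * 1 + y) : R * R); first by [].
      by rewrite mulr0 add0r.
    transitivity ((h * 1 + x, h * 0 + y) : R * R); first by [].
    by rewrite mulr0 add0r.
  - by case: (b).
case: H => H1 H2; split.
  by rewrite /derivable E.
rewrite -H2 /derive E //.
Qed.

Lemma derive1n_ge0_vanish n t : r ^+ 2 < t -> derive1n n q t = 0.
Proof. exact: (@derive1n_zero_open _ q _ (@open_gt _ (r ^+ 2)) qr n t). Qed.

Lemma derive1n_continuous n : continuous (derive1n n q).
Proof.
move=> x; apply: differentiable_continuous; apply/derivable1_diffP; exact: sq.
Qed.

(** The range [0 <= t] is the relevant one, the argument being [z.1 ^+ 2 + z.2 ^+ 2]: the extreme
    value theorem covers [t <= r ^+ 2], and beyond it the derivatives vanish. *)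
Lemma derive1n_bounded n : exists M, forall t, 0 <= t -> `|derive1n n q t| <= M.
Proof.
have r20 : 0 <= r ^+ 2 by rewrite exprn_ge0// ltW.
have cq : {within `[0, r ^+ 2], continuous (fun t => `|derive1n n q t|)}.
  apply: continuous_subspaceT => x; apply: continuous_comp; first exact: derive1n_continuous.
  exact: norm_continuous.
have [c _ cmax] := EVT_max r20 cq.
exists `|derive1n n q c| => t t0; have [tr|tr] := leP t (r ^+ 2).
  by apply: cmax; rewrite in_itv /= t0 tr.
by rewrite derive1n_ge0_vanish// normr0.
Qed.

Lemma radial_derive f : radial f -> forall b, exists2 g, radial g &
  forall z : R * R, is_derive z (axis b) f (g z).
Proof.
move=> rf b; elim: rf => {f} [f [n [i [j ->]]]|f g _ [f' Pf df] _ [g' Pg dg]|k f _ [f' Pf df]].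
- pose B n i j : pl -> R := fun z =>
    z.1 ^+ i * z.2 ^+ j * derive1n n q (z.1 ^+ 2 + z.2 ^+ 2).
  (* Leibniz and chain rule. When the exponent is 0 its coefficient vanishes, so the truncated
     predecessor does no harm. *)
  exists (fun z => if b then j%:R * B n i j.-1 z + 2 * B n.+1 i j.+1 z
    else i%:R * B n i.-1 j z + 2 * B n.+1 i.+1 j z).
    by case: b; apply: lspan_add; apply: lspan_scale; apply: lspan_base;
      do 3 eexists.
  move=> [x y]; apply: is_derive_slice.
  have hq : is_derive (x ^+ 2 + y ^+ 2) 1 (derive1n n q) (derive1n n.+1 q (x ^+ 2 + y ^+ 2)).
    exact: smooth_line_derive.
  case: b; rewrite /B [(_, _).1]/= [(_, _).2]/=.
  - have h1 := is_derive1X 2 (is_derive_id y (1 : R)).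
    have h2 : is_derive y 1 (fun t => x ^+ 2 + t ^+ 2) (2 * y).
      refine (is_derive_eq (is_deriveD (is_derive_cst (x ^+ 2) y 1) h1) _).
      by rewrite add0r expr1 mulr1.
    have h3 := @is_derive1_chain _ _ (fun t => x ^+ 2 + t ^+ 2) _ _ _ hq h2.
    have h4 := is_derive1X j (is_derive_id y (1 : R)).
    have h5 := is_derive1M (is_derive_cst (x ^+ i) y 1) h4.
    refine (is_derive_eq (is_derive1M h5 h3) _).
    rewrite /cst /=.
    by case: j {h4 h5} => [|j] /=; rewrite ?exprS; ring.
  - have h1 := is_derive1X 2 (is_derive_id x (1 : R)).
    have h2 : is_derive x 1 (fun t => t ^+ 2 + y ^+ 2) (2 * x).
      refine (is_derive_eq (is_deriveD h1 (is_derive_cst (y ^+ 2) x 1)) _).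
      by rewrite addr0 expr1 mulr1.
    have h3 := @is_derive1_chain _ _ (fun t => t ^+ 2 + y ^+ 2) _ _ _ hq h2.
    have h4 := is_derive1X i (is_derive_id x (1 : R)).
    have h5 := is_derive1M h4 (is_derive_cst (y ^+ j) x 1).
    refine (is_derive_eq (is_derive1M h5 h3) _).
    rewrite /cst /=.
    by case: i {h4 h5} => [|i] /=; rewrite ?exprS; ring.
- exists (fun z => f' z + g' z); first exact: lspan_add.
  by move=> z; exact: is_deriveD.
- exists (fun z => k * f' z); first exact: lspan_scale.
  by move=> z; exact: is_deriveZ.
Qed.

Lemma radial_continuous f : radial f -> continuous (f : R * R -> R).
Proof.
have c1 i : continuous (fun z : R * R => z.1 ^+ i).
  move=> z; apply: (@continuous_comp _ _ _ fst (fun t : R => t ^+ i)).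
    exact: cvg_fst.
  exact: exprn_continuous.
have c2 i : continuous (fun z : R * R => z.2 ^+ i).
  move=> z; apply: (@continuous_comp _ _ _ snd (fun t : R => t ^+ i)).
    exact: cvg_snd.
  exact: exprn_continuous.
elim => {f} [f [n [i [j ->]]]|f g _ cf _ cg|k f _ cf] z.
- apply: cvgM; first by apply: cvgM; [exact: c1|exact: c2].
  apply: (@continuous_comp _ _ _ (fun z : R * R => z.1 ^+ 2 + z.2 ^+ 2)).
    by apply: cvgD; [exact: c1|exact: c2].
  exact: derive1n_continuous.
- by apply: cvgD; [exact: cf|exact: cg].
- by apply: cvgM; [exact: cvg_cst|exact: cf].
Qed.

Lemma radial_measurable f : radial f -> measurable_fun setT f.
Proof.
have mq n : measurable_fun setT (derive1n n q).
  exact: continuous_measurable_fun (@derive1n_continuous n).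
elim => {f} [f [n [i [j ->]]]|f g _ cf _ cg|k f _ cf].
- apply: measurable_funM.
    by apply: measurable_funM; apply: measurable_funX; [exact: measurable_fst|exact: measurable_snd].
  apply: (measurableT_comp (mq n)).
  by apply: measurable_funD; apply: measurable_funX; [exact: measurable_fst|exact: measurable_snd].
- exact: measurable_funD.
- exact: measurable_funM.
Qed.

(** The supporting disc is enlarged to the circumscribed square, since the later estimates proceed
    coordinate by coordinate. *)
Lemma radial_support f : radial f -> forall z, ~~ ((`|z.1| <= r) && (`|z.2| <= r)) -> f z = 0.
Proof.
elim => {f} [f [n [i [j ->]]]|f g _ cf _ cg|k f _ cf] z rz.
- rewrite derive1n_ge0_vanish ?mulr0//.
  move: rz; rewrite negb_and -!ltNge => /orP[h|h].
    apply: lt_le_trans (_ : z.1 ^+ 2 <= _); last by rewrite lerDl sqr_ge0.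
    by rewrite -[ltRHS]real_normK ?num_real// ltr_pXn2r ?nnegrE// ltW.
  apply: lt_le_trans (_ : z.2 ^+ 2 <= _); last by rewrite lerDr sqr_ge0.
  by rewrite -[ltRHS]real_normK ?num_real// ltr_pXn2r ?nnegrE// ltW.
- by rewrite cf// cg// addr0.
- by rewrite cf// mulr0.
Qed.

Lemma radial_bounded f : radial f -> exists2 M, 0 <= M & forall z, `|f z| <= M.
Proof.
elim => {f} [f [n [i [j ->]]]|f g _ [M M0 bf] _ [N N0 bg]|k f _ [M M0 bf]].
- have [M bM] := derive1n_bounded n.
  have M0 : 0 <= M by exact: le_trans (bM 0 (lexx _)).
  exists (r ^+ i * r ^+ j * M); first by rewrite !mulr_ge0// exprn_ge0// ltW.
  move=> z; have [/andP[h1 h2]|rz] := boolP ((`|z.1| <= r) && (`|z.2| <= r)).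
    rewrite !normrM !normrX ler_pM ?mulr_ge0 ?exprn_ge0//.
      by rewrite ler_pM ?exprn_ge0// lerXn2r ?nnegrE// ltW.
    by apply: bM; rewrite addr_ge0 ?sqr_ge0.
  have rf : radial (fun z => z.1 ^+ i * z.2 ^+ j * derive1n n q (z.1 ^+ 2 + z.2 ^+ 2)).
    by apply: lspan_base; exists n, i, j.
  by rewrite (radial_support rf rz) normr0 !mulr_ge0// exprn_ge0// ltW.
- exists (M + N); first exact: addr_ge0.
  by move=> z; rewrite (le_trans (ler_normD _ _))// lerD.
- exists (`|k| * M); first by rewrite mulr_ge0.
  by move=> z; rewrite normrM ler_pM.
Qed.

Lemma radial_monomial f i j : radial f -> radial (fun z => z.1 ^+ i * z.2 ^+ j * f z).
Proof.
elim => {f} [f [n [k [l ->]]]|f g _ cf _ cg|k f _ cf].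
- apply: lspan_base; exists n, (i + k)%N, (j + l)%N; apply/funext => z.
  by rewrite !exprD; ring.
- by have := lspan_add cf cg; congr lspan; apply/funext => z; ring.
- by have := lspan_scale k cf; congr lspan; apply/funext => z; ring.
Qed.

Lemma radial_partials f : radial f -> forall w, radial (partials w f).
Proof.
move=> rf; elim => [//|b w IH] /=.
have [g rg dg] := radial_derive IH b.
suff -> : 'D_(axis b) (partials w f) = g by [].
by apply/funext => z; exact: derive_val.
Qed.

Lemma radial_schwartz f : radial f -> real_schwartz f.
Proof.
move=> rf; split.
  move=> w; have rw := radial_partials rf w; split; first exact: radial_continuous.
  by move=> b z; have [g _ dg] := radial_derive rw b; have [] := dg z.
move=> w m n; have rw := radial_monomial m n (radial_partials rf w).
by have [M _ bM] := radial_bounded rw; exists M.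
Qed.

End Radial.

(** * The annular window and the low-pass profile *)

Section Windows.
Context {R : realType}.
Local Notation pl := (measurableTypeR R * measurableTypeR R)%type.
Variables (theta : R -> R) (a delta : R).
Hypothesis theta_smooth : smooth_line theta.
Hypothesis theta0 : forall x : R, x <= -1 -> theta x = 0.
Hypothesis theta1 : forall x : R, 1 <= x -> theta x = 1.
Hypothesis theta_sq : forall x : R, theta x ^+ 2 + theta (- x) ^+ 2 = 1.
Hypothesis a_gt0 : 0 < a.
Hypothesis delta_gt0 : 0 < delta.
Hypothesis delta_a : 2 * delta < a.

(** The two transitions of the window lie on disjoint intervals, so its case distinction can be
    traded for a product, whose smoothness is immediate. *)
Definition ring_profile (x : R) := theta ((x - a) / (delta / 2)) * theta ((2 * a - x) / delta).
(** The outer flank of the window, squared and continued by 1 towards the origin. *)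
Definition low_profile (x : R) := theta ((2 * a - x) / delta) ^+ 2.
Definition low_pass (z : pl) : R := low_profile (Num.sqrt (z.1 ^+ 2 + z.2 ^+ 2)).

Ltac slra := have := a_gt0; have := delta_gt0; have := delta_a; intros; lra.

Let d2 : 0 < delta / 2. Proof. by rewrite divr_gt0. Qed.

Lemma ge1_div (d x : R) : 0 < d -> d <= x -> 1 <= x / d.
Proof. by move=> d0 dx; rewrite ler_pdivlMr// mul1r. Qed.

Lemma leN1_div (d x : R) : 0 < d -> x <= - d -> x / d <= -1.
Proof. by move=> d0 dx; rewrite ler_pdivrMr// mulN1r. Qed.

Lemma window_ring_profile x : window theta a (2 * a) (delta / 2) delta x = ring_profile x.
Proof.
rewrite /window /ring_profile; case: (ltP x (a + delta / 2)) => h1.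
  rewrite [theta (_ / delta)]theta1 ?mulr1//; apply: ge1_div => //. slra.
rewrite [theta ((x - a) / _)]theta1 ?mul1r; last by apply: ge1_div => //; slra.
case: (leP x (2 * a - delta)) => h2 //.
by rewrite theta1//; apply: ge1_div => //; slra.
Qed.

Lemma smooth_ring_profile : smooth_line ring_profile.
Proof.
have s1 := @smooth_line_affine _ theta (delta / 2)^-1 (- a / (delta / 2)) theta_smooth.
have s2 := @smooth_line_affine _ theta (- delta^-1) (2 * a / delta) theta_smooth.
have := smooth_lineM s1 s2; congr smooth_line; apply/funext => x.
rewrite /ring_profile; congr (theta _ * theta _); ring.
Qed.

Lemma smooth_low_profile : smooth_line low_profile.
Proof.
have s2 := @smooth_line_affine _ theta (- delta^-1) (2 * a / delta) theta_smooth.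
have := smooth_lineM s2 s2; congr smooth_line; apply/funext => x.
rewrite /low_profile expr2; congr (theta _ * theta _); ring.
Qed.

Lemma ring_profile_lo x : x <= a - delta / 2 -> ring_profile x = 0.
Proof.
by move=> h; rewrite /ring_profile theta0 ?mul0r//; apply: leN1_div => //; slra.
Qed.

Lemma ring_profile_hi x : 2 * a + delta <= x -> ring_profile x = 0.
Proof.
by move=> h; rewrite /ring_profile mulrC theta0 ?mul0r//; apply: leN1_div => //; slra.
Qed.

Lemma low_profile_lo x : x <= 2 * a - delta -> low_profile x = 1.
Proof.
by move=> h; rewrite /low_profile theta1 ?expr1n//; apply: ge1_div => //; slra.
Qed.

Lemma low_profile_hi x : 2 * a + delta <= x -> low_profile x = 0.
Proof.
by move=> h; rewrite /low_profile theta0 ?expr0n//; apply: leN1_div => //; slra.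
Qed.

(** This explains the unequal widths: replacing [x] by [2 * x] moves the outer transition, at
    [2 * a] with width [delta], onto the inner one, at [a] with width [delta / 2], in reversed
    direction. There [theta_sq] makes the two squares complementary; further out
    [low_profile (2 * x)] has already vanished. *)
Lemma ring_profile_sq x : ring_profile x ^+ 2 = low_profile x - low_profile (2 * x).
Proof.
rewrite /ring_profile /low_profile exprMn.
have [h|h] := leP (a + delta / 2) x.
  rewrite theta1 ?expr1n ?mul1r; last by apply: ge1_div => //; slra.
  rewrite [theta ((2 * a - 2 * x) / _)]theta0 ?expr0n ?subr0//.
  by apply: leN1_div => //; slra.
rewrite [theta ((2 * a - x) / _)]theta1; last by apply: ge1_div => //; slra.
rewrite expr1n mulr1 (_ : (2 * a - 2 * x) / delta = - ((x - a) / (delta / 2))).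
  by apply: (canRL (addrK _)); exact: theta_sq.
by field; rewrite gt_eqF.
Qed.

Lemma psi_hatE z : psi_hat theta a delta z = ring_profile (Num.sqrt (z.1 ^+ 2 + z.2 ^+ 2)).
Proof. exact: window_ring_profile. Qed.

Lemma psi_hat_sq (z : R * R) : psi_hat theta a delta z ^+ 2 =
  low_pass z - low_pass (2 * z.1, 2 * z.2).
Proof.
rewrite psi_hatE ring_profile_sq /low_pass; congr (_ - low_profile _) => /=.
rewrite !exprMn -mulrDr sqrtrM ?exprn_ge0//.
by rewrite sqrtr_sqr ger0_norm.
Qed.

Lemma sqrt_hi (t : R) : (2 * a + delta) ^+ 2 < t -> 2 * a + delta <= Num.sqrt t.
Proof.
move=> h; have r0 : 0 <= 2 * a + delta by slra.
rewrite -[leLHS]ger0_norm// -sqrtr_sqr ler_wsqrtr//; exact: ltW.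
Qed.

Lemma smooth_ring_sqrt : smooth_line (fun t => ring_profile (Num.sqrt t)).
Proof.
apply: (@smooth_line_sqrt _ _ (a - delta / 2) 0) smooth_ring_profile _ _; first by slra.
by move=> x h; rewrite ring_profile_lo// ltW.
Qed.

Lemma smooth_low_sqrt : smooth_line (fun t => low_profile (Num.sqrt t)).
Proof.
apply: (@smooth_line_sqrt _ _ (2 * a - delta) 1) smooth_low_profile _ _; first by slra.
by move=> x h; rewrite low_profile_lo// ltW.
Qed.

Lemma radial_psi_hat : radial (fun t => ring_profile (Num.sqrt t)) (psi_hat theta a delta).
Proof.
apply: lspan_base; exists 0%N, 0%N, 0%N; apply/funext => z.
by rewrite psi_hatE !expr0 !mul1r.
Qed.

Lemma radial_low_pass : radial (fun t => low_profile (Num.sqrt t)) low_pass.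
Proof.
apply: lspan_base; exists 0%N, 0%N, 0%N; apply/funext => z.
by rewrite !expr0 !mul1r.
Qed.

Lemma low_pass0 : low_pass (0, 0) = 1.
Proof.
rewrite /low_pass /= expr0n /= addr0 sqrtr0 low_profile_lo//; slra.
Qed.

End Windows.

(** * Cosine transforms *)

Section VanishingIntegral.
Context {R : realType}.
Local Notation leb := (@lebesgue_measure R).

Lemma int_derive_compact (g g' : R -> R) (r : R) : 0 < r ->
  (forall x : R, is_derive x 1 g (g' x)) -> continuous g' ->
  (forall x, r <= `|x| -> g x = 0) -> (forall x, r <= `|x| -> g' x = 0) ->
  \int[leb]_x g' x = 0.
Proof.
move=> r0 dg cg' g0 g'0.
have E : \int[leb]_x g' x = \int[leb]_(x in `[- r, r]%classic) g' x.
  rewrite [RHS]Rintegral_mkcond; congr Rintegral; apply/funext => x; rewrite patchE.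
  case: ifPn => //; rewrite notin_setE /= in_itv /= => h; rewrite g'0// leNgt.
  by apply/negP => /ltW; rewrite ler_norml => /h.
have cg : continuous g.
  by move=> x; apply: differentiable_continuous; apply/derivable1_diffP; case: (dg x).
rewrite E /Rintegral (@continuous_FTC2 _ g' g)//.
- by rewrite !g0 ?normrN ?ger0_norm ?subee// ltW.
- lra.
- exact: continuous_subspaceT.
- split.
  + by move=> x _; case: (dg x).
  + exact/cvg_at_right_filter/cg.
  + exact/cvg_at_left_filter/cg.
- by move=> x _; rewrite derive1E derive_val.
Qed.

End VanishingIntegral.

Section Cosft.
Context {R : realType}.
Local Notation leb := (@lebesgue_measure R).
Local Notation mu := (@area R).
Local Notation pl := (measurableTypeR R * measurableTypeR R)%type.

Definition dot2 (x y : pl) : R := x.1 * y.1 + x.2 * y.2.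
(* The inverse Fourier transform of a real even function. *)
Definition cosft (h : pl -> R) (x : pl) : R := \int[mu]_y (h y * cos (2 * pi * dot2 x y)).

Lemma measurable_cos : measurable_fun setT (@cos R).
Proof. exact: continuous_measurable_fun (@continuous_cos R). Qed.

Lemma measurable_dot2 x : measurable_fun setT (dot2 x).
Proof.
by apply: measurable_funD; apply: measurable_funM.
Qed.

Lemma measurable_cos_dot2 (c d : R) x :
  measurable_fun setT (fun y : pl => cos (c * dot2 x y + d)).
Proof.
apply: (measurableT_comp measurable_cos); apply: measurable_funD => //.
by apply: measurable_funM => //; exact: measurable_dot2.
Qed.

Lemma rint_itv (r : R) : rint leb (\1_(`[- r, r]%classic : set (measurableTypeR R)) : R -> R).
Proof. exact: integrable_indic_itv. Qed.

Lemma rint_box (f : pl -> R) (r M : R) : measurable_fun setT f ->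
  (forall z, `|f z| <= M) ->
  (forall z : pl, ~~ ((`|z.1| <= r) && (`|z.2| <= r)) -> f z = 0) -> rint mu f.
Proof.
move=> mf fM f0.
have := rintZl M (rint_tensor (rint_itv r) (rint_itv r)).
move/(rint_le mf); apply => z; rewrite !indicE !mem_setE !in_itv /= -!ler_norml.
have [h|h] := boolP ((`|z.1| <= r) && (`|z.2| <= r)).
  by have /andP[-> ->] := h; rewrite !mulr1.
rewrite f0// normr0; have := h; rewrite negb_and => /orP[] /negbTE ->;
  by rewrite ?mul0r ?mulr0.
Qed.

Lemma rint_mul_cos (f : pl -> R) (c d : R) x : rint mu f ->
  rint mu (fun y => f y * cos (c * dot2 x y + d)).
Proof.
move=> fi; apply: rint_le (rint_norm fi) _.
  apply: measurable_funM; first exact: (rint_measurable fi).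
  exact: measurable_cos_dot2.
by move=> y; rewrite normrM ler_piMr// cos_max.
Qed.

Lemma rint_mul_cos0 (f : pl -> R) (c : R) x : rint mu f ->
  rint mu (fun y => f y * cos (c * dot2 x y)).
Proof. by move/(rint_mul_cos c 0 x); congr rint; apply/funext => y; rewrite addr0. Qed.

Lemma cosft_le (f : pl -> R) x : rint mu f -> `|cosft f x| <= \int[mu]_y `|f y|.
Proof.
move=> fi; have fc := rint_mul_cos0 (2 * pi) x fi.
apply: le_trans (le_normr_Rintegral measurableT fc) _.
apply: le_Rintegral => //; [exact: rint_norm|exact: rint_norm|].
by move=> y _; rewrite normrM ler_piMr// cos_max.
Qed.

Variables (q : R -> R) (r : R).
Hypothesis sq : smooth_line q.
Hypothesis r0 : 0 < r.
Hypothesis qr : forall t, r ^+ 2 < t -> q t = 0.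
Implicit Types f g : pl -> R.

Lemma radial_rint f : radial q f -> rint mu f.
Proof.
move=> rf; have [M _ bM] := radial_bounded sq r0 qr rf.
apply: (rint_box (radial_measurable sq rf) bM); exact: (radial_support r0 qr rf).
Qed.

Definition slice (b : bool) (z t : R) : pl := if b then (z, t) else (t, z).

(** The passage converse to [is_derive_slice], by the same identity of difference quotients. *)
Lemma radial_slice_derive f g b (z t : R) : (forall z : R * R, is_derive z (axis b) f (g z)) ->
  is_derive t 1 (fun t => f (slice b z t)) (g (slice b z t)).
Proof.
move=> dfg; case: (dfg (slice b z t)) => H1 H2.
have E : (fun h : R => h^-1 *: (((f : R * R -> R) \o shift (slice b z t : R * R)) (h *: axis b) - f (slice b z t))) =
  (fun h : R => h^-1 *: (((fun t => f (slice b z t)) \o shift t) (h *: (1 : R)) - f (slice b z t))).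
  apply/funext => h; congr (_ *: (f _ - f _)); rewrite /slice; case: (b); rewrite /= /shift.
    transitivity ((h * 0 + z, h * 1 + t) : R * R); first by [].
    by rewrite mulr0 add0r.
  transitivity ((h * 1 + t, h * 0 + z) : R * R); first by [].
  by rewrite mulr0 add0r.
split; first by rewrite /derivable -E.
by rewrite -H2 /derive -E.
Qed.

Lemma radial_slice_continuous f b (z : R) : radial q f -> continuous (fun t : R => f (slice b z t)).
Proof.
move=> rf t; apply: (@continuous_comp _ _ _ (slice b z : R -> R * R) (f : R * R -> R)).
  by rewrite /slice; case: (b); apply: (@cvg_pair _ _ _ _ (nbhs _) (nbhs _)); [exact: cvg_cst|exact: cvg_id|exact: cvg_id|exact: cvg_cst].
exact: (radial_continuous sq rf).
Qed.

(** Two integrations by parts at once: along the slice the integrand is the derivative of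
    [c * f * sin + g * cos], which has compact support; the terms in [c * g * sin] cancel. *)
Lemma slice_ibp f g k b (z c d : R) : radial q f -> radial q g -> radial q k ->
  (forall z : R * R, is_derive z (axis b) f (g z)) ->
  (forall z : R * R, is_derive z (axis b) g (k z)) ->
  \int[leb]_t ((c ^+ 2 * f (slice b z t) + k (slice b z t)) * cos (c * t + d)) = 0.
Proof.
move=> rf rg rk df dg.
pose F t := c * (f (slice b z t) * sin (c * t + d)) + g (slice b z t) * cos (c * t + d).
have dl (t : R) : is_derive t 1 (fun t : R => c * t + d) c.
  refine (is_derive_eq (is_deriveD (is_deriveZ c (is_derive_id t 1)) (is_derive_cst d t 1)) _).
  by rewrite addr0 /GRing.scale /= mulr1.
have dsin (t : R) := @is_derive1_chain _ sin (fun t => c * t + d) t _ _ (is_derive_sin _) (dl t).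
have dcos (t : R) := @is_derive1_chain _ cos (fun t => c * t + d) t _ _ (is_derive_cos _) (dl t).
(* The margin 1 supplies the strict inequality that [radial_support] asks for. *)
have supp h : radial q h -> forall t, r + 1 <= `|t| -> h (slice b z t) = 0.
  move=> rh t tr; apply: (radial_support r0 qr rh); rewrite /slice.
  have tr' : (`|t| <= r) = false by apply/negbTE; rewrite -ltNge; lra.
  by case: (b) => /=; rewrite tr' ?andbF.
apply: (@int_derive_compact _ F _ (r + 1)); first by have := r0; intros; lra.
- move=> t.
  have d1 := is_derive1M (radial_slice_derive z t df) (dsin t).
  have d2 := is_derive1M (radial_slice_derive z t dg) (dcos t).
  refine (is_derive_eq (is_deriveD (is_deriveZ c d1) d2) _).
  by rewrite /GRing.scale /=; ring.
- move=> t; apply: cvgM.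
    by apply: cvgD; [apply: cvgM; [exact: cvg_cst|]|]; exact: radial_slice_continuous.
  apply: (@continuous_comp _ _ _ (fun t : R => c * t + d) cos); last exact: continuous_cos.
  by apply: cvgD; [apply: cvgM; [exact: cvg_cst|exact: cvg_id]|exact: cvg_cst].
- by move=> t tr; rewrite /F !supp// !mul0r mulr0 addr0.
- by move=> t tr; rewrite !supp// mulr0 addr0 mul0r.
Qed.

(** Fubini with the variable of differentiation innermost, so that [slice_ibp] applies; the other
    variable enters only through the phase [d]. *)
Lemma cosft_ibp f g k b x : radial q f -> radial q g -> radial q k ->
  (forall z : R * R, is_derive z (axis b) f (g z)) ->
  (forall z : R * R, is_derive z (axis b) g (k z)) ->
  (2 * pi * (if b then x.2 else x.1)) ^+ 2 * cosft f x = - cosft k x.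
Proof.
move=> rf rg rk df dg; apply/eqP; rewrite -addr_eq0; apply/eqP.
have fi := rint_mul_cos0 (2 * pi) x (radial_rint rf).
have ki := rint_mul_cos0 (2 * pi) x (radial_rint rk).
set c := 2 * pi * _.
have si : rint mu (fun y => (c ^+ 2 * f y + k y) * cos (2 * pi * dot2 x y)).
  have := rintD (rintZl (c ^+ 2) fi) ki; congr rint; apply/funext => y; ring.
transitivity (\int[mu]_y ((c ^+ 2 * f y + k y) * cos (2 * pi * dot2 x y))).
  rewrite /cosft -RintegralZl// -RintegralD//; last exact: rintZl.
  by congr Rintegral; apply/funext => y; ring.
rewrite /c; case: b df dg @c si => df dg c si.
  have [_ <-] := rint_fubini1 si.
  rewrite [LHS](_ : _ = \int[leb]_y 0); first by rewrite Rintegral_cst// mul0r.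
  congr Rintegral; apply/funext => y1.
  rewrite -[RHS](slice_ibp y1 c (2 * pi * (x.1 * y1)) rf rg rk df dg).
  congr Rintegral; apply/funext => y2; rewrite /slice /dot2 /c /=; congr (_ * cos _); ring.
have [_ <-] := rint_fubini2 si.
rewrite [LHS](_ : _ = \int[leb]_y 0); first by rewrite Rintegral_cst// mul0r.
congr Rintegral; apply/funext => y1.
rewrite -[RHS](slice_ibp y1 c (2 * pi * (x.2 * y1)) rf rg rk df dg).
congr Rintegral; apply/funext => y2; rewrite /slice /dot2 /c /=; congr (_ * cos _); ring.
Qed.

(** The scale of decay: weak enough to follow from two integrations by parts, strong enough to be
    integrable and to be summable, with a uniform bound, over all translates of the integers. *)
Definition bump (t : R) : R := (1 + t ^+ 2)^-1.

(* Each factor [1 + x.i ^+ 2] is absorbed by two integrations by parts. *)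
Lemma cosft_decay f : radial q f ->
  exists2 C, 0 <= C & forall x, `|cosft f x| <= C * (bump x.1 * bump x.2).
Proof.
move=> rf.
have D b h : radial q h -> exists2 k, radial q k &
    forall x, (if b then x.2 else x.1) ^+ 2 * `|cosft h x| <= `|cosft k x|.
  move=> rh; have [g rg dg] := radial_derive sq rh b.
  have [k rk dk] := radial_derive sq rg b.
  exists k => // x; have := cosft_ibp x rh rg rk dg dk.
  set t := if b then x.2 else x.1; move=> /(congr1 Num.norm).
  (* The square of [2 * pi] is at least 1 and is given away. *)
  rewrite normrN normrM => <-; rewrite ler_wpM2r// ger0_norm ?sqr_ge0// exprMn ler_peMl ?sqr_ge0//.
  rewrite expr_ge1//; have := pi_ge2 R; intros; lra.
have [k1 rk1 b1] := D false _ rf.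
have [k2 rk2 b2] := D true _ rf.
have [k3 rk3 b3] := D true _ rk1.
pose A f := \int[mu]_y `|f y|.
have A0 h : 0 <= A h by exact: Rintegral_ge0.
exists (A f + A k1 + A k2 + A k3); first by rewrite !addr_ge0.
move=> x; have p1 : 0 < 1 + x.1 ^+ 2 by rewrite ltr_wpDr// sqr_ge0.
have p2 : 0 < 1 + x.2 ^+ 2 by rewrite ltr_wpDr// sqr_ge0.
rewrite /bump -invfM ler_pdivlMr ?mulr_gt0//.
rewrite (_ : _ * _ = `|cosft f x| + x.1 ^+ 2 * `|cosft f x| + x.2 ^+ 2 * `|cosft f x| +
  x.2 ^+ 2 * (x.1 ^+ 2 * `|cosft f x|)); last by ring.
rewrite !lerD//.
- exact: cosft_le (radial_rint rf).
- exact: le_trans (b1 x) (cosft_le _ (radial_rint rk1)).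
- exact: le_trans (b2 x) (cosft_le _ (radial_rint rk2)).
- apply: le_trans (cosft_le x (radial_rint rk3)).
  apply: le_trans (b3 x) => /=; rewrite ler_wpM2l ?sqr_ge0//; exact: b1.
Qed.

End Cosft.

(** * Sampling of band-limited functions *)

Section TrigSums.
Context {R : realType}.

(** The real part of [e^{i phi} * |\sum_j e^{i alpha_j}|^2]; the factor of [sin phi] cancels because
    it is antisymmetric in the two indices. *)
Lemma sum_cos_sub (P : finType) (alpha : P -> R) (phi : R) :
  \sum_i \sum_j cos (phi - (alpha i - alpha j)) =
  cos phi * ((\sum_i cos (alpha i)) ^+ 2 + (\sum_i sin (alpha i)) ^+ 2).
Proof.
have E a b : cos (phi - (a - b)) = cos phi * (cos a * cos b + sin a * sin b)
    + sin phi * (sin a * cos b - cos a * sin b) by rewrite cosB cosB sinB.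
under eq_bigr => i _ do (under eq_bigr => j _ do rewrite E;
  rewrite big_split /= -!mulr_sumr sumrB big_split /= -!mulr_sumr).
rewrite big_split /= -!mulr_sumr sumrB big_split /= -!mulr_suml !expr2.
by rewrite [X in sin phi * (X - _)]mulrC subrr mulr0 addr0.
Qed.

(** Real form of the fact that the exponential sum over pairs factors, hence also its squared
    modulus. *)
Lemma sum_cos_sin_pair (P Q : finType) (a : P -> R) (b : Q -> R) :
  (\sum_(i : P * Q) cos (a i.1 + b i.2)) ^+ 2 + (\sum_(i : P * Q) sin (a i.1 + b i.2)) ^+ 2 =
  ((\sum_i cos (a i)) ^+ 2 + (\sum_i sin (a i)) ^+ 2) *
  ((\sum_i cos (b i)) ^+ 2 + (\sum_i sin (b i)) ^+ 2).
Proof.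
rewrite -(pair_bigA _ (fun i j => cos (a i + b j))) -(pair_bigA _ (fun i j => sin (a i + b j))) /=.
under eq_bigr => i _ do (under eq_bigr => j _ do rewrite cosD;
  rewrite sumrB -!mulr_sumr).
under [X in _ + X ^+ 2]eq_bigr => i _ do (under eq_bigr => j _ do rewrite sinD;
  rewrite big_split /= -!mulr_sumr).
by rewrite sumrB big_split /= -!mulr_suml; ring.
Qed.

(* [|\sum_(j < N) e^{2 pi i j t}|^2], that is [N] times the usual Fejer kernel. *)
Definition fejer (N : nat) (t : R) : R :=
  (\sum_(i < N) cos (2 * pi * (i%:R * t))) ^+ 2 +
  (\sum_(i < N) sin (2 * pi * (i%:R * t))) ^+ 2.

Lemma fejer_ge0 N t : 0 <= fejer N t.
Proof. by rewrite addr_ge0 ?sqr_ge0. Qed.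

Lemma fejerE N t :
  fejer N t = \sum_(i < N) \sum_(j < N) cos (2 * pi * ((i%:R - j%:R) * t)).
Proof.
have := @sum_cos_sub 'I_N (fun i => 2 * pi * (i%:R * t)) 0.
rewrite cos0 mul1r /fejer => <-; apply: eq_bigr => i _; apply: eq_bigr => j _.
by rewrite sub0r cosN; congr cos; ring.
Qed.

Lemma continuous_fejer N : continuous (fejer N).
Proof.
have cl (i : nat) : continuous (fun t : R => 2 * pi * (i%:R * t)).
  by move=> t; apply: cvgM; [exact: cvg_cst|apply: cvgM; [exact: cvg_cst|exact: cvg_id]].
have cs (f : R -> R) n : continuous f ->
    continuous (fun t : R => \sum_(i < n) f (2 * pi * (i%:R * t))).
  move=> cf; elim: n => [|n IH].
    rewrite (_ : (fun t : R => _) = cst 0); first by move=> t; exact: cvg_cst.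
    by apply/funext => t; rewrite big_ord0.
  rewrite (_ : (fun t : R => _) = (fun t => \sum_(i < n) f (2 * pi * (i%:R * t)) +
    f (2 * pi * (n%:R * t)))); last by apply/funext => t; rewrite big_ord_recr.
  move=> t; apply: cvgD; first exact: IH.
  apply: (@continuous_comp _ _ _ (fun t : R => 2 * pi * (n%:R * t)) f); first exact: cl.
  exact: cf.
have csum (f : R -> R) : continuous f ->
    continuous (fun t : R => (\sum_(i < N) f (2 * pi * (i%:R * t))) ^+ 2).
  move=> cf t; apply: (@continuous_comp _ _ _
    (fun t : R => \sum_(i < N) f (2 * pi * (i%:R * t))) (fun s : R => s ^+ 2)).
    exact: cs.
  exact: exprn_continuous.
by move=> t; apply: cvgD; apply: csum; [exact: continuous_cos|exact: continuous_sin].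
Qed.

Lemma sin_natpi (n : nat) : sin (n%:R * pi) = 0 :> R.
Proof.
elim: n => [|n IH]; first by rewrite mul0r sin0.
by rewrite -natr1 mulrDl mul1r sinD IH sinpi mul0r mulr0 addr0.
Qed.

(** Multiplication by [2 * sin (pi * t)] makes both trigonometric sums telescope. The constant 2 is
    crude; what matters is that it does not depend on [N]. *)
Lemma fejer_sin N t : sin (pi * t) ^+ 2 * fejer N t <= 2.
Proof.
have sC : 2 * (sin (pi * t) * \sum_(i < N) cos (2 * pi * (i%:R * t))) =
    sin ((2 * N%:R - 1) * (pi * t)) + sin (pi * t).
  elim: N => [|N IH]; first by rewrite big_ord0 !mulr0 sub0r mulN1r sinN addNr.
  rewrite big_ord_recr /= mulrDr mulrDr IH.
  have -> : 2 * N.+1%:R - 1 = 2 * N%:R + 1 :> R by rewrite -natr1; ring.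
  have -> : (2 * N%:R - 1) * (pi * t) = 2 * pi * (N%:R * t) - pi * t by ring.
  have -> : (2 * N%:R + 1) * (pi * t) = 2 * pi * (N%:R * t) + pi * t by ring.
  by rewrite sinB sinD; ring.
have sS : 2 * (sin (pi * t) * \sum_(i < N) sin (2 * pi * (i%:R * t))) =
    cos (pi * t) - cos ((2 * N%:R - 1) * (pi * t)).
  elim: N {sC} => [|N IH]; first by rewrite big_ord0 !mulr0 sub0r mulN1r cosN subrr.
  rewrite big_ord_recr /= mulrDr mulrDr IH.
  have -> : 2 * N.+1%:R - 1 = 2 * N%:R + 1 :> R by rewrite -natr1; ring.
  have -> : (2 * N%:R - 1) * (pi * t) = 2 * pi * (N%:R * t) - pi * t by ring.
  have -> : (2 * N%:R + 1) * (pi * t) = 2 * pi * (N%:R * t) + pi * t by ring.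
  by rewrite cosB cosD; ring.
rewrite /fejer; move: sC sS; set S := sin (pi * t).
set A := \sum_(i < N) _; set B := \sum_(i < N) _ => sC sS.
have : (2 * (S * A)) ^+ 2 + (2 * (S * B)) ^+ 2 <= 8.
  rewrite sC sS; set u := sin (_ * _); set c := cos (pi * t); set v := cos (_ * _).
  have h1 : v ^+ 2 + u ^+ 2 = 1 by exact: cos2Dsin2.
  have h2 : c ^+ 2 + S ^+ 2 = 1 by exact: cos2Dsin2.
  have h3 := sqr_ge0 (u - S); have h4 := sqr_ge0 (c + v).
  rewrite sqrrB in h3; rewrite sqrrD in h4; rewrite sqrrD sqrrB; lra.
by rewrite !exprMn mulrDr; lra.
Qed.

End TrigSums.

Section FejerIntegral.
Context {R : realType}.
Local Notation leb := (@lebesgue_measure R).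

(** The kernel cut down to [L] periods centred at 0. One period serves for the normalisation, two
    periods as an integrable majorant on the support of the integrand in [fejer_cvg]. *)
Definition fejer_on (L : nat) N : R -> R :=
  fun t => fejer N t * \1_(`[- (L%:R / 2), L%:R / 2]%classic : set (measurableTypeR R)) t.

(** The interval consists of [L] full periods: at its ends the primitive is a sine of an integer
    multiple of [pi], split into two natural multiples to suit [sin_natpi]. *)
Lemma int_cos_itv (L i j : nat) : (0 < L)%N ->
  \int[leb]_(t in `[- (L%:R / 2), L%:R / 2]) cos (2 * pi * ((i%:R - j%:R) * t)) =
  (i == j)%:R * L%:R.
Proof.
move=> L0; have L2 : 0 < L%:R / 2 :> R by rewrite divr_gt0 ?ltr0n.
have [->|ij] := eqVneq i j.
  under eq_Rintegral do rewrite subrr mul0r mulr0 cos0.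
  rewrite Rintegral_cst//= lebesgue_measure_itv /= lte_fin ifT; last by lra.
  by rewrite -EFinB /=; field.
set m := i%:R - j%:R : R; have m0 : m != 0 by rewrite subr_eq0 eqr_nat.
have pi0 : pi != 0 :> R by rewrite gt_eqF// pi_gt0.
set w := 2 * pi * m; have w0 : w != 0 by rewrite !mulf_neq0.
pose F t : R := w^-1 * sin (w * t).
have dF (t : R) : is_derive t 1 F (cos (2 * pi * (m * t))).
  have dl : is_derive t 1 (fun t : R => w * t) w.
    refine (is_derive_eq (is_deriveZ w (is_derive_id t 1)) _).
    by rewrite /GRing.scale /= mulr1.
  have ds := @is_derive1_chain _ sin (fun t => w * t) t _ _ (is_derive_sin _) dl.
  refine (is_derive_eq (is_deriveZ w^-1 ds) _).
  by rewrite /GRing.scale /= mulrCA mulVf// mulr1 mulrA.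
have cF : continuous F.
  by move=> x; apply: differentiable_continuous; apply/derivable1_diffP; case: (dF x).
have cc : continuous (fun t : R => cos (2 * pi * (m * t))).
  move=> t; apply: (@continuous_comp _ _ _ (fun t : R => 2 * pi * (m * t)) cos); last exact: continuous_cos.
  by apply: cvgM; [exact: cvg_cst|apply: cvgM; [exact: cvg_cst|exact: cvg_id]].
rewrite mul0r /Rintegral (@continuous_FTC2 _ _ F)//.
- rewrite -EFinB /= /F mulrN sinN mulrN opprK.
  have -> : w * (L%:R / 2) = (L * i)%:R * pi - (L * j)%:R * pi.
    by rewrite /w /m !natrM; field.
  by rewrite sinB !sin_natpi mulr0 mul0r subrr mulr0 addr0.
- lra.
- exact: continuous_subspaceT.
- split.
  + by move=> x _; case: (dF x).
  + exact/cvg_at_right_filter/cF.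
  + exact/cvg_at_left_filter/cF.
- by move=> x _; rewrite derive1E derive_val.
Qed.

Lemma rint_fejer_on L N : (0 < L)%N -> rint leb (fejer_on L N) /\
  \int[leb]_t fejer_on L N t = (L * N)%:R.
Proof.
move=> L0; set D := `[- (L%:R / 2), L%:R / 2]%classic : set (measurableTypeR R).
have ci (f : R -> R) : continuous f -> leb.-integrable D (EFin \o f).
  move=> cf; apply: continuous_compact_integrable; first exact: segment_compact.
  exact: continuous_subspaceT.
have mD : measurable D by exact: measurable_itv.
have E : fejer_on L N = (fejer N) \_ D.
  by apply/funext => t; rewrite /fejer_on patchE indicE; case: ifPn => h; rewrite ?mulr1 ?mulr0.
split.
  rewrite /rint E -restrict_EFin; apply: (integrable_mkcond _ mD).1.
  exact: ci (@continuous_fejer _ N).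
rewrite E -Rintegral_mkcond.
under eq_Rintegral do rewrite fejerE.
pose F i j : R -> R := (fun t => cos (2 * pi * ((i%:R - j%:R) * t))) \_ D.
have iF i j : rint leb (F i j).
  rewrite /rint /F -restrict_EFin; apply: (integrable_mkcond _ mD).1; apply: ci => t.
  apply: (@continuous_comp _ _ _ (fun t : R => 2 * pi * ((i%:R - j%:R) * t)) cos); last exact: continuous_cos.
  by apply: cvgM; [exact: cvg_cst|apply: cvgM; [exact: cvg_cst|exact: cvg_id]].
rewrite Rintegral_mkcond.
transitivity (\int[leb]_t \sum_(i < N) \sum_(j < N) F i j t).
  congr Rintegral; apply/funext => t; rewrite /F !patchE; case: ifPn => h.
    by apply: eq_bigr => i _; apply: eq_bigr => j _; rewrite patchE h.
  by rewrite big1// => i _; rewrite big1// => j _; rewrite patchE (negbTE h).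
rewrite int_sum; last by move=> i; exact: rint_sum.
under eq_bigr => i _.
  rewrite int_sum//; under eq_bigr => j _ do rewrite /F -Rintegral_mkcond int_cos_itv//.
  rewrite (bigD1 i)//= eqxx mul1r big1; last first.
    by move=> j; rewrite eq_sym => /negbTE ij; rewrite -val_eqE /= in ij; rewrite ij mul0r.
  over.
by rewrite sumr_const card_ord addr0 natrM mulr_natr.
Qed.

End FejerIntegral.

Section FejerConvergence.
Context {R : realType}.
Local Notation leb := (@lebesgue_measure R).
Local Notation mu := (@area R).
Local Notation pl := (measurableTypeR R * measurableTypeR R)%type.

Lemma fejer_onE L N t : fejer_on L N t = (if `|t| <= L%:R / 2 then fejer N t else 0) :> R.
Proof.
rewrite /fejer_on indicE mem_setE in_itv /= -ler_norml.
by case: ifPn; rewrite ?mulr1 ?mulr0.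
Qed.

Lemma fejer_on_ge0 L N (t : R) : 0 <= fejer_on L N t.
Proof. by rewrite fejer_onE; case: ifPn => // _; exact: fejer_ge0. Qed.

Lemma fejer_on_le L N (t : R) : fejer_on L N t <= fejer N t.
Proof. by rewrite fejer_onE; case: ifPn => // _; exact: fejer_ge0. Qed.

(** On [[d, k]], which lies strictly between the zeros 0 and 1 of [sin (pi * t)], the sine is
    bounded below, and [fejer_sin] gives a bound uniform in [N]. *)
Lemma fejer_far (d k : R) : 0 < d -> k < 1 ->
  exists2 c, 0 <= c & forall N t, d <= `|t| <= k -> fejer N t <= c.
Proof.
move=> d0 k1; have [dk|kd] := leP d k; last first.
  by exists 0 => // N t /andP[h1 h2]; have := le_trans h1 h2; rewrite leNgt kd.
have pi0 := pi_gt0 R.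
have cs : {within `[d, k], continuous (fun t : R => sin (pi * t))}.
  apply: continuous_subspaceT => t.
  apply: (@continuous_comp _ _ _ (fun t : R => pi * t) sin); last exact: continuous_sin.
  by apply: cvgM; [exact: cvg_cst|exact: cvg_id].
have [c cdk cmin] := EVT_min dk cs.
have sc : 0 < sin (pi * c).
  move: cdk; rewrite in_itv /= => /andP[dc ck]; apply: sin_gt0_pi.
  by rewrite mulr_gt0//= ?(lt_le_trans d0)// gtr_pMr// (le_lt_trans ck).
exists (2 / sin (pi * c) ^+ 2); first by rewrite divr_ge0// sqr_ge0.
move=> N t tdk; rewrite ler_pdivlMr ?exprn_gt0// mulrC.
apply: le_trans (fejer_sin N t); rewrite ler_wpM2r ?fejer_ge0//.
have -> : sin (pi * t) ^+ 2 = sin (pi * `|t|) ^+ 2.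
  by have [t0|t0] := leP 0 t; [rewrite ger0_norm|rewrite ltr0_norm// mulrN sinN sqrrN].
by rewrite ler_pXn2r ?nnegrE ?(ltW sc)//; [exact: cmin|
  exact: le_trans (ltW sc) (cmin _ tdk)].
Qed.

Variables (v : pl -> R) (M k : R).
Hypothesis mv : measurable_fun setT v.
Hypothesis vM : forall z, `|v z| <= M.
Hypothesis k_half : 1 / 2 <= k.
Hypothesis k_lt1 : k < 1.
Hypothesis v_supp : forall z : pl, ~~ ((`|z.1| <= k) && (`|z.2| <= k)) -> v z = 0.
Hypothesis v_cont : forall e, 0 < e -> exists2 d, 0 < d &
  forall z : pl, `|z.1| <= d -> `|z.2| <= d -> `|v z - v (0, 0)| <= e.

Let M0 : 0 <= M. Proof. exact: le_trans (vM (0, 0)). Qed.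

Lemma rint_mul_fejer N : rint mu (fun z : pl => v z * (fejer N z.1 * fejer N z.2)).
Proof.
have [i2 _] := @rint_fejer_on R 2 N isT.
have [ii _] := int_tensor i2 i2.
have mf : measurable_fun setT (fejer N : R -> R).
  exact: continuous_measurable_fun (@continuous_fejer _ N).
apply: rint_le (rintZl M ii) _.
  apply: measurable_funM => //; apply: measurable_funM.
    exact: (measurableT_comp mf measurable_fst).
  exact: (measurableT_comp mf measurable_snd).
move=> z; have [/andP[h1 h2]|/v_supp ->] := boolP ((`|z.1| <= k) && (`|z.2| <= k)).
  rewrite normrM [`|_ * _ : R|]ger0_norm ?mulr_ge0 ?fejer_ge0//.
  by rewrite !fejer_onE divff// !(le_trans _ (ltW k_lt1))// ler_wpM2r// mulr_ge0// fejer_ge0.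
by rewrite mul0r normr0 !mulr_ge0// fejer_ge0.
Qed.

(** The product kernel concentrates at the integer points, of which [k < 1] leaves only the origin,
    with mass about [N ^+ 2]. Away from it one factor is bounded while the other has integral of
    order [N]. This gives an error [e * N ^+ 2 + c * N], which is negligible after division. *)
Lemma fejer_cvg : (fun N => \int[mu]_z (v z * (fejer N.+1 z.1 * fejer N.+1 z.2)) / N.+1%:R ^+ 2)
  @ \oo --> v (0, 0).
Proof.
suff H e : 0 < e -> exists c, forall N,
    `|\int[mu]_z (v z * (fejer N z.1 * fejer N z.2)) - v (0, 0) * N%:R ^+ 2|
      <= e * N%:R ^+ 2 + c * N%:R.
  apply/cvgrPdist_le => e e0; have [c Hc] := H (e / 2) (divr_gt0 e0 (ltr0Sn _ 1)).
  near=> N; have N0 : 0 < N.+1%:R :> R by rewrite ltr0n.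
  rewrite distrC -(ler_pM2r (exprn_gt0 2 N0)) -{2}(ger0_norm (ltW (exprn_gt0 2 N0))) -normrM.
  rewrite mulrBl divfK ?gt_eqF ?exprn_gt0//; apply: le_trans (Hc _) _.
  have : c <= e / 2 * N.+1%:R.
    rewrite -ler_pdivrMl ?divr_gt0// mulrC -[N.+1%:R]natr1.
    apply: (@le_trans _ _ N%:R); last by rewrite lerDl.
    by near: N; exact: nbhs_infty_ger.
  move=> /(ler_wpM2r (ltW N0)); rewrite expr2; move: (N.+1%:R : R) => X; lra.
move=> e0; have [d d0 Hd] := v_cont (divr_gt0 e0 (ltr0Sn _ 3)).
(* Up to distance [1 / 2] the truncation to one period coincides with the full kernel. *)
pose d1 := Num.min d (1 / 2).
have d10 : 0 < d1 by rewrite lt_min d0/=.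
have [c c0 Hc] := @fejer_far d1 k d10 k_lt1.
exists (2 * M * c * 8) => N.
have [i1 e1] := @rint_fejer_on R 1 N isT.
have [i2 e2] := @rint_fejer_on R 2 N isT.
have ichi := @rint_itv R 1.
set chi := (\1__ : R -> R) in ichi.
have echi : \int[leb]_t chi t = 2.
  rewrite /Rintegral integral_indic// setIT /= lebesgue_measure_itv /= lte_fin ifT ?gtrN//.
  by rewrite -EFinB /=; ring.
have [i11 e11] := int_tensor i1 i1; have [i22 e22] := int_tensor i2 i2.
have [i2c e2c] := int_tensor i2 ichi; have [ic2 ec2] := int_tensor ichi i2.
have iv := rint_mul_fejer N.
(* The first term controls the neighbourhood of the origin by continuity of [v], the second its
   complement, where one factor is at most [c] and the values of [v] contribute at most [2 * M]. Two
   periods have mass [2 * N] per coordinate, so the first term integrates to [e * N ^+ 2]; the 8 is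
   twice [2 * 2], since [chi] has integral 2. *)
pose bnd (z : pl) := e / 4 * (fejer_on 2 N z.1 * fejer_on 2 N z.2) +
  2 * M * c * (fejer_on 2 N z.1 * chi z.2 + chi z.1 * fejer_on 2 N z.2).
have ibnd : rint mu bnd by apply: rintD; apply: rintZl => //; exact: rintD.
have Ebnd : \int[mu]_z bnd z = e * N%:R ^+ 2 + 2 * M * c * 8 * N%:R.
  rewrite /bnd (RintegralD measurableT (rintZl _ i22) (rintZl _ (rintD i2c ic2))).
  rewrite (@RintegralZl _ _ _ mu setT _ (e / 4) measurableT i22).
  rewrite (@RintegralZl _ _ _ mu setT _ (2 * M * c) measurableT (rintD i2c ic2)).
  by rewrite (RintegralD measurableT i2c ic2) e22 e2c ec2 e2 echi natrM; field.
rewrite -Ebnd.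
have -> : v (0, 0) * N%:R ^+ 2 = \int[mu]_z (v (0, 0) * (fejer_on 1 N z.1 * fejer_on 1 N z.2)).
  by rewrite (@RintegralZl _ _ _ mu setT _ (v (0, 0)) measurableT i11) e11 e1 mul1n expr2.
rewrite -(RintegralB measurableT iv (rintZl _ i11)).
have idif := rintB iv (rintZl (v (0, 0)) i11).
apply: le_trans (le_normr_Rintegral measurableT idif) _.
apply: le_Rintegral => //; first exact: rint_norm.
move=> z _.
have chiE (t : R) : chi t = (if `|t| <= 1 then 1 else 0).
  by rewrite /chi indicE mem_setE in_itv /= -ler_norml; case: ifPn.
have chi0 t : 0 <= chi t by rewrite chiE; case: ifPn.
have F0 (t : R) : 0 <= fejer N t by exact: fejer_ge0.
have F20 := fejer_on_ge0 2 N.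
have Mc0 : 0 <= 2 * M * c by apply: mulr_ge0 => //; exact: mulr_ge0.
have bnd0 : 0 <= bnd z.
  rewrite /bnd; apply: addr_ge0; apply: mulr_ge0.
  - lra.
  - exact: mulr_ge0.
  - by rewrite !mulr_ge0.
  - by apply: addr_ge0; apply: mulr_ge0.
have le12 (t : R) : `|t| <= 1 / 2 -> `|t| <= 1 by move=> h; lra.
(* Here [1 / 2 <= k] enters: outside the square the kernel truncated to one period vanishes together
   with [v]. *)
have big : ~~ ((`|z.1| <= k) && (`|z.2| <= k)) ->
    `|v z * (fejer N z.1 * fejer N z.2) - v (0, 0) * (fejer_on 1 N z.1 * fejer_on 1 N z.2)| <= bnd z.
  move=> h; rewrite (v_supp h) mul0r sub0r normrN.
  suff -> : fejer_on 1 N z.1 * fejer_on 1 N z.2 = 0 by rewrite mulr0 normr0.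
  rewrite !fejer_onE; move: h; rewrite negb_and -!ltNge => /orP[] h.
    by rewrite [`|z.1| <= _]leNgt (le_lt_trans k_half h) mul0r.
  by rewrite [`|z.2| <= _]leNgt (le_lt_trans k_half h) mulr0.
have [/andP[h1 h2]|/big//] := boolP ((`|z.1| <= k) && (`|z.2| <= k)).
have g1 : `|z.1| <= 1 by rewrite (le_trans h1)// ltW.
have g2 : `|z.2| <= 1 by rewrite (le_trans h2)// ltW.
have E21 : fejer_on 2 N z.1 = fejer N z.1 by rewrite fejer_onE divff// g1.
have E22 : fejer_on 2 N z.2 = fejer N z.2 by rewrite fejer_onE divff// g2.
have bndE : bnd z = e / 4 * (fejer N z.1 * fejer N z.2) + 2 * M * c * (fejer N z.1 + fejer N z.2).
  by rewrite /bnd E21 E22 !chiE g1 g2 mulr1 mul1r.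
rewrite bndE.
have [/andP[s1 s2]|far] := boolP ((`|z.1| <= d1) && (`|z.2| <= d1)).
  have E11 : fejer_on 1 N z.1 = fejer N z.1.
    by rewrite fejer_onE (le_trans s1)// /d1 ge_min lexx orbT.
  have E12 : fejer_on 1 N z.2 = fejer N z.2.
    by rewrite fejer_onE (le_trans s2)// /d1 ge_min lexx orbT.
  rewrite E11 E12 -mulrBl normrM [`|_ * _ : R|]ger0_norm ?mulr_ge0//.
  apply: (@le_trans _ _ (e / 4 * (fejer N z.1 * fejer N z.2))); last first.
    rewrite lerDl; apply: (mulr_ge0 Mc0). apply: addr_ge0; exact: fejer_ge0.
  apply: ler_wpM2r; first by apply: mulr_ge0; exact: fejer_ge0.
  by apply: Hd; [rewrite (le_trans s1)|rewrite (le_trans s2)]; rewrite // /d1 ge_min lexx.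
apply: (@le_trans _ _ (2 * M * c * (fejer N z.1 + fejer N z.2))); last first.
  by rewrite lerDr; apply: mulr_ge0; [lra|by apply: mulr_ge0; exact: fejer_ge0].
have B1 : `|v z * (fejer N z.1 * fejer N z.2) - v (0, 0) * (fejer_on 1 N z.1 * fejer_on 1 N z.2)|
    <= 2 * M * (fejer N z.1 * fejer N z.2).
  have P0 : 0 <= fejer N z.1 * fejer N z.2 by apply: mulr_ge0; exact: fejer_ge0.
  have P1 : 0 <= fejer_on 1 N z.1 * fejer_on 1 N z.2 by apply: mulr_ge0; exact: fejer_on_ge0.
  rewrite (le_trans (ler_normB _ _))//.
  rewrite (_ : 2 * M * _ = M * (fejer N z.1 * fejer N z.2) + M * (fejer N z.1 * fejer N z.2)); last by ring.
  apply: lerD; rewrite normrM [`|_ * _ : R|]ger0_norm//; first exact: ler_wpM2r.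
  apply: ler_pM => //; apply: ler_pM; [exact: fejer_on_ge0|exact: fejer_on_ge0|
    exact: fejer_on_le|exact: fejer_on_le].
have F1 := fejer_ge0 N z.1; have F2 := fejer_ge0 N z.2.
apply: le_trans B1 _; rewrite -[leRHS]mulrA; apply: ler_wpM2l; first exact: mulr_ge0.
move: far; rewrite negb_and -!ltNge => /orP[] far.
  have := Hc N z.1; rewrite (ltW far) h1 => /(_ isT) /(ler_wpM2r F2) h.
  by apply: le_trans h _; rewrite (mulrDr c (fejer N z.1) (fejer N z.2)) lerDr; exact: mulr_ge0.
have := Hc N z.2; rewrite (ltW far) h2 => /(_ isT) /(ler_wpM2l F1) h.
by apply: le_trans h _; rewrite (mulrDr c (fejer N z.1) (fejer N z.2)) [leLHS]mulrC lerDl; exact: mulr_ge0.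
Unshelve. all: by end_near. Qed.

End FejerConvergence.

(** * Sums over the integer lattice and their Cesaro means *)

Lemma int2_enum : exists f : nat -> int * int, bijective f.
Proof.
have inf : infinite_set [set: int].
  move=> /(finite_preimage (f := Posz)) h; apply: infinite_nat; apply: h.
  by move=> m n _ _ [].
have inf2 : infinite_set [set: int * int].
  by rewrite -setXTT; apply: infinite_setX.
have /card_set_bijP[f] := eq_card_nat (countableP [set: int * int]) inf2.
by rewrite setTT_bijective => -[g fK gK]; exists g; exists f.
Qed.

(* Sums over Z^2 are integrals against [cnt] along [zz], which makes Fubini and
   dominated convergence available for them. *)
Definition zz : nat -> int * int := sval (cid int2_enum).

Lemma zz_bij : bijective zz. Proof. exact: (svalP (cid int2_enum)). Qed.

Section LatticeSums.
Context {R : realType}.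
Local Notation cnt := (@cnt R).

Lemma integral_zz (a : int * int -> \bar R) : (forall k, 0 <= a k)%E ->
  (\int[cnt]_i a (zz i) = \esum_(k in [set: int * int]) a k)%E.
Proof.
move=> a0; rewrite [LHS]ge0_integral_count// nneseries_esumT//.
rewrite [RHS](reindex_esum [set: nat] _ zz)//; rewrite setTT_bijective; exact: zz_bij.
Qed.

Lemma rint_zz (c : int * int -> R) :
  (\esum_(k in [set: int * int]) `|c k|%:E < +oo)%E -> rint cnt (fun i => c (zz i)).
Proof.
move=> coo; apply/integrableP; split; first by [].
by rewrite (@integral_zz (fun k => `|c k|%:E)).
Qed.

Lemma int_delta_zz (c : int * int -> R) m :
  rint cnt (fun i => (zz i == m)%:R * c (zz i)) /\
  \int[cnt]_i ((zz i == m)%:R * c (zz i)) = c m.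
Proof.
have [g gK Kg] := zz_bij.
have E : (fun i => (zz i == m)%:R * c (zz i)) = (fun i => c m * \1_[set g m] i).
  apply/funext => i; rewrite indicE mulrC.
  have -> : (i \in [set g m]%classic) = (zz i == m).
    by apply/idP/eqP => [|<-]; rewrite ?gK inE//= => ->; rewrite Kg.
  by case: eqP => [->//|_]; rewrite !mulr0.
have c1 : (cnt [set g m] = 1)%E.
  by rewrite /cnt /= /counting asboolT// fset_set1 finmap.cardfs1.
have i1 : rint cnt (\1_[set g m] : nat -> R).
  apply: rint_of_ge0 => //.
  have <- : (1 = \int[cnt]_x (\1_[set g m] x)%:E :> \bar R)%E.
    by rewrite integral_indic// setIT; exact: esym c1.
  by rewrite ltry.
rewrite E; split; first exact: rintZl.
rewrite RintegralZl// /Rintegral integral_indic// setIT.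
by rewrite (_ : fine _ = 1) ?mulr1//; exact: (congr1 fine c1).
Qed.

Let P N := ('I_N * 'I_N)%type.

Definition ord_diff N (i j : 'I_N) : int := (i : nat)%:Z - (j : nat)%:Z.
Definition ord2_diff N (i j : 'I_N * 'I_N) : int * int :=
  (ord_diff i.1 j.1, ord_diff i.2 j.2).

(** The Fejer weight, that is [N - |k|] cut off at 0, presented as the count of pairs from which it
    arises. The two-sided bounds below suffice for its use. *)
Definition diff_count N (k : int) : R :=
  \sum_(i < N) \sum_(j < N) (ord_diff i j == k)%:R.

Lemma diff_countN N k : diff_count N (- k) = diff_count N k.
Proof.
rewrite /diff_count exchange_big; apply: eq_bigr => i _; apply: eq_bigr => j _.
by rewrite /ord_diff -eqr_oppLR opprB.
Qed.

(** For each [i] at most one [j] has the prescribed difference. *)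
Lemma diff_count_le N k : diff_count N k <= N%:R.
Proof.
have -> : N%:R = \sum_(i < N) 1 :> R by rewrite sumr_const card_ord.
apply: ler_sum => i _.
have [[j0 Pj0]|no] := pselect (exists j : 'I_N, ord_diff i j == k).
  rewrite (bigD1 j0)//= Pj0 big1 ?addr0// => j jj0.
  case: eqP => // e; case/negP: jj0; apply/eqP/val_inj => /=.
  by move/eqP: Pj0; rewrite -e /ord_diff => /addrI/oppr_inj[].
by rewrite big1// => j _; case: eqP => // /eqP e; case: no; exists j.
Qed.

Lemma diff_count_ge0 N k : 0 <= diff_count N k.
Proof. by apply: sumr_ge0 => i _; apply: sumr_ge0 => j _; rewrite ler0n. Qed.

(** For [k = n >= 0] every [i >= n] has the partner [i - n]; negative [k] follow by the symmetry
    [diff_countN]. *)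
Lemma diff_count_ge N k : N%:R - `|k|%N%:R <= diff_count N k.
Proof.
have main (n : nat) : N%:R - n%:R <= diff_count N n%:Z.
  apply: (@le_trans _ _ (\sum_(i < N) (n <= i)%N%:R)).
    elim: N => [|m IH]; first by rewrite big_ord0 sub0r oppr_le0 ler0n.
    rewrite big_ord_recr /= -natr1; case: leqP => h; rewrite ?[nat_of_bool _]/=; first by move: IH; lra.
    have : (m.+1)%:R <= n%:R :> R by rewrite ler_nat.
    have : 0 <= \sum_(i < m) (n <= i)%N%:R :> R by apply: sumr_ge0 => i _; rewrite ler0n.
    by rewrite -[m.+1%:R]natr1; lra.
  apply: ler_sum => i _; case: leqP => h; last by apply: sumr_ge0 => j _; rewrite ler0n.
  have jN : (i - n < N)%N by rewrite (leq_ltn_trans (leq_subr _ _)).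
  rewrite (bigD1 (Ordinal jN))//= /ord_diff /= subzn ?leq_subr// subKn// eqxx.
  by rewrite lerDl; apply: sumr_ge0 => j _; rewrite ler0n.
case: k => n; first exact: main.
by rewrite NegzE diff_countN abszN; exact: main.
Qed.

Definition cesaro_weight N (k : int * int) : R :=
  diff_count N k.1 * diff_count N k.2 / N%:R ^+ 2.

Lemma cesaro_weightE N k : cesaro_weight N k =
  (\sum_(i : P N) \sum_(j : P N) (k == ord2_diff i j)%:R) / N%:R ^+ 2.
Proof.
congr (_ / _); rewrite /diff_count mulr_suml.
rewrite -(pair_bigA _ (fun i1 i2 => \sum_(j : P N) (k == ord2_diff (i1, i2) j)%:R)) /=.
apply: eq_bigr => i1 _; rewrite mulr_sumr; apply: eq_bigr => i2 _.
rewrite -(pair_bigA _ (fun j1 j2 => (k == ord2_diff (i1, i2) (j1, j2))%:R)) /=.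
rewrite mulr_suml; apply: eq_bigr => j1 _; rewrite mulr_sumr; apply: eq_bigr => j2 _.
by case: k => k1 k2; rewrite -natrM mulnb /ord2_diff /= xpair_eqE [k1 == _]eq_sym [k2 == _]eq_sym.
Qed.

Lemma cesaro_weight_norm N k : `|cesaro_weight N k| <= 1.
Proof.
rewrite ger0_norm; last by rewrite divr_ge0 ?mulr_ge0 ?diff_count_ge0 ?sqr_ge0.
have [->|N0] := eqVneq N 0%N; first by rewrite /cesaro_weight expr0n /= invr0 mulr0.
rewrite ler_pdivrMr ?exprn_gt0 ?ltr0n ?lt0n// mul1r expr2.
by rewrite ler_pM ?diff_count_ge0 ?diff_count_le.
Qed.

Lemma cesaro_weight_cvg k : cesaro_weight N.+1 k @[N --> \oo] --> (1 : R).
Proof.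
have h (m : int) : diff_count N.+1 m / N.+1%:R @[N --> \oo] --> (1 : R).
  apply: (@squeeze_cvgr _ _ _ _ (fun N => 1 - `|m|%N%:R * N.+1%:R^-1) (cst 1)).
  - apply: nearW => N; rewrite ler_pdivrMr ?ltr0n// ler_pdivlMr ?ltr0n//.
    by rewrite mul1r diff_count_le mulrBl mul1r divfK ?pnatr_eq0// diff_count_ge.
  - rewrite -[X in _ --> X]subr0; apply: cvgB; first exact: cvg_cst.
    rewrite -[X in _ --> X](mulr0 (`|m|%N%:R)); apply: cvgM; [exact: cvg_cst|exact: cvg_harmonic].
  - exact: cvg_cst.
rewrite (_ : (fun N => _) = (fun N => (diff_count N.+1 k.1 / N.+1%:R) *
  (diff_count N.+1 k.2 / N.+1%:R))).
  by rewrite -[X in _ --> X](mulr1 1); exact: cvgM (h k.1) (h k.2).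
by apply/funext => N; rewrite /cesaro_weight expr2 invfM mulrACA.
Qed.

(** Regrouped by differences, the double sum weighs [c k] with [cesaro_weight], which is at most 1
    in modulus and tends to 1: dominated convergence. An absolutely convergent sum is thus replaced
    by means whose kernel is nonnegative. *)
Lemma cesaro_zz (c : int * int -> R) : rint cnt (fun i => c (zz i)) ->
  (fun N => (\sum_(i : P N.+1) \sum_(j : P N.+1) c (ord2_diff i j)) / N.+1%:R ^+ 2) @ \oo
  --> \int[cnt]_i c (zz i).
Proof.
move=> ci.
rewrite (_ : (fun N => _) =
  (fun N => \int[cnt]_i (cesaro_weight N.+1 (zz i) * c (zz i)))).
  apply: (@rint_dct _ _ _ cnt (fun N i => cesaro_weight N.+1 (zz i) * c (zz i)) _
    (fun i => `|c (zz i)|) _ _ _ _).2.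
  - by [].
  - move=> i; rewrite -[X in _ --> X]mul1r; apply: cvgM; last exact: cvg_cst.
    exact: cesaro_weight_cvg.
  - exact: rint_norm.
  - by move=> N i; rewrite normrM ler_piMl// cesaro_weight_norm.
apply/funext => N.
transitivity (\int[cnt]_i ((\sum_(p : P N.+1) \sum_(r : P N.+1)
    (zz i == ord2_diff p r)%:R * c (zz i)) / N.+1%:R ^+ 2)); last first.
  congr Rintegral; apply/funext => i; rewrite cesaro_weightE mulrAC; congr (_ / _).
  by rewrite mulr_suml; apply: eq_bigr => p _; rewrite mulr_suml.
have i0 p r : rint cnt (fun i => (zz i == @ord2_diff N.+1 p r)%:R * c (zz i)).
  by case: (int_delta_zz c (ord2_diff p r)).
have i1 p : rint cnt (fun i => \sum_(r : P N.+1) (zz i == ord2_diff p r)%:R * c (zz i)).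
  exact: (rint_sum _ (i0 p)).
rewrite (RintegralZr _ measurableT (rint_sum _ i1)).
congr (_ / _); rewrite (int_sum _ i1); apply: eq_bigr => p _.
rewrite (int_sum _ (i0 p)).
by apply: eq_bigr => r _; case: (int_delta_zz c (ord2_diff p r)).
Qed.

End LatticeSums.

Section BumpSums.
Context {R : realType}.
Local Notation cnt := (@cnt R).
Local Notation pl := (measurableTypeR R * measurableTypeR R)%type.

Lemma bump_gt0 (t : R) : 0 < bump t.
Proof. by rewrite invr_gt0 ltr_wpDr// sqr_ge0. Qed.

Lemma bump_ge0 (t : R) : 0 <= bump t. Proof. exact: ltW (bump_gt0 t). Qed.

Lemma bumpN (t : R) : bump (- t) = bump t. Proof. by rewrite /bump sqrrN. Qed.

(** Comparison with a telescoping sum: [bump x <= 2 / x - 2 / (x + 1)] for [x >= 1], and the term at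
    0 is 1. The induction carries the sharper bound [3 - 2 / N.+1]. *)
Lemma sum_bump_nat (N : nat) : \sum_(0 <= i < N) bump i%:R <= 3 :> R.
Proof.
suff : \sum_(0 <= i < N.+1) bump i%:R <= 3 - 2 / N.+1%:R :> R.
  rewrite big_nat_recr//= => h.
  apply: le_trans (_ : _ <= 3 - 2 / N.+1%:R) _.
    by apply: le_trans h; rewrite lerDl bump_ge0.
  by rewrite lerBlDr lerDl divr_ge0.
elim: N => [|N IH]; first by rewrite big_nat1 /bump expr0n /= addr0 invr1 ?mulr1 ?divr1; lra.
rewrite big_nat_recr//=; move: IH; set S := (\sum_(0 <= i < N.+1) _ : R) => IH.
suff h : bump N.+1%:R <= 2 / N.+1%:R - 2 / N.+2%:R :> R.
  by move: IH h; move: S (bump _) (2 / _) (2 / _) => S b c d; lra.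
have p1 : 0 < N.+1%:R :> R by rewrite ltr0n.
rewrite -[N.+2%:R]natr1; move: p1; move: (N.+1%:R : R) (ler1n R N.+1) => x /= x1 x0.
have x10 : 0 < x + 1 by lra.
have -> : 2 / x - 2 / (x + 1) = 2 / (x * (x + 1)) by field; rewrite !gt_eqF.
rewrite /bump ler_pdivlMr ?mulr_gt0// mulrC ler_pdivrMr ?ltr_wpDr ?sqr_ge0//.
by have := sqr_ge0 (x - 1); rewrite sqrrB; lra.
Qed.

Lemma esum_bump_nat : (\esum_(i in [set: nat]) (bump i%:R : R)%:E <= 3%:E)%E.
Proof.
rewrite -nneseries_esumT; last by move=> i; rewrite lee_fin bump_ge0.
apply: lime_le; first by apply: is_cvg_nneseries => i _ _; rewrite lee_fin bump_ge0.
by apply: nearW => N; rewrite sumEFin lee_fin; exact: sum_bump_nat.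
Qed.

Lemma esum_int (a : int -> \bar R) : (forall k, 0 <= a k)%E ->
  (\esum_(k in [set: int]) a k =
   \esum_(n in [set: nat]) a (Posz n) + \esum_(n in [set: nat]) a (Negz n))%E.
Proof.
move=> a0; rewrite (esumID [set k | exists n, k = Posz n])//; congr (_ + _)%E.
  rewrite (reindex_esum [set: nat] _ Posz)//; split.
  - by move=> n _; split => //; exists n.
  - by move=> m n _ _ [].
  - by move=> k [_ [n ->]]; exists n.
rewrite (reindex_esum [set: nat] _ Negz)//; split.
- by move=> n _; split => // -[].
- by move=> m n _ _ [].
- by move=> [n|n] [_ h]; [case: h; exists n|exists n].
Qed.

Lemma esum_bump_int : (\esum_(k in [set: int]) (bump k%:~R : R)%:E <= 6%:E)%E.
Proof.
rewrite esum_int; last by move=> k; rewrite lee_fin bump_ge0.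
rewrite (_ : 6%:E = 3%:E + 3%:E)%E; last by rewrite -EFinD; congr EFin; ring.
apply: leeD; first exact: esum_bump_nat.
apply: le_trans esum_bump_nat; apply: le_esum => n _.
rewrite lee_fin NegzE mulrNz bumpN /bump lef_pV2 ?posrE ?ltr_wpDr ?sqr_ge0//.
by rewrite lerD2l ler_sqr ?nnegrE ?ler0n// -pmulrn ler_nat.
Qed.

(** Once the integer part of [t] is absorbed by reindexing, a shift [s] in [[0, 1]] remains, and it
    costs a factor 3, as [1 + j ^+ 2 <= 3 * (1 + (s - j) ^+ 2)]. Hence 18 is 3 times the 6 of
    [esum_bump_int]. *)
Lemma esum_bump_shift (t : R) : (\esum_(k in [set: int]) (bump (t - k%:~R) : R)%:E <= 18%:E)%E.
Proof.
pose m := Num.floor t.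
rewrite (reindex_esum [set: int] _ (fun k => m + k)); last first.
  rewrite setTT_bijective; exists (fun k => k - m) => k; first by rewrite addrC addKr.
  by rewrite addrC subrK.
apply: (@le_trans _ _ (\esum_(k in [set: int]) (3 * bump k%:~R : R)%:E)%E).
  apply: le_esum => k _; rewrite lee_fin intrD.
  have /andP[s0 s1] : 0 <= t - m%:~R <= 1.
    by rewrite subr_ge0 lerBlDr Num.Theory.floor_le /= addrC ltW// -intrD1 floorD1_gt.
  rewrite opprD addrA; move: (t - m%:~R) (k%:~R : R) s0 s1 => s j s0 s1.
  rewrite /bump ler_pdivlMr ?ltr_wpDr ?sqr_ge0// mulrC ler_pdivrMr ?ltr_wpDr ?sqr_ge0//.
  have := sqr_ge0 (j - 2 * s); have : s ^+ 2 <= 1 by rewrite expr_le1.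
  by have := sqr_ge0 (s - j); rewrite !sqrrB exprMn; lra.
have b0 (k : int) : (0 <= (bump k%:~R : R)%:E)%E by rewrite lee_fin bump_ge0.
rewrite (eq_esum (b := fun k => ((bump k%:~R : R)%:E + ((bump k%:~R)%:E + (bump k%:~R)%:E))%E)); last first.
  by move=> k _; rewrite -!EFinD; congr EFin; ring.
rewrite esumD//; last by move=> k _; rewrite adde_ge0.
rewrite esumD// (_ : 18%:E = 6%:E + (6%:E + 6%:E))%E; last first.
  by rewrite -!EFinD; congr EFin; ring.
by rewrite !leeD// esum_bump_int.
Qed.

Lemma esumZl_le (T : choiceType) (r : R) (a : T -> \bar R) : 0 <= r ->
  (forall k, 0 <= a k)%E ->
  (\esum_(k in [set: T]) (r%:E * a k) <= r%:E * \esum_(k in [set: T]) a k)%E.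
Proof.
move=> r0 a0; apply: ge_ereal_sup => _ [F [finF _] <-].
rewrite -ge0_mule_fsumr// lee_wpmul2l ?lee_fin//.
by apply: ereal_sup_ubound; exists F.
Qed.

Lemma esum_bump2 (x : pl) : (\esum_(k in [set: int * int])
  (bump (x.1 - k.1%:~R) * bump (x.2 - k.2%:~R) : R)%:E <= (18 * 18)%:E)%E.
Proof.
have b0 (t : R) (k : int) : (0 <= (bump (t - k%:~R) : R)%:E)%E by rewrite lee_fin bump_ge0.
have -> : [set: int * int] = [set: int] `*`` (fun=> [set: int]).
  by apply/seteqP; split => -[].
rewrite -(@esum_esum _ _ _ _ _ (fun k1 k2 => (bump (x.1 - k1%:~R) * bump (x.2 - k2%:~R) : R)%:E)); last first.
  by move=> k1 k2 _ _; rewrite EFinM mule_ge0.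
apply: (@le_trans _ _ (\esum_(k1 in [set: int]) (18%:E * (bump (x.1 - k1%:~R) : R)%:E))%E).
  apply: le_esum => k1 _.
  apply: (@le_trans _ _ ((bump (x.1 - k1%:~R))%:E * \esum_(k in [set: int]) (bump (x.2 - k%:~R))%:E)%E).
    by under eq_esum do rewrite EFinM; apply: esumZl_le => //; exact: bump_ge0.
  by rewrite muleC lee_wpmul2r// esum_bump_shift.
apply: le_trans (esumZl_le _ _) _ => //.
by rewrite [leRHS]EFinM lee_wpmul2l// esum_bump_shift.
Qed.

Definition lat (k : int * int) : pl := (k.1%:~R, k.2%:~R).
Definition sub2 (x y : pl) : pl := (x.1 - y.1, x.2 - y.2).

Lemma rint_bump_zz (x : pl) : rint cnt (fun i => bump (x.1 - (lat (zz i)).1) * bump (x.2 - (lat (zz i)).2)) /\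
  \int[cnt]_i (bump (x.1 - (lat (zz i)).1) * bump (x.2 - (lat (zz i)).2)) <= 18 * 18.
Proof.
pose c (k : int * int) : R := bump (x.1 - (lat k).1) * bump (x.2 - (lat k).2).
have c0 k : 0 <= c k by rewrite mulr_ge0// bump_ge0.
have ci : rint cnt (fun i => c (zz i)).
  apply: rint_zz; apply: le_lt_trans (ltry (18 * 18)); apply: le_trans (esum_bump2 x).
  by apply: le_esum => k _; rewrite lee_fin ger0_norm.
split=> //; rewrite -lee_fin -rint_fin//.
rewrite (@integral_zz R (fun k => (c k)%:E)); last by move=> k; rewrite lee_fin.
exact: esum_bump2.
Qed.

End BumpSums.

(** * The sampling formula *)

Section Sampling.
Context {R : realType}.
Local Notation cnt := (@cnt R).
Local Notation mu := (@area R).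
Local Notation pl := (measurableTypeR R * measurableTypeR R)%type.

Variables (h : pl -> R) (b M C : R).
Hypothesis mh : measurable_fun setT h.
Hypothesis hM : forall z, `|h z| <= M.
Hypothesis b_half : b < 1 / 2.
Hypothesis h_supp : forall z : pl, ~~ ((`|z.1| <= b) && (`|z.2| <= b)) -> h z = 0.
Hypothesis h_cont : continuous (h : R * R -> R).
Hypothesis h_even : forall z, h (opp2 z) = h z.
Hypothesis h_decay : forall x, `|cosft h x| <= C * (bump x.1 * bump x.2).

Lemma sampling_rint : rint mu h.
Proof. exact: (rint_box mh hM h_supp). Qed.

(** The integrand is odd because [h] is even. *)
Lemma int_mul_sin (x : pl) : \int[mu]_y (h y * sin (2 * pi * dot2 x y)) = 0.
Proof.
have ms : rint mu (fun y => h y * sin (2 * pi * dot2 x y)).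
  have := rint_mul_cos (2 * pi) (- (pi / 2)) x sampling_rint.
  by congr rint; apply/funext => y; rewrite cosBpihalf.
have [_] := rint_opp2 ms.
rewrite (_ : (fun y => h (opp2 y) * sin (2 * pi * dot2 x (opp2 y))) =
  (fun y => -1 * (h y * sin (2 * pi * dot2 x y)))); last first.
  apply/funext => y; rewrite h_even mulN1r -mulrN -sinN; congr (_ * sin _).
  by rewrite /dot2 /opp2 /=; ring.
by rewrite RintegralZl//; lra.
Qed.

(** Addition formula, its sine part vanishing by [int_mul_sin]. It merges the two oscillating
    factors of the lattice sum into a single phase. *)
Lemma cosft_cos (x : pl) (t : R) :
  cosft h x * cos t = \int[mu]_y (h y * cos (2 * pi * dot2 x y - t)).
Proof.
have ic := rint_mul_cos0 (2 * pi) x sampling_rint.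
have is_ : rint mu (fun y => h y * sin (2 * pi * dot2 x y)).
  have := rint_mul_cos (2 * pi) (- (pi / 2)) x sampling_rint.
  by congr rint; apply/funext => y; rewrite cosBpihalf.
transitivity (\int[mu]_y (h y * cos (2 * pi * dot2 x y) * cos t +
    h y * sin (2 * pi * dot2 x y) * sin t)).
  by rewrite RintegralD ?RintegralZr ?int_mul_sin ?mul0r ?addr0//; exact: rintZr.
by congr Rintegral; apply/funext => y; rewrite cosB; ring.
Qed.

Variables (x y eta : pl).
Hypothesis eta1 : `|eta.1| <= b.
Hypothesis eta2 : `|eta.2| <= b.

Let c (k : int * int) : R :=
  cosft h (sub2 x (lat k)) * cos (2 * pi * dot2 (sub2 y (lat k)) eta).

Let phi (z : pl) : R := 2 * pi * (dot2 x z - dot2 y eta).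

Lemma sampling_rint_zz : rint cnt (fun i => c (zz i)).
Proof.
have [bi _] := rint_bump_zz x.
apply: rint_le (rintZl C bi) _; first by [].
move=> i; rewrite /c normrM; apply: (le_trans _ (h_decay (sub2 x (lat (zz i))))).
by rewrite ler_piMr// cos_max.
Qed.

(** By [cosft_cos] the term [c k] is an integral of [h] against a cosine with phase [phi z] minus
    [2 * pi] times the scalar product of [k] and [z - eta]. Summation over all differences [k]
    produces Fejer kernels in [z - eta], and a translation by [eta] centres them at 0. *)
Lemma sampling_sum N :
  \sum_(i : 'I_N * 'I_N) \sum_(j : 'I_N * 'I_N) c (ord2_diff i j) =
  \int[mu]_z (h (affine2 1 eta z) * cos (phi (affine2 1 eta z)) * (fejer N z.1 * fejer N z.2)).
Proof.
pose al (z : pl) (i : 'I_N * 'I_N) : R :=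
  2 * pi * (i.1%:R * (z.1 - eta.1)) + 2 * pi * (i.2%:R * (z.2 - eta.2)).
have cE i j : c (ord2_diff i j) =
    \int[mu]_z (h z * cos (phi z - (al z i - al z j))).
  rewrite /c cosft_cos; congr Rintegral; apply/funext => z; congr (_ * cos _).
  rewrite /phi /al /dot2 /sub2 /lat /ord2_diff /ord_diff /= !intrB -!pmulrn; ring.
have ci i j : rint mu (fun z => h z * cos (phi z - (al z i - al z j))).
  have := rint_mul_cos (2 * pi) (- (2 * pi * dot2 (sub2 y (lat (ord2_diff i j))) eta))
    (sub2 x (lat (ord2_diff i j))) sampling_rint.
  congr rint; apply/funext => z; congr (_ * cos _).
  rewrite /phi /al /dot2 /sub2 /lat /ord2_diff /ord_diff /= !intrB -!pmulrn; ring.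
under eq_bigr => i _ do (under eq_bigr => j _ do rewrite cE; rewrite -int_sum//).
rewrite -int_sum; last by move=> i; exact: (rint_sum _ (ci i)).
pose F (z : pl) : R := h z * cos (phi z) * (fejer N (z.1 - eta.1) * fejer N (z.2 - eta.2)).
have FE : (fun z => \sum_i \sum_j h z * cos (phi z - (al z i - al z j))) = F.
  apply/funext => z; under eq_bigr => i _ do rewrite -mulr_sumr.
  rewrite -mulr_sumr sum_cos_sub /F -mulrA; congr (_ * (_ * _)).
  exact: (sum_cos_sin_pair (fun i : 'I_N => 2 * pi * (i%:R * (z.1 - eta.1)))
    (fun i : 'I_N => 2 * pi * (i%:R * (z.2 - eta.2)))).
have iF : rint mu F.
  by rewrite -FE; apply: rint_sum => i; exact: (rint_sum _ (ci i)).
rewrite FE.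
have [_] := rint_affine2 eta ltr01 iF; rewrite expr1n invr1 mul1r => <-.
congr Rintegral; apply/funext => z; rewrite /F; congr (_ * (fejer N _ * fejer N _)).
  by rewrite /affine2 /= mul1r addrK.
by rewrite /affine2 /= mul1r addrK.
Qed.

(* The Cesaro means of the lattice sum are Fejer integrals over the support of
   [h], whose side is less than 1; only the peak of the kernel at [0] survives. *)
Lemma sampling : \int[cnt]_i c (zz i) = h eta * cos (2 * pi * dot2 (sub2 x y) eta).
Proof.
pose v (z : pl) : R := h (affine2 1 eta z) * cos (phi (affine2 1 eta z)).
have b0 : 0 <= b by exact: le_trans (normr_ge0 _) eta1.
(* After translation by [eta] the support lies in the square of half-side [2 * b < 1]; the maximum
   meets the requirement [1 / 2 <= k] of [fejer_cvg]. *)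
pose k := Num.max (2 * b) (1 / 2).
have cv := cesaro_zz sampling_rint_zz.
have E0 : affine2 1 eta (0, 0) = eta.
  by rewrite /affine2 /= !mulr0 !add0r -surjective_pairing.
have v0 : v (0, 0) = h eta * cos (2 * pi * dot2 (sub2 x y) eta).
  by rewrite /v E0 /phi; congr (_ * cos _); rewrite /dot2 /sub2 /=; ring.
have mphi : measurable_fun setT (fun z => cos (phi z)).
  have := measurable_cos_dot2 (2 * pi) (- (2 * pi * dot2 y eta)) x.
  by congr measurable_fun; apply/funext => z; congr cos; rewrite /phi; ring.
have cphi : continuous (fun z : R * R => cos (phi z)).
  move=> z; apply: (@continuous_comp _ _ _ (phi : R * R -> R) cos); last exact: continuous_cos.
  rewrite /phi /dot2; apply: cvgM; first exact: cvg_cst.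
  apply: cvgB; last exact: cvg_cst.
  by apply: cvgD; apply: cvgM; [exact: cvg_cst|exact: cvg_fst|exact: cvg_cst|exact: cvg_snd].
rewrite -v0; apply: (cvg_unique _ cv); first exact: norm_hausdorff.
rewrite /=; under eq_fun do rewrite sampling_sum.
have ma := measurable_affine2 1 eta.
apply: (@fejer_cvg R v M k).
- apply: measurable_funM; first exact: (measurableT_comp mh ma).
  exact: (measurableT_comp mphi ma).
- by move=> z; rewrite normrM (le_trans _ (hM (affine2 1 eta z)))// ler_piMr// cos_max.
- by rewrite /k le_max lexx orbT.
- by rewrite /k gt_max; apply/andP; split; have := b_half; intros; lra.
- move=> z; apply: contraNeq => vz.
  have : (`|(affine2 1 eta z).1| <= b) && (`|(affine2 1 eta z).2| <= b).
    by apply: contraNT vz => /h_supp; rewrite /v => ->; rewrite mul0r.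
  have tri (u w : R) : `|w| <= b -> `|u + w| <= b -> `|u| <= 2 * b.
    move=> wb uwb; rewrite -[u](addrK w) (le_trans (ler_normB _ _))//; lra.
  rewrite /affine2 /= !mul1r /k => /andP[/(tri _ _ eta1) h1 /(tri _ _ eta2) h2].
  by rewrite !le_max h1 h2.
- move=> e e0.
  have cw : continuous (fun z : R * R => h z * cos (phi z)).
    by move=> z; apply: cvgM; [exact: h_cont|exact: cphi].
  have /cvgrPdist_le /(_ _ e0) := cw eta.
  rewrite -nbhs_ballE => -[d /= d0 Hd]; exists (d / 2); first by rewrite divr_gt0.
  move=> z z1 z2; rewrite distrC /v E0; apply: (Hd (affine2 1 eta z)).
  have dd : d / 2 < d by rewrite ltr_pdivrMr// mulr2n mulrDr mulr1 ltrDl.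
  by split; rewrite /= /ball /= /affine2 /= mul1r opprD addrCA subrr addr0 normrN (le_lt_trans _ dd).
Qed.

End Sampling.

(** * The reproducing formula on one scale *)

Section CountableProduct.
Context d1 d2 (T : measurableType d1) (U : measurableType d2).

(** A preimage is the countable union of its slices at the points of [nat]. *)
Lemma measurable_fun_prod_nat (F : T * nat -> U) :
  (forall i, measurable_fun setT (fun x => F (x, i))) -> measurable_fun setT F.
Proof.
move=> mF _ Y mY; rewrite setTI.
have -> : F @^-1` Y = \bigcup_i (((fun x => F (x, i)) @^-1` Y) `*` [set i]).
  apply/seteqP; split=> [[x i] Fxi|[x i] [j _ [/= ? ->]]] //; first by exists i.
apply: bigcupT_measurable => i; apply: measurableX => //.
by rewrite -[X in measurable X]setTI; exact: mF.
Qed.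

End CountableProduct.

Section Tiling.
Context {R : realType}.
Local Notation cnt := (@cnt R).
Local Notation mu := (@area R).
Local Notation pl := (measurableTypeR R * measurableTypeR R)%type.

Local Notation sub2 := (@sub2 R).
Local Notation opp2 := (@opp2 R).
Local Notation affine2 := (@affine2 R).
Local Notation lat := (@lat R).

Definition add2 (x y : pl) : pl := (x.1 + y.1, x.2 + y.2).
(** Half-open, hence a fundamental domain of the lattice: each point of the plane has exactly one
    lattice translate in it. *)
Definition unit_sq : set pl := `[0, 1[%classic `*` `[0, 1[%classic.
Definition chi (x : pl) : R := \1_unit_sq x.

Lemma measurable_unit_sq : measurable unit_sq.
Proof. by apply: measurableX; exact: measurable_itv. Qed.

Lemma measurable_chi : measurable_fun setT chi.
Proof. by apply: measurable_indic; exact: measurable_unit_sq. Qed.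

Lemma chi_ge0 x : 0 <= chi x. Proof. by rewrite /chi indicE. Qed.

Lemma area_unit_sq : mu unit_sq = 1%E.
Proof.
rewrite /area (product_measure1E (@lebesgue_measure R) (@lebesgue_measure R)); last 2 first.
  exact: measurable_itv.
  exact: measurable_itv.
by rewrite /= lebesgue_measure_itv /= lte_fin ltr01 sube0 mule1.
Qed.

Lemma rint_chi : rint mu chi /\ \int[mu]_x chi x = 1.
Proof.
have i1 : (\int[mu]_x (chi x)%:E = 1)%E.
  rewrite integral_indic//; last exact: measurable_unit_sq.
  by rewrite setIT; exact: area_unit_sq.
split; last by rewrite /Rintegral i1.
by apply: rint_of_ge0; [exact: measurable_chi|exact: chi_ge0|rewrite i1 ltry].
Qed.

Lemma measurable_add2 y : measurable_fun setT (fun x => add2 x y).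
Proof.
have := measurable_affine2 1 y; congr measurable_fun; apply/funext => x.
by rewrite /affine2 /add2 !mul1r.
Qed.

Lemma measurable_sub2 y : measurable_fun setT (fun x => sub2 x y).
Proof. exact: (measurable_add2 (opp2 y)). Qed.

Lemma ge0_integral_add2 (F : pl -> \bar R) y : measurable_fun setT F ->
  (forall x, 0 <= F x)%E -> (\int[mu]_x F (add2 x y) = \int[mu]_x F x)%E.
Proof.
move=> mF F0; have := ge0_integral_affine2 y ltr01 mF F0.
rewrite expr1n invr1 mul1e => <-; apply: eq_integral => x _.
by rewrite /affine2 /add2 !mul1r.
Qed.

Lemma rint_add2 (F : pl -> R) y : rint mu F ->
  rint mu (fun x => F (add2 x y)) /\ \int[mu]_x F (add2 x y) = \int[mu]_x F x.
Proof.
move=> iF; have := rint_affine2 y ltr01 iF; rewrite expr1n invr1 mul1r.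
have -> // : (fun x => F (affine2 1 y x)) = (fun x => F (add2 x y)).
by apply/funext => x; rewrite /affine2 /add2 !mul1r.
Qed.

Lemma rint_sub2 (F : pl -> R) y : rint mu F ->
  rint mu (fun x => F (sub2 x y)) /\ \int[mu]_x F (sub2 x y) = \int[mu]_x F x.
Proof. exact: (@rint_add2 F (opp2 y)). Qed.

Lemma chi_lat x : exists m, forall k, chi (add2 x (lat k)) = (k == m)%:R.
Proof.
exists (- Num.floor (x.1 : R), - Num.floor (x.2 : R)) => -[k1 k2].
rewrite /chi indicE /unit_sq in_setX /= !mem_setE !in_itv /= xpair_eqE.
have H (t : R) (k : int) : (0 <= t + k%:~R < 1) = (k == - Num.floor t).
  have -> : (k == - Num.floor t) = (Num.floor t == - k) by rewrite eq_sym eqr_oppLR.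
  rewrite floor_eq // intrD mulrNz; apply/idP/idP => /andP[h1 h2]; apply/andP; split; lra.
by rewrite !H.
Qed.

Lemma chi_zz x (c : R) : rint cnt (fun i => chi (add2 x (lat (zz i))) * c) /\
  \int[cnt]_i (chi (add2 x (lat (zz i))) * c) = c.
Proof.
have [m Hm] := chi_lat x.
have [i1 e1] := int_delta_zz (fun=> c) m.
split; [move: i1; congr rint|rewrite -[RHS]e1; congr Rintegral];
  by apply/funext => i; rewrite Hm.
Qed.

Lemma chi_zz_ge0 x (c : \bar R) : (0 <= c)%E ->
  (\int[cnt]_i ((chi (add2 x (lat (zz i))))%:E * c) = c)%E.
Proof.
move=> c0; have [i1 e1] := chi_zz x 1.
rewrite ge0_integralZr//; last first.
  by move=> i _; rewrite lee_fin chi_ge0.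
transitivity (1%:E * c)%E; last by rewrite mul1e.
congr (_ * _)%E; rewrite -e1 -rint_fin//; apply: eq_integral => i _.
by rewrite mulr1.
Qed.

(** The translates of [chi] form a partition of unity; it is inserted, Tonelli is applied, and each
    term is moved by its lattice vector. *)
Lemma ge0_tiling (F : pl -> \bar R) : measurable_fun setT F ->
  (forall x, 0 <= F x)%E ->
  (\int[mu]_x F x =
   \int[mu]_x \int[cnt]_i ((chi x)%:E * F (sub2 x (lat (zz i)))))%E.
Proof.
move=> mF F0.
pose K1 (z : pl * nat) := ((chi (add2 z.1 (lat (zz z.2))))%:E * F z.1)%E.
pose K2 (z : pl * nat) := ((chi z.1)%:E * F (sub2 z.1 (lat (zz z.2))))%E.
have K10 z : (0 <= K1 z)%E by rewrite mule_ge0// lee_fin chi_ge0.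
have K20 z : (0 <= K2 z)%E by rewrite mule_ge0// lee_fin chi_ge0.
have mK1 : measurable_fun setT K1.
  apply: measurable_fun_prod_nat => i; apply: emeasurable_funM => //.
  apply/measurable_EFinP; exact: (measurableT_comp measurable_chi (measurable_add2 (lat (zz i)))).
have mK2 : measurable_fun setT K2.
  apply: measurable_fun_prod_nat => i; apply: emeasurable_funM.
    by apply/measurable_EFinP; exact: measurable_chi.
  exact: (measurableT_comp mF (measurable_sub2 (lat (zz i)))).
transitivity (\int[mu]_x \int[cnt]_i K1 (x, i))%E.
  by apply: eq_integral => x _; rewrite /K1 /= chi_zz_ge0.
rewrite (@fubini_tonelli _ _ _ _ _ mu cnt K1 mK1 K10).
transitivity (\int[cnt]_i \int[mu]_x K2 (x, i))%E; last first.
  exact: esym (@fubini_tonelli _ _ _ _ _ mu cnt K2 mK2 K20).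
apply: eq_integral => i _.
rewrite -(@ge0_integral_add2 (fun x => K2 (x, i)) (lat (zz i))).
- apply: eq_integral => x _; rewrite /K1 /K2 /=; congr (_ * F _)%E.
  by rewrite /sub2 /add2 /= !addrK -surjective_pairing.
- apply: emeasurable_funM; first by apply/measurable_EFinP; exact: measurable_chi.
  exact: (measurableT_comp mF (measurable_sub2 (lat (zz i)))).
- by move=> x; exact: K20.
Qed.

(** The same unfolding for signed [F]. Applied to the modulus of [F], [ge0_tiling] yields the
    integrability that Fubini needs on the folded side. *)
Lemma tiling (F : pl -> R) : rint mu F ->
  \int[mu]_x F x = \int[mu]_x (chi x * \int[cnt]_i F (sub2 x (lat (zz i)))).
Proof.
move=> iF; have mF := rint_measurable iF.
pose K1 (z : pl * nat) := chi (add2 z.1 (lat (zz z.2))) * F z.1.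
pose K2 (z : pl * nat) := chi z.1 * F (sub2 z.1 (lat (zz z.2))).
have mK1 : measurable_fun setT K1.
  apply: measurable_fun_prod_nat => i; apply: measurable_funM => //.
  exact: (measurableT_comp measurable_chi (measurable_add2 (lat (zz i)))).
have mK2 : measurable_fun setT K2.
  apply: measurable_fun_prod_nat => i; apply: measurable_funM; first exact: measurable_chi.
  exact: (measurableT_comp mF (measurable_sub2 (lat (zz i)))).
have mFE : measurable_fun setT (EFin \o F) by exact/measurable_EFinP.
have Foo : (\int[mu]_x `|F x|%:E < +oo)%E by case/integrableP: iF.
have iK1 : rint (mu \x cnt)%E K1.
  apply/(@integrable12ltyP _ _ _ _ _ mu cnt); first exact/measurable_EFinP.
  under eq_integral => x _.
    under eq_integral => i _ do rewrite /K1 /= normrM ger0_norm ?chi_ge0// EFinM.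
    rewrite chi_zz_ge0 ?lee_fin//.
    over.
  exact: Foo.
have iK2 : rint (mu \x cnt)%E K2.
  apply/(@integrable12ltyP _ _ _ _ _ mu cnt); first exact/measurable_EFinP.
  under eq_integral => x _.
    under eq_integral => i _ do rewrite /K2 /= normrM ger0_norm ?chi_ge0// EFinM.
    over.
  rewrite -(@ge0_tiling (fun x => `|F x|%:E)) //.
  exact: (measurableT_comp (f := abse) _ mFE).
transitivity (\int[mu]_x \int[cnt]_i K1 (x, i)).
  by congr Rintegral; apply/funext => x; rewrite (chi_zz x (F x)).2.
rewrite (rint_fubini iK1).
transitivity (\int[cnt]_i \int[mu]_x K2 (x, i)).
  congr Rintegral; apply/funext => i.
  have -> : (fun x => K1 (x, i)) = (fun x => K2 (add2 x (lat (zz i)), i)).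
    apply/funext => x; rewrite /K1 /K2 /=; congr (_ * F _).
    by rewrite /sub2 /add2 /= !addrK -surjective_pairing.
  have [K2i|nK2i] := pselect (rint mu (fun x => K2 (x, i))).
    by rewrite (rint_add2 (lat (zz i)) K2i).2.
  have iKi : rint mu (fun x => K2 (x, i)).
    apply: rint_le (rint_norm (rint_sub2 (lat (zz i)) iF).1) _.
      apply: measurable_funM; first exact: measurable_chi.
      exact: (measurableT_comp mF (measurable_sub2 (lat (zz i)))).
    move=> x; rewrite normrM ler_piMl// ger0_norm ?chi_ge0//.
    by rewrite /chi indicE lern1 leq_b1.
  by rewrite (rint_add2 (lat (zz i)) iKi).2.
rewrite -(rint_fubini iK2); congr Rintegral; apply/funext => x.
have [x0|x0] := eqVneq (chi x) 0.
  rewrite x0 mul0r (_ : (fun i => _) = cst 0); last first.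
    by apply/funext => i; rewrite /K2 /= x0 mul0r.
  by rewrite Rintegral_cst// mul0r.
have x1 : chi x = 1 by move: x0; rewrite /chi indicE; case: (_ \in _); rewrite ?eqxx.
by rewrite x1 mul1r; congr Rintegral; apply/funext => i; rewrite /K2 /= x1 mul1r.
Qed.

Definition bump2 (x : pl) : R := bump x.1 * bump x.2.

Lemma bump2_gt0 x : 0 < bump2 x.
Proof. by rewrite mulr_gt0 ?bump_gt0. Qed.

Lemma measurable_bump : measurable_fun setT (@bump R).
Proof.
apply: continuous_measurable_fun => t; apply: cvgV.
  by rewrite gt_eqF// ltr_wpDr// sqr_ge0.
by apply: cvgD; [exact: cvg_cst|exact: exprn_continuous].
Qed.

Lemma measurable_bump2 : measurable_fun setT bump2.
Proof.
by apply: measurable_funM; [exact: (measurableT_comp measurable_bump measurable_fst)|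
  exact: (measurableT_comp measurable_bump measurable_snd)].
Qed.

Lemma rint_bump2_zz (x : pl) : rint cnt (fun i => bump2 (sub2 x (lat (zz i)))) /\
  \int[cnt]_i bump2 (sub2 x (lat (zz i))) <= 18 * 18.
Proof. exact: rint_bump_zz. Qed.

(** Tiling reduces the integral to the unit square, where the periodised function is at most
    [18 * 18]. *)
Lemma rint_bump2 : rint mu bump2.
Proof.
apply: rint_of_ge0; [exact: measurable_bump2|by move=> x; exact: ltW (bump2_gt0 x)|].
rewrite (@ge0_tiling (fun x => (bump2 x)%:E)); last 2 first.
- by apply/measurable_EFinP; exact: measurable_bump2.
- by move=> x; rewrite lee_fin ltW// bump2_gt0.
apply: (@le_lt_trans _ _ (\int[mu]_x (chi x * (18 * 18))%:E)%E); last first.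
  by rewrite (rint_fin (rintZr _ rint_chi.1)) ltry.
apply: ge0_le_integral => //.
- by move=> x _; apply: integral_ge0 => i _; rewrite mule_ge0// lee_fin ?chi_ge0// ltW// bump2_gt0.
- apply: (@measurable_fun_fubini_tonelli_F _ _ _ _ _ cnt
    (fun z => ((chi z.1)%:E * (bump2 (sub2 z.1 (lat (zz z.2))))%:E)%E)) => [|z].
    apply: measurable_fun_prod_nat => i; apply: emeasurable_funM; apply/measurable_EFinP.
      exact: measurable_chi.
    exact: (measurableT_comp measurable_bump2 (measurable_sub2 (lat (zz i)))).
  by rewrite mule_ge0// lee_fin ?chi_ge0// ltW// bump2_gt0.
- by apply/measurable_EFinP; apply: measurable_funM => //; exact: measurable_chi.
move=> x _; have [i1 le1] := rint_bump2_zz x.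
under eq_integral do rewrite -EFinM.
rewrite rint_fin; last exact: rintZl.
by rewrite RintegralZl// lee_fin ler_wpM2l// chi_ge0.
Qed.

(** Fubini yields measurability of a parameter integral when the integrand is jointly integrable.
    The factor [bump2] makes it so in [x], and being positive it can be divided out again. *)
Lemma measurable_cosft (h : pl -> R) : rint mu h -> measurable_fun setT (cosft h).
Proof.
move=> ih; pose F (z : pl * pl) : R := bump2 z.1 * (h z.2 * cos (2 * pi * dot2 z.1 z.2)).
have md : measurable_fun setT (fun z : pl * pl => cos (2 * pi * dot2 z.1 z.2)).
  apply: (measurableT_comp measurable_cos); apply: measurable_funM => //.
  apply: measurable_funD; apply: measurable_funM.
  - exact: (measurableT_comp measurable_fst measurable_fst).
  - exact: (measurableT_comp measurable_fst measurable_snd).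
  - exact: (measurableT_comp measurable_snd measurable_fst).
  - exact: (measurableT_comp measurable_snd measurable_snd).
have iF : rint (mu \x mu)%E F.
  apply: (@rint_prod12 _ _ _ _ _ mu mu _ (fun x => bump2 x * \int[mu]_y `|h y|)).
  - apply: measurable_funM; first exact: (measurableT_comp measurable_bump2 measurable_fst).
    apply: measurable_funM => //; exact: (measurableT_comp (rint_measurable ih) measurable_snd).
  - exact: rintZr rint_bump2.
  - move=> x; have ic := rint_mul_cos0 (2 * pi) x ih; split; first exact: (rintZl (bump2 x) ic).
    rewrite -RintegralZl//; last exact: rint_norm.
    apply: le_Rintegral => //.
    + exact: (rint_norm (rintZl (bump2 x) ic)).
    + exact: (rintZl (bump2 x) (rint_norm ih)).
    + move=> y _; rewrite /F normrM ger0_norm ?ler_wpM2l ?(ltW (bump2_gt0 x))//.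
      by rewrite normrM ler_piMr// cos_max.
have [/rint_measurable mI _] := rint_fubini1 iF.
have -> : cosft h = (fun x => (1 + x.1 ^+ 2) * (1 + x.2 ^+ 2) * \int[mu]_y F (x, y)).
  apply/funext => x; rewrite /F /= RintegralZl//; last exact: rint_mul_cos0.
  rewrite (_ : (1 + x.1 ^+ 2) * (1 + x.2 ^+ 2) = (bump2 x)^-1); last first.
    by rewrite /bump2 /bump invfM !invrK.
  by rewrite mulKf// gt_eqF// bump2_gt0.
apply: measurable_funM => //; apply: measurable_funM; apply: measurable_funD => //;
  by apply: measurable_funX.
Qed.

End Tiling.

Section Reproducing.
Context {R : realType}.
Local Notation cnt := (@cnt R).
Local Notation mu := (@area R).
Local Notation pl := (measurableTypeR R * measurableTypeR R)%type.
Local Notation sub2 := (@sub2 R).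
Local Notation opp2 := (@opp2 R).
Local Notation lat := (@lat R).
Local Notation bump2 := (@bump2 R).

Variables (h : pl -> R) (b M C : R).
Hypothesis mh : measurable_fun setT h.
Hypothesis hM : forall z, `|h z| <= M.
Hypothesis b0 : 0 <= b.
Hypothesis b_half : b < 1 / 2.
Hypothesis h_supp : forall z : pl, ~~ ((`|z.1| <= b) && (`|z.2| <= b)) -> h z = 0.
Hypothesis h_cont : continuous (h : R * R -> R).
Hypothesis h_even : forall z, h (opp2 z) = h z.
Hypothesis C0 : 0 <= C.
Hypothesis h_decay : forall x, `|cosft h x| <= C * bump2 x.

Let ih : rint mu h. Proof. exact: (sampling_rint mh hM h_supp). Qed.

Lemma rint_cosft : rint mu (cosft h).
Proof. exact: (rint_le (measurable_cosft ih) (rintZl C (@rint_bump2 R))). Qed.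

Lemma rint_cosft_zz x : rint cnt (fun i => cosft h (sub2 x (lat (zz i)))) /\
  \int[cnt]_i `|cosft h (sub2 x (lat (zz i)))| <= C * (18 * 18).
Proof.
have [bi be] := rint_bump2_zz x.
have ic : rint cnt (fun i => cosft h (sub2 x (lat (zz i)))).
  by apply: rint_le (rintZl C bi) _ => // i; exact: h_decay.
split=> //; apply: le_trans (ler_wpM2l C0 be).
rewrite -RintegralZl//; apply: le_Rintegral => //; first exact: rint_norm.
exact: rintZl.
Qed.

(** Fourier inversion at a single point: after tiling, the lattice sum over the translates of any
    [x] is [sampling] at frequency 0, with value [h (0, 0)]. *)
Lemma int_cosft : \int[mu]_x cosft h x = h (0, 0).
Proof.
rewrite (tiling rint_cosft).
transitivity (\int[mu]_x (chi x * h (0, 0))); last first.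
  by have [ic ec] := @rint_chi R; rewrite RintegralZr // ec mul1r.
congr Rintegral; apply/funext => x; congr (_ * _).
have := @sampling R h b M C mh hM b_half h_supp h_cont h_even h_decay x x (0, 0).
rewrite /= normr0 => /(_ b0 b0); rewrite [dot2 _ _]/dot2 /= !mulr0 addr0 mulr0 cos0 mulr1 => <-.
congr Rintegral; apply/funext => i.
by rewrite /dot2 /= !mulr0 addr0 mulr0 cos0 mulr1.
Qed.

(** Only the second factor is expanded as an integral over frequencies [z]. After exchange with the
    lattice sum, [sampling] with [eta = z] evaluates that sum and contributes the second factor
    [h z]; it applies in the supporting square, and elsewhere both sides vanish. *)
Lemma reproducing x y :
  rint cnt (fun i => cosft h (sub2 x (lat (zz i))) * cosft h (sub2 y (lat (zz i)))) /\
  \int[cnt]_i (cosft h (sub2 x (lat (zz i))) * cosft h (sub2 y (lat (zz i)))) =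
  cosft (fun z => h z ^+ 2) (sub2 x y).
Proof.
have [ix _] := rint_cosft_zz x; have [iy _] := rint_cosft_zz y.
pose F (z : pl * nat) : R := cosft h (sub2 x (lat (zz z.2))) *
  (h z.1 * cos (2 * pi * dot2 (sub2 y (lat (zz z.2))) z.1)).
have iF : rint (mu \x cnt)%E F.
  apply: rint_le (rint_tensor (rint_norm ih) (rint_norm ix)) _.
    apply: measurable_fun_prod_nat => i; apply: measurable_funM; first exact: (measurable_cst (cosft h (sub2 x (lat (zz i))))).
    apply: measurable_funM; first exact: mh.
    have := measurable_cos_dot2 (2 * pi) 0 (sub2 y (lat (zz i))).
    by congr measurable_fun; apply/funext => z; rewrite addr0.
  by move=> z; rewrite /F /= !normrM [leRHS]mulrC ler_wpM2l// ler_piMr// cos_max.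
have FE i : \int[mu]_z F (z, i) =
    cosft h (sub2 x (lat (zz i))) * cosft h (sub2 y (lat (zz i))).
  by rewrite /F /= RintegralZl//; exact: rint_mul_cos0.
have [iG _] := rint_fubini2 iF.
split; first by move: iG; congr rint; apply/funext => i; exact: FE.
transitivity (\int[cnt]_i \int[mu]_z F (z, i)).
  by congr Rintegral; apply/funext => i; rewrite FE.
rewrite -(rint_fubini iF); congr Rintegral; apply/funext => z.
have [/andP[z1 z2]|hz] := boolP ((`|z.1| <= b) && (`|z.2| <= b)); last first.
  rewrite (h_supp hz) expr0n mul0r (_ : (fun i => _) = cst 0).
    by rewrite Rintegral_cst// mul0r.
  by apply/funext => i; rewrite /F /= (h_supp hz) mul0r mulr0.
have S := @sampling R h b M C mh hM b_half h_supp h_cont h_even h_decay x y z z1 z2.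
have Si := @sampling_rint_zz R h C h_decay x y z.
rewrite expr2 -mulrA -S -RintegralZl//; congr Rintegral; apply/funext => i.
by rewrite /F /=; ring.
Qed.

End Reproducing.

Section ProductTools.
Context d1 d2 (T : measurableType d1) (U : measurableType d2).

Lemma measurable_fun_nat_prod (F : nat * T -> U) :
  (forall i, measurable_fun setT (fun x => F (i, x))) -> measurable_fun setT F.
Proof.
move=> mF _ Y mY; rewrite setTI.
have -> : F @^-1` Y = \bigcup_i ([set i] `*` ((fun x => F (i, x)) @^-1` Y)).
  apply/seteqP; split=> [[i x] Fxi|[i x] [j _ [/= -> ?]]] //; first by exists i.
apply: bigcupT_measurable => i; apply: measurableX => //.
by rewrite -[X in measurable X]setTI; exact: mF.
Qed.

End ProductTools.

(** * Autocorrelation and the frame sum at scale 0 *)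

Section SquareIntegrable.
Context {R : realType}.
Local Notation mu := (@area R).
Local Notation pl := (measurableTypeR R * measurableTypeR R)%type.
Local Notation sub2 := (@sub2 R).
Local Notation opp2 := (@opp2 R).
Local Notation add2 := (@add2 R).

Definition autocor (f : pl -> R) (s : pl) : R := \int[mu]_x (f x * f (sub2 x s)).

Lemma le_norm_sqr1 (a : R) : `|a| <= a ^+ 2 + 1.
Proof.
have := sqr_ge0 (`|a| - 1); rewrite sqrrB real_normK ?num_real//; have := normr_ge0 a; lra.
Qed.

Lemma amgm (a b : R) : `|a * b| <= a ^+ 2 / 2 + b ^+ 2 / 2.
Proof.
rewrite normrM; have := sqr_ge0 (`|a| - `|b|); rewrite sqrrB !real_normK ?num_real//; lra.
Qed.

Lemma int_sub2l (F : pl -> R) (x : pl) : rint mu F ->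
  rint mu (fun s => F (sub2 x s)) /\ \int[mu]_s F (sub2 x s) = \int[mu]_y F y.
Proof.
move=> iF; have [i1 e1] := rint_add2 x iF; have [i2 e2] := rint_opp2 i1.
have E : (fun s => F (add2 (opp2 s) x)) = (fun s => F (sub2 x s)).
  apply/funext => s; congr F; rewrite /add2 /opp2 /sub2 /=.
  by congr (_, _); rewrite addrC.
by rewrite -E -e1 -e2.
Qed.

Variable f : pl -> R.
Hypothesis mf : measurable_fun setT f.
Hypothesis f2 : rint mu (fun x => f x ^+ 2).

(** By [le_norm_sqr1] the product is dominated by [K * f ^+ 2 + |g|]. *)
Lemma rint_mul_bounded (g : pl -> R) (K : R) : rint mu g -> (forall x, `|g x| <= K) ->
  rint mu (fun x => f x * g x).
Proof.
move=> ig gK; apply: rint_le (rintD (rintZl K f2) (rint_norm ig)) _.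
  by apply: measurable_funM => //; exact: rint_measurable ig.
move=> x; rewrite normrM; have := le_norm_sqr1 (f x).
move=> /(ler_wpM2r (normr_ge0 (g x))) /le_trans; apply.
by rewrite mulrDl mul1r lerD// [leRHS]mulrC ler_wpM2l// sqr_ge0.
Qed.

Lemma f2_sub2 s : rint mu (fun x => f (sub2 x s) ^+ 2) /\
  \int[mu]_x f (sub2 x s) ^+ 2 = \int[mu]_x f x ^+ 2.
Proof. exact: (rint_sub2 s f2). Qed.

(** The inequality between arithmetic and geometric mean loses nothing against Cauchy-Schwarz here,
    since [f] and its translate have the same square integral. *)
Lemma autocor_rint s : rint mu (fun x => f x * f (sub2 x s)) /\
  \int[mu]_x `|f x * f (sub2 x s)| <= \int[mu]_x f x ^+ 2.
Proof.
have [fs2 fse] := f2_sub2 s.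
have ib := rintD (rintZr 2^-1 f2) (rintZr 2^-1 fs2).
have i1 : rint mu (fun x => f x * f (sub2 x s)).
  apply: rint_le ib _; last by move=> x; exact: amgm.
  by apply: measurable_funM => //; exact: (measurableT_comp mf (measurable_sub2 s)).
split=> //; apply: (@le_trans _ _ (\int[mu]_x (f x ^+ 2 / 2 + f (sub2 x s) ^+ 2 / 2))).
  by apply: le_Rintegral => //; [exact: rint_norm|move=> x _; exact: amgm].
rewrite RintegralD//; [|exact: rintZr|exact: rintZr].
by rewrite !RintegralZr// fse; lra.
Qed.

Lemma autocor_le s : `|autocor f s| <= \int[mu]_x f x ^+ 2.
Proof.
have [i1 le1] := autocor_rint s.
exact: le_trans (le_normr_Rintegral measurableT i1) le1.
Qed.

Lemma measurable_sub2_fst : measurable_fun setT (fun z : pl * pl => sub2 z.1 z.2).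
Proof.
apply: measurable_fun_pair; apply: measurable_funB.
- exact: (measurableT_comp measurable_fst measurable_fst).
- exact: (measurableT_comp measurable_fst measurable_snd).
- exact: (measurableT_comp measurable_snd measurable_fst).
- exact: (measurableT_comp measurable_snd measurable_snd).
Qed.

Lemma autocor_mul_rint (G : pl -> R) : rint mu G ->
  rint (mu \x mu)%E (fun z : pl * pl => G z.1 * (f z.2 * f (sub2 z.2 z.1))) /\
  rint mu (fun s => G s * autocor f s).
Proof.
move=> iG.
have msw : measurable_fun setT (fun z : pl * pl => sub2 z.2 z.1).
  exact: (measurableT_comp measurable_sub2_fst (measurable_fun_pair measurable_snd measurable_fst)).
have i1 : rint (mu \x mu)%E (fun z : pl * pl => G z.1 * (f z.2 * f (sub2 z.2 z.1))).
  apply: (@rint_prod12 _ _ _ _ _ mu mu _ (fun s => `|G s| * \int[mu]_x f x ^+ 2)).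
  - apply: measurable_funM; first exact: (measurableT_comp (rint_measurable iG) measurable_fst).
    apply: measurable_funM; first exact: (measurableT_comp mf measurable_snd).
    exact: (measurableT_comp mf msw).
  - exact: rintZr (rint_norm iG).
  - move=> s; have [ia le] := autocor_rint s; split; first exact: (rintZl (G s) ia).
    rewrite (_ : (fun y => _) = (fun y => `|G s| * `|f y * f (sub2 y s)|)); last first.
      by apply/funext => y; rewrite /= normrM.
    by rewrite RintegralZl//; [rewrite ler_wpM2l|exact: rint_norm].
split=> //; have [i2 _] := rint_fubini1 i1; move: i2; congr rint; apply/funext => s.
by rewrite /= RintegralZl//; case: (autocor_rint s).
Qed.

(** The device of [measurable_cosft]: multiply by [bump2] to reach an integrable function, then
    divide. *)
Lemma measurable_autocor : measurable_fun setT (autocor f).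
Proof.
have [_ /rint_measurable mW] := autocor_mul_rint (@rint_bump2 R).
have -> : autocor f = (fun s => (1 + s.1 ^+ 2) * (1 + s.2 ^+ 2) * (bump2 s * autocor f s)).
  apply/funext => s.
  rewrite (_ : (1 + s.1 ^+ 2) * (1 + s.2 ^+ 2) = (bump2 s)^-1); last first.
    by rewrite /bump2 /bump invfM !invrK.
  by rewrite mulKf// gt_eqF// bump2_gt0.
apply: measurable_funM => //; apply: measurable_funM; apply: measurable_funD => //;
  by apply: measurable_funX.
Qed.

(** The substitution [s = x - y] in the inner integral, followed by Fubini. *)
Lemma int_convolution (G : pl -> R) (K : R) : rint mu G -> (forall x, `|G x| <= K) ->
  rint (@area2 R) (fun z => f z.1 * f z.2 * G (sub2 z.1 z.2)) ->
  \int[@area2 R]_z (f z.1 * f z.2 * G (sub2 z.1 z.2)) = \int[mu]_s (G s * autocor f s).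
Proof.
move=> iG GK iK.
have [_ <-] := @rint_fubini1 _ _ _ _ _ mu mu _ iK.
have [i1 _] := autocor_mul_rint iG.
transitivity (\int[mu]_x \int[mu]_s (G s * (f x * f (sub2 x s)))).
  congr Rintegral; apply/funext => x /=.
  have iGx : rint mu (fun y => G (sub2 x y)) by exact: (int_sub2l x iG).1.
  have iy : rint mu (fun y => f x * f y * G (sub2 x y)).
    have := rintZl (f x) (rint_mul_bounded iGx (fun y => GK (sub2 x y))).
    by congr rint; apply/funext => y; rewrite mulrA.
  have [_ <-] := int_sub2l x iy; congr Rintegral; apply/funext => s.
  have -> : sub2 x (sub2 x s) = s.
    by rewrite /sub2 /= !opprB !(addrC (x.1)) !(addrC (x.2)) !subrK -surjective_pairing.
  by rewrite mulrC.
have := rint_fubini i1 => /= <-.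
congr Rintegral; apply/funext => s; rewrite /= RintegralZl//.
by case: (autocor_rint s).
Qed.

End SquareIntegrable.

Section FrameScale.
Context {R : realType}.
Local Notation cnt := (@cnt R).
Local Notation mu := (@area R).
Local Notation pl := (measurableTypeR R * measurableTypeR R)%type.
Local Notation sub2 := (@sub2 R).
Local Notation lat := (@lat R).
Local Notation bump2 := (@bump2 R).

Variables (f psi G : pl -> R) (C K : R).
Hypothesis mf : measurable_fun setT f.
Hypothesis f2 : rint mu (fun x => f x ^+ 2).
Hypothesis mpsi : measurable_fun setT psi.
Hypothesis C0 : 0 <= C.
Hypothesis psi_le : forall x, `|psi x| <= C * bump2 x.
Hypothesis iG : rint mu G.
Hypothesis GK : forall x, `|G x| <= K.
Hypothesis rep : forall x y, \int[cnt]_i (psi (sub2 x (lat (zz i))) * psi (sub2 y (lat (zz i)))) =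
  G (sub2 x y).

Let ipsi : rint mu psi. Proof. exact: rint_le mpsi (rintZl C (@rint_bump2 R)) psi_le. Qed.

Lemma bump2_le1 x : bump2 x <= 1.
Proof.
rewrite /bump2 mulr_ile1 ?bump_ge0//; rewrite invf_le1 ?ltr_wpDr ?sqr_ge0//;
  by rewrite lerDl sqr_ge0.
Qed.

Let psi_C x : `|psi x| <= C.
Proof. by rewrite (le_trans (psi_le x))// ler_piMr// bump2_le1. Qed.

Let T i x := psi (sub2 x (lat (zz i))).

Let iT i : rint mu (T i) /\ \int[mu]_x `|T i x| = \int[mu]_x `|psi x|.
Proof.
by split; [exact: (rint_sub2 (lat (zz i)) ipsi).1|
  exact: (rint_sub2 (lat (zz i)) (rint_norm ipsi)).2].
Qed.

Let ifT i : rint mu (fun x => f x * T i x).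
Proof. by apply: (rint_mul_bounded mf f2 (iT i).1) => x; exact: psi_C. Qed.

(** The source of absolute convergence. Splitting [f x * f y] into halves of squares bounds the
    double integral belonging to the lattice point [i] by the L1 norm of [psi] times [J i], and the
    decay of [psi] makes [J] summable. *)
Let J i := \int[mu]_x (f x ^+ 2 * `|T i x|).

Let ifJ i : rint mu (fun x => f x ^+ 2 * `|T i x|).
Proof.
apply: rint_le (rintZr C f2) _.
  apply: measurable_funM; first exact: rint_measurable f2.
  exact: rint_measurable (rint_norm (iT i).1).
by move=> x; rewrite normrM ger0_norm ?sqr_ge0// normr_id ler_wpM2l ?sqr_ge0// psi_C.
Qed.

Let iJ : rint cnt J.
Proof.
have i1 : rint (mu \x cnt)%E (fun z : pl * nat => f z.1 ^+ 2 * `|T z.2 z.1|).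
  apply: (@rint_prod12 _ _ _ _ _ mu cnt _ (fun x => f x ^+ 2 * (C * (18 * 18)))).
  - apply: measurable_fun_prod_nat => i; exact: rint_measurable (ifJ i).
  - exact: rintZr.
  - move=> x; have [bi be] := rint_bump2_zz x.
    have ic : rint cnt (fun i => T i x).
      by apply: rint_le (rintZl C bi) _ => // i; exact: psi_le.
    split; first exact: (rintZl (f x ^+ 2) (rint_norm ic)).
    rewrite (_ : (fun y => _) = (fun i => f x ^+ 2 * `|T i x|)); last first.
      by apply/funext => i; rewrite /= normrM normr_id ger0_norm ?sqr_ge0.
    rewrite RintegralZl//; last exact: rint_norm.
    rewrite ler_wpM2l ?sqr_ge0//; apply: le_trans (ler_wpM2l C0 be).
    rewrite -RintegralZl//; apply: le_Rintegral => //; first exact: rint_norm.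
      exact: rintZl.
    by move=> i _; exact: psi_le.
by have [] := rint_fubini2 i1.
Qed.

Let P (z : nat * (pl * pl)) : R := (f z.2.1 * T z.1 z.2.1) * (f z.2.2 * T z.1 z.2.2).

Let Pi i : rint (@area2 R) (fun z => P (i, z)) /\
  \int[@area2 R]_z P (i, z) = (\int[mu]_x (f x * T i x)) ^+ 2.
Proof.
split; first exact: (rint_tensor (ifT i) (ifT i)).
by rewrite expr2 -(int_tensor (ifT i) (ifT i)).2.
Qed.

Let Pabs i : \int[@area2 R]_z `|P (i, z)| <= (\int[mu]_x `|psi x|) * J i.
Proof.
have [Ti Te] := iT i; have nTi := rint_norm Ti.
have i1 := rint_tensor (ifJ i) nTi; have i2 := rint_tensor nTi (ifJ i).
have [_ e1] := int_tensor (ifJ i) nTi; have [_ e2] := int_tensor nTi (ifJ i).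
have iS := rintZr 2^-1 (rintD i1 i2).
apply: le_trans (le_Rintegral measurableT (rint_norm (Pi i).1) iS _) _.
  move=> z _ /=.
  rewrite /P /= mulrACA normrM; apply: le_trans (ler_wpM2r _ (amgm _ _)) _ => //.
  by rewrite normrM le_eqVlt; apply/orP; left; apply/eqP; field.
rewrite RintegralZr//; last exact: rintD.
by rewrite RintegralD// e1 e2 Te -/(J i); set a := Rintegral _ _ _; lra.
Qed.

Let iP : rint (cnt \x @area2 R)%E P.
Proof.
apply: (@rint_prod12 _ _ _ _ _ cnt (@area2 R) _ (fun i => (\int[mu]_x `|psi x|) * J i)).
- by apply: measurable_fun_nat_prod => i; exact: rint_measurable (Pi i).1.
- exact: (rintZl _ iJ).
- by move=> i; split; [exact: (Pi i).1|exact: Pabs].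
Qed.

(* Fubini moves the lattice sum inside the double integral of
   [f x * f y * psi (x - k) * psi (y - k)], where it produces [G (x - y)]. *)
Lemma frame_scale :
  rint cnt (fun i => (\int[mu]_x (f x * psi (sub2 x (lat (zz i))))) ^+ 2) /\
  \int[cnt]_i (\int[mu]_x (f x * psi (sub2 x (lat (zz i))))) ^+ 2 =
  \int[mu]_s (G s * autocor f s).
Proof.
have [i1 e1] := rint_fubini1 iP; have [i2 e2] := rint_fubini2 iP.
have E1 : (fun i => \int[@area2 R]_z P (i, z)) =
    (fun i => (\int[mu]_x (f x * psi (sub2 x (lat (zz i))))) ^+ 2).
  by apply/funext => i; rewrite (Pi i).2.
have E2 : (fun z => \int[cnt]_i P (i, z)) = (fun z => f z.1 * f z.2 * G (sub2 z.1 z.2)).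
  apply/funext => z; rewrite -rep -RintegralZl//; last first.
    have [bi _] := rint_bump2_zz z.1.
    apply: rint_le (rintZl (C * C) bi) _ => // i.
    rewrite normrM mulrC -[leRHS]mulrA; apply: ler_pM => //.
  by congr Rintegral; apply/funext => i; rewrite /P /T /=; ring.
rewrite E1 in i1; rewrite E1 in e1; rewrite E2 in i2; rewrite E2 in e2.
split=> //; rewrite e1 -e2; exact: int_convolution.
Qed.

End FrameScale.

(** * Continuity of translations in L2 *)

Import HBNNSimple.
Section ShiftContinuity.
Context d (T : measurableType d) {R : realType}.
Variables (mu : {measure set T -> \bar R}) (tau : nat -> T -> T).
Hypothesis mtau : forall n, measurable_fun setT (tau n).
Hypothesis tau_int : forall n (F : T -> R), rint mu F ->
  rint mu (fun x => F (tau n x)) /\ \int[mu]_x F (tau n x) = \int[mu]_x F x.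
Implicit Types f g : T -> R.

Definition shift_dist f n := \int[mu]_x (f x - f (tau n x)) ^+ 2.

Definition L2fun f := measurable_fun setT f /\ rint mu (fun x => f x ^+ 2).

(** Relative to a sequence [tau] of measure-preserving maps of an arbitrary space, since the notion
    serves both on the line and in the plane. *)
Definition shift_cont f := L2fun f /\ shift_dist f @ \oo --> (0 : R).

Lemma sqrB_le (a b : R) : (a - b) ^+ 2 <= 2 * a ^+ 2 + 2 * b ^+ 2.
Proof. have := sqr_ge0 (a + b); rewrite sqrrB sqrrD; lra. Qed.

Lemma sqrD_le (a b : R) : (a + b) ^+ 2 <= 2 * a ^+ 2 + 2 * b ^+ 2.
Proof. have := sqr_ge0 (a - b); rewrite sqrrB sqrrD; lra. Qed.

Lemma L2funB f g : L2fun f -> L2fun g -> L2fun (fun x => f x - g x).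
Proof.
move=> [mf f2] [mg g2]; split; first exact: measurable_funB.
apply: rint_le (rintD (rintZl 2 f2) (rintZl 2 g2)) _.
  by apply: measurable_funX; exact: measurable_funB.
by move=> x; rewrite ger0_norm ?sqr_ge0// sqrB_le.
Qed.

Lemma L2funZ k f : L2fun f -> L2fun (fun x => k * f x).
Proof.
move=> [mf f2]; split; first exact: measurable_funM.
by have := rintZl (k ^+ 2) f2; congr rint; apply/funext => x; rewrite exprMn.
Qed.

Lemma L2fun_tau n f : L2fun f -> L2fun (fun x => f (tau n x)).
Proof.
move=> [mf f2]; split; first exact: (measurableT_comp mf (mtau n)).
by case: (tau_int n f2).
Qed.

Lemma rint_shift f n : L2fun f -> rint mu (fun x => (f x - f (tau n x)) ^+ 2).
Proof. by move=> Lf; exact: (L2funB Lf (L2fun_tau n Lf)).2. Qed.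

Lemma shift_dist_ge0 f n : 0 <= shift_dist f n.
Proof. by apply: Rintegral_ge0 => x _; exact: sqr_ge0. Qed.

(** The increment of [f] is the increment of [f - g] plus that of [g]. Two applications of
    [(a + b) ^ 2 <= 2 a ^ 2 + 2 b ^ 2] give weights 4, 4 and 2, and invariance under [tau] makes the
    first two integrals equal. *)
Lemma shift_dist_le f g n : L2fun f -> L2fun g ->
  shift_dist f n <= 8 * (\int[mu]_x (f x - g x) ^+ 2) + 2 * shift_dist g n.
Proof.
move=> Lf Lg; have Lfg := L2funB Lf Lg.
have i1 := Lfg.2; have [i2 e2] := tau_int n i1; have i3 := rint_shift n Lg.
have i4 := rintD (rintD (rintZl 4 i1) (rintZl 4 i2)) (rintZl 2 i3).
apply: le_trans (le_Rintegral measurableT (rint_shift n Lf) i4 _) _.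
  move=> x _; set a := f x; set b := g x; set c := f _; set e := g _.
  have := sqrD_le (a - b - (c - e)) (b - e).
  have := sqrB_le (a - b) (c - e).
  have -> : a - b - (c - e) + (b - e) = a - c by ring.
  by lra.
rewrite (RintegralD measurableT (rintD (rintZl 4 i1) (rintZl 4 i2)) (rintZl 2 i3)).
rewrite (RintegralD measurableT (rintZl 4 i1) (rintZl 4 i2)).
by rewrite !RintegralZl// e2 /shift_dist; lra.
Qed.

Lemma shift_cont_approx f : L2fun f ->
  (forall e : R, 0 < e -> exists2 g, shift_cont g & \int[mu]_x (f x - g x) ^+ 2 <= e) ->
  shift_cont f.
Proof.
move=> Lf H; split=> //; apply/cvgrPdist_le => e e0.
have [g [Lg cg] ge] := H (e / 16) (divr_gt0 e0 (ltr0Sn _ 15)).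
have /cvgrPdist_le /(_ (e / 4) (divr_gt0 e0 (ltr0Sn _ 3))) := cg.
apply: filterS => n; rewrite !sub0r !normrN !ger0_norm ?shift_dist_ge0// => h.
by apply: le_trans (shift_dist_le n Lf Lg) _; lra.
Qed.

Lemma shift_contZ k f : shift_cont f -> shift_cont (fun x => k * f x).
Proof.
move=> [Lf cf]; split; first exact: L2funZ.
rewrite (_ : shift_dist _ = (fun n => k ^+ 2 * shift_dist f n)).
  by rewrite -[X in _ --> X](mulr0 (k ^+ 2)); apply: cvgM => //; exact: cvg_cst.
apply/funext => n; rewrite /shift_dist -RintegralZl//; last exact: rint_shift.
by congr Rintegral; apply/funext => x; rewrite -exprMn mulrBr.
Qed.

Lemma shift_contB f g : shift_cont f -> shift_cont g ->
  shift_cont (fun x => f x - g x).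
Proof.
move=> [Lf cf] [Lg cg]; have Lfg := L2funB Lf Lg; split=> //.
apply: (@squeeze_cvgr _ _ _ _ (cst 0) (fun n => 2 * shift_dist f n + 2 * shift_dist g n)).
- apply: nearW => n; rewrite shift_dist_ge0 /=.
  have i1 := rint_shift n Lf; have i2 := rint_shift n Lg.
  rewrite /shift_dist -!RintegralZl// -RintegralD//; [|exact: rintZl|exact: rintZl].
  apply: le_Rintegral => //.
  + exact: (rint_shift n Lfg).
  + by apply: rintD; exact: rintZl.
  + by move=> x _; rewrite (_ : _ - _ = (f x - f (tau n x)) - (g x - g (tau n x)));
      [exact: sqrB_le|ring].
- exact: cvg_cst.
- rewrite -[X in _ --> X]addr0 -(mulr0 2).
  by apply: cvgD; apply: cvgM => //; exact: cvg_cst.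
Qed.

Lemma shift_contD f g : shift_cont f -> shift_cont g ->
  shift_cont (fun x => f x + g x).
Proof.
move=> Lf /(shift_contZ (-1)) /(shift_contB Lf); congr shift_cont.
by apply/funext => x; rewrite mulN1r opprK.
Qed.

Lemma shift_cont0 : shift_cont (fun=> 0).
Proof.
have E0 : (fun=> (0 : R) ^+ 2) = (fun=> 0 : R) :> (T -> R) by rewrite expr0n.
split; first by split => //; rewrite E0; exact: rint0.
rewrite (_ : shift_dist _ = cst 0); first exact: cvg_cst.
apply/funext => n; rewrite /shift_dist subrr E0.
by rewrite Rintegral_cst// mul0r.
Qed.

Lemma shift_cont_sum n (F : 'I_n -> T -> R) : (forall i, shift_cont (F i)) ->
  shift_cont (fun x => \sum_(i < n) F i x).
Proof.
elim: n F => [|n IH] F cF.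
  rewrite (_ : (fun x => _) = (fun=> 0)); first exact: shift_cont0.
  by apply/funext => x; rewrite big_ord0.
rewrite (_ : (fun x => _) = (fun x => \sum_(i < n) F (widen_ord (leqnSn n) i) x + F ord_max x)).
  by apply: shift_contD => //; exact: IH.
by apply/funext => x; rewrite big_ord_recr.
Qed.

Variable (G : set (set T)).
Hypothesis GI : setI_closed G.
Hypothesis Gm : measurable = <<s G >>.

Lemma L2fun_indic (E : set T) : measurable E -> (mu E < +oo)%E -> L2fun (\1_E : T -> R).
Proof.
move=> mE Eoo; have mi : measurable_fun setT (\1_E : T -> R) by exact: measurable_indic.
split=> //.
rewrite (_ : (fun x => _) = (\1_E : T -> R)).
  apply: rint_of_ge0 => //.
  by rewrite integral_indic// setIT.
by apply/funext => x; rewrite indicE -natrX; case: (_ \in _).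
Qed.

(** Dynkin's argument, run inside [D] so that all indicators are square integrable: proper
    differences are handled by linearity, increasing unions by [shift_cont_approx] and dominated
    convergence. *)
Lemma shift_cont_sets (D : set T) : measurable D -> (mu D < +oo)%E ->
  shift_cont (\1_D : T -> R) ->
  (forall E, G E -> shift_cont (\1_(E `&` D) : T -> R)) ->
  forall E, measurable E -> shift_cont (\1_(E `&` D) : T -> R).
Proof.
move=> mD Doo cD GD E mE.
pose H := [set E | measurable E /\ shift_cont (\1_(E `&` D) : T -> R)].
suff : <<s G >> `<=` H by rewrite -Gm => /(_ _ mE) [].
have ED F : measurable F -> L2fun (\1_(F `&` D) : T -> R).
  move=> mF; apply: L2fun_indic; first exact: measurableI.
  by apply: le_lt_trans Doo; apply: le_measure; rewrite ?inE//; exact: measurableI.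
apply: lambda_system_subset => //; last first.
  by move=> F GF; split; [rewrite Gm; exact: sub_sigma_algebra|exact: GD].
split => //.
- by split=> //; rewrite setTI.
- move=> A B BA [mA cA] [mB cB]; split; first exact: measurableD.
  have := shift_contB cA cB; congr shift_cont; apply/funext => x.
  rewrite !indicE !in_setI in_setC.
  have [xB|xB] := boolP (x \in B); last by rewrite andbT subr0.
  have -> : x \in A by move: xB; rewrite !inE; exact: BA.
  by rewrite subrr.
- move=> F ndF HF; split; first by apply: bigcupT_measurable => n; case: (HF n).
  have mU : measurable (\bigcup_n F n) by apply: bigcupT_measurable => n; case: (HF n).
  apply: shift_cont_approx; first exact: ED.
  move=> e e0.
  have [||||_] := @rint_dct _ _ _ mu (fun n x => (\1_(\bigcup_n F n `&` D) x - \1_(F n `&` D) x : R) ^+ 2)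
     (fun=> 0) (\1_D : T -> R).
  + move=> n; apply: measurable_funX; apply: measurable_funB; apply: measurable_indic;
    by apply: measurableI => //; case: (HF n).
  + move=> x; apply: cvg_near_cst.
    have [[k _ Fkx]|xF] := pselect ((\bigcup_n F n) x); last first.
      apply: nearW => n; have xFn : ~ F n x by move=> Fnx; apply: xF; exists n.
      by rewrite !indicE !in_setI (memNset xF) (memNset xFn) subrr expr0n.
    exists k => // n /= kn; have Fnx : F n x by have /subsetPset := ndF k n kn; apply.
    have UFx : (\bigcup_n F n) x by exists n.
    by rewrite !indicE !in_setI (mem_set UFx) (mem_set Fnx) subrr expr0n.
  + have [mD1 D2] := L2fun_indic mD Doo.
    by move: D2; congr rint; apply/funext => x; rewrite indicE -natrX; case: (_ \in _).
  + move=> n x; rewrite !indicE !in_setI ger0_norm ?sqr_ge0//.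
    by do 3 case: (_ \in _); rewrite /= ?subrr ?subr0 ?sub0r ?sqrrN ?expr1n ?expr0n.
  rewrite Rintegral_cst// mul0r => /cvgrPdist_le /(_ _ e0) [n _ Hn].
  exists (\1_(F n `&` D) : T -> R); first by case: (HF n).
  have := Hn n (leqnn n); rewrite /= sub0r normrN ger0_norm//.
  by apply: Rintegral_ge0 => x _; exact: sqr_ge0.
Qed.

Variable D : nat -> set T.
Hypothesis mD : forall n, measurable (D n).
Hypothesis Doo : forall n, (mu (D n) < +oo)%E.
Hypothesis D_exhaust : forall x, \forall n \near \oo, D n x.
Hypothesis cD : forall n, shift_cont (\1_(D n) : T -> R).
Hypothesis GD : forall n E, G E -> shift_cont (\1_(E `&` D n) : T -> R).

(** Simple functions increasing to [f], cut off to the sets [D n] of finite measure, converge to [f]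
    in L2 with dominating function [f ^+ 2]. Each of them is a finite combination of the indicators
    treated in [shift_cont_sets]. *)
Lemma shift_cont_ge0 f : L2fun f -> (forall x, 0 <= f x) -> shift_cont f.
Proof.
move=> Lf f0; have [mf f2] := Lf; apply: (shift_cont_approx Lf) => e e0.
have mfE : measurable_fun setT (EFin \o f) by exact/measurable_EFinP.
pose s n : {nnsfun T >-> R} := nnsfun_approx measurableT mfE n.
pose g n : T -> R := s n.
pose v n : seq R := finmap.enum_fset (fset_set (range (s n))).
have g_cvg x : (fun n => g n x) @ \oo --> f x.
  have := @cvg_nnsfun_approx _ _ _ _ measurableT _ mfE (fun y _ => f0 y) x I.
  by move/fine_cvgP => [].
have g_le n x : g n x <= f x.
  rewrite -(cvg_lim (@Rhausdorff _) (g_cvg x)).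
  apply: nondecreasing_cvgn_le (n) => [i j ij|]; last by apply/cvg_ex; exists (f x).
  by have /lefP := nd_nnsfun_approx measurableT mfE ij; exact.
pose u n x := g n x * \1_(D n) x.
have cu n : shift_cont (u n).
  rewrite (_ : u n = fun x => \sum_(i < size (v n))
     ((v n)`_i * \1_((s n @^-1` [set (v n)`_i]) `&` D n) x)).
    apply: shift_cont_sum => i; apply: shift_contZ; apply: shift_cont_sets => //.
    exact: GD.
  apply/funext => x; rewrite /u /g fimfunEord mulr_suml; apply: eq_bigr => i _.
  by rewrite -mulrA indicI.
have mu_ n : measurable_fun setT (u n) by have [[]] := cu n.
have [||||_] := @rint_dct _ _ _ mu (fun n x => (f x - u n x) ^+ 2) (fun=> 0) (fun x => f x ^+ 2).
- by move=> n; apply: measurable_funX; exact: measurable_funB.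
- move=> x.
  have cux : (fun n => u n x) @ \oo --> f x.
    rewrite -[X in _ --> X]mulr1; apply: cvgM; first exact: g_cvg.
    apply: cvg_near_cst; apply: filterS (D_exhaust x) => n Dnx.
    by rewrite indicE mem_set.
  have c0 : (fun n => f x - u n x) @ \oo --> (0 : R).
    by rewrite -(subrr (f x)); apply: cvgB => //; exact: cvg_cst.
  rewrite -(mulr0 0); under eq_fun do rewrite expr2; exact: cvgM.
- exact: f2.
- move=> n x; rewrite ger0_norm ?sqr_ge0//.
  have ux : 0 <= u n x <= f x.
    rewrite /u indicE; case: (_ \in _); rewrite ?mulr1 ?mulr0 ?lexx ?f0//.
    by rewrite g_le andbT.
  rewrite ler_sqr ?nnegrE//; last by case/andP: ux => _; rewrite subr_ge0.
  by case/andP: ux => h _; rewrite gerBl.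
rewrite Rintegral_cst// mul0r => /cvgrPdist_le /(_ _ e0) [n _ Hn].
exists (u n) => //; have := Hn n (leqnn n); rewrite /= sub0r normrN ger0_norm//.
by apply: Rintegral_ge0 => x _; exact: sqr_ge0.
Qed.

Lemma shift_cont_L2 f : L2fun f -> shift_cont f.
Proof.
move=> [mf f2].
(* Both signs in one argument: [s = 1] gives the positive part of [f], [s = -1] the negative
   part. *)
have H (s : R) : shift_cont (fun x => Num.max (s * f x) 0) \/ `|s| != 1.
  have [s1|] := eqVneq `|s| 1; [left|by right].
  apply: shift_cont_ge0; last by move=> x; rewrite le_max lexx orbT.
  have mm : measurable_fun setT (fun x => Num.max (s * f x) 0).
    by apply: measurable_maxr => //; exact: measurable_funM.
  split=> //; apply: rint_le f2 _; first exact: measurable_funX.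
  move=> x; rewrite ger0_norm ?sqr_ge0//.
  have -> : f x ^+ 2 = (s * f x) ^+ 2 by rewrite exprMn -[s ^+ 2]real_normK ?num_real// s1 expr1n mul1r.
  by case: (leP (s * f x) 0) => h //; rewrite expr0n/= sqr_ge0.
have [h1|] := H 1; last by rewrite normr1 eqxx.
have [h2|] := H (-1); last by rewrite normrN1 eqxx.
have := shift_contB h1 h2; congr shift_cont; apply/funext => x.
by rewrite mul1r mulN1r; case: leP => a; case: leP => b; rewrite ?subr0 ?sub0r ?opprK//; lra.
Qed.

End ShiftContinuity.

Section Translations.
Context {R : realType}.
Local Notation leb := (@lebesgue_measure R).
Local Notation mu := (@area R).
Local Notation ln := (measurableTypeR R).
Local Notation pl := (measurableTypeR R * measurableTypeR R)%type.
Local Notation sub2 := (@sub2 R).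

Definition tr (s : nat -> R) n (t : ln) : ln := t - s n.

Lemma measurable_tr s n : measurable_fun setT (tr s n).
Proof.
have := measurable_affine 1 (- s n); congr measurable_fun.
by apply/funext => t; rewrite mul1r.
Qed.

Lemma rint_tr s n (F : ln -> R) : rint leb F ->
  rint leb (fun t => F (tr s n t)) /\ \int[leb]_t F (tr s n t) = \int[leb]_t F t.
Proof.
move=> iF; have H A (mA : measurable A) : (leb A = 1%:E * leb (tr s n @^-1` A))%E.
  rewrite (leb_affine (- s n) ltr01 mA); congr (_ * leb _)%E.
  by apply/funext => t; rewrite /preimage /tr /= mul1r.
have [h1 h2] := rint_change ltr01 (measurable_tr s n) H iF.
by split; [exact: h1|rewrite h2 mul1r].
Qed.

Definition segm (n : nat) : set ln := `]- (n%:R : R), n%:R]%classic.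

Lemma leb_itv_fin (i : interval R) (a b : R) (x y : bool) :
  i = Interval (BSide x a) (BSide y b) -> (leb [set` i] < +oo)%E.
Proof. by move=> ->; rewrite lebesgue_measure_itv/=; case: ifP => _; rewrite ?ltry. Qed.

Lemma int_indic_ball (c e : R) : 0 <= e ->
  rint leb (\1_(`[c - e, c + e]%classic : set ln) : ln -> R) /\
  \int[leb]_t (\1_(`[c - e, c + e]%classic : set ln) t) = 2 * e.
Proof.
move=> e0; split; first exact: integrable_indic_itv.
rewrite /Rintegral integral_indic//.
rewrite setIT /= lebesgue_measure_itv/= lte_fin.
case: ltP => h /=; lra.
Qed.

(** An interval and its translate by [s] differ only at points within distance [|s|] of one of the
    two ends. *)
Lemma ocitv_shift_le (a b s t : R) :
  ((a < t <= b)%R%:R - (a < t - s <= b)%R%:R) ^+ 2 <=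
  (a - `|s| <= t <= a + `|s|)%R%:R + (b - `|s| <= t <= b + `|s|)%R%:R :> R.
Proof.
have h1 := ler_norm s; have h2 := ler_norm (- s); rewrite normrN in h2.
have [A|A] := boolP (a < t <= b); have [B|B] := boolP (a < t - s <= b);
  rewrite ?subrr ?subr0 ?sub0r ?sqrrN ?expr1n ?expr0n/= ?addr_ge0 ?ler0n//.
- have [C|C] := boolP (a - `|s| <= t <= a + `|s|); first by rewrite lerDl.
  suff -> : b - `|s| <= t <= b + `|s| by rewrite lerDr.
  move: A B C; rewrite !negb_and -!leNgt -!ltNge => /andP[A1 A2] B C; lra.
- have [C|C] := boolP (a - `|s| <= t <= a + `|s|); first by rewrite lerDl.
  suff -> : b - `|s| <= t <= b + `|s| by rewrite lerDr.
  move: A B C; rewrite !negb_and -!leNgt -!ltNge => A /andP[B1 B2] C; lra.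
Qed.

Lemma shift_cont_ocitv s : s @ \oo --> (0 : R) -> forall E, ocitv E ->
  shift_cont leb (tr s) (\1_(E : set ln) : ln -> R).
Proof.
move=> s0 _ [[a b] _ <-] /=.
have mI (x y : R) : measurable (`]x, y]%classic : set ln) by exact: measurable_itv.
have LE : L2fun leb (\1_(`]a, b]%classic : set ln) : ln -> R).
  by apply: L2fun_indic => //; exact: leb_itv_fin erefl.
split=> //.
apply: (@squeeze_cvgr _ _ _ _ (cst 0) (fun n => 4 * `|s n|)).
- apply: nearW => n; rewrite shift_dist_ge0 /=.
  have [i1 e1] := int_indic_ball a (normr_ge0 (s n)).
  have [i2 e2] := int_indic_ball b (normr_ge0 (s n)).
  apply: le_trans (le_Rintegral measurableT _ (rintD i1 i2) _) _.
  + exact: (rint_shift (measurable_tr s) (@rint_tr s) n LE).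
  + move=> t _; rewrite !indicE !mem_setE !in_itv /=; exact: ocitv_shift_le.
  + rewrite RintegralD// e1 e2; lra.
- exact: cvg_cst.
- rewrite -[X in _ --> X](mulr0 4) -[X in 4 * X](normr0 R).
  by apply: cvgM; [exact: cvg_cst|exact: cvg_norm].
Qed.

Lemma shift_cont_segm s : s @ \oo --> (0 : R) -> forall n E, measurable E ->
  shift_cont leb (tr s) (\1_(E `&` segm n) : ln -> R).
Proof.
move=> s0 n; apply: (shift_cont_sets (measurable_tr s) (@rint_tr s) (G := @ocitv R)) => //.
- exact: ocitvI.
- exact: measurable_itv.
- exact: leb_itv_fin erefl.
- by apply: shift_cont_ocitv => //; exact: is_ocitv.
- by move=> E oE; apply: shift_cont_ocitv => //; apply: ocitvI => //; exact: is_ocitv.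
Qed.

(** With primes for translates, [u v - u' v' = (u - u') v + u' (v - v')], and the square integral of
    each summand factors. *)
Lemma shift_cont_tensor s t (u v : ln -> R) : shift_cont leb (tr s) u ->
  shift_cont leb (tr t) v ->
  shift_cont mu (fun n z => sub2 z (s n, t n)) (fun z : pl => u z.1 * v z.2).
Proof.
move=> [Lu cu] [Lv cv]; have [mU u2] := Lu; have [mV v2] := Lv.
have Luv : L2fun mu (fun z : pl => u z.1 * v z.2).
  split; first by apply: measurable_funM; [exact: (measurableT_comp mU)|exact: (measurableT_comp mV)].
  have := rint_tensor u2 v2; congr rint.
  by apply/funext => z; rewrite exprMn.
split=> //.
pose U := \int[leb]_x u x ^+ 2; pose V := \int[leb]_x v x ^+ 2.
apply: (@squeeze_cvgr _ _ _ _ (cst 0)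
  (fun n => 2 * (shift_dist leb (tr s) u n * V) + 2 * (U * shift_dist leb (tr t) v n))).
- apply: nearW => n; rewrite shift_dist_ge0 /=.
  have iu := rint_shift (measurable_tr s) (@rint_tr s) n Lu.
  have iv := rint_shift (measurable_tr t) (@rint_tr t) n Lv.
  have [iu' eu] := rint_tr s n u2.
  have [j1 e1] := int_tensor iu v2; have [j2 e2] := int_tensor iu' iv.
  have k := rintD (rintZl 2 j1) (rintZl 2 j2).
  apply: le_trans (le_Rintegral measurableT _ k _) _.
  + exact: (rint_shift (fun m => measurable_sub2 (s m, t m) : measurable_fun setT _)
      (fun m F iF => rint_sub2 (s m, t m) iF) n Luv).
  + move=> z _ /=; rewrite -/(tr s n z.1) -/(tr t n z.2).
    rewrite (_ : _ - _ = (u z.1 - u (tr s n z.1)) * v z.2 + u (tr s n z.1) * (v z.2 - v (tr t n z.2))); last by ring.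
    by rewrite -!exprMn; exact: sqrD_le.
  + rewrite (RintegralD measurableT (rintZl 2 j1) (rintZl 2 j2)).
    rewrite !RintegralZl//.
    by rewrite e1 e2 eu.
- exact: cvg_cst.
- have E : 2 * (0 * V) + 2 * (U * 0) = 0 by ring.
  rewrite -[X in _ --> X]E; apply: cvgD.
    by apply: cvgM; [exact: cvg_cst|apply: cvgM; [exact: cu|exact: cvg_cst]].
  by apply: cvgM; [exact: cvg_cst|apply: cvgM; [exact: cvg_cst|exact: cv]].
Qed.

Definition square n : set pl := segm n `*` segm n.

Lemma measurable_square n : measurable (square n).
Proof. by apply: measurableX; exact: measurable_itv. Qed.

Lemma area_square n : (mu (square n) < +oo)%E.
Proof.
rewrite /square /area product_measure1E; [|exact: measurable_itv..].
by rewrite lte_mul_pinfty//; [rewrite ge0_fin_numE//|]; exact: leb_itv_fin erefl.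
Qed.

Lemma square_exhaust (x : pl) : \forall n \near \oo, square n x.
Proof.
near=> n; have h1 : `|x.1| < n%:R by near: n; exact: nbhs_infty_gtr.
have h2 : `|x.2| < n%:R by near: n; exact: nbhs_infty_gtr.
move: h1 h2; rewrite !ltr_norml => /andP[? /ltW ?] /andP[? /ltW ?].
by split; rewrite /segm /= in_itv /=; apply/andP.
Unshelve. all: by end_near. Qed.

(** Measurable rectangles generate the product structure, and cut off to a square their indicators
    are tensor products. As the sides are arbitrary measurable sets, the line has to be settled for
    all of them beforehand, in [shift_cont_segm]. *)
Lemma shift_cont_plane (s : nat -> pl) (f : pl -> R) :
  (fun n => (s n).1) @ \oo --> (0 : R) -> (fun n => (s n).2) @ \oo --> (0 : R) ->
  L2fun mu f -> shift_cont mu (fun n z => sub2 z (s n)) f.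
Proof.
move=> s1 s2.
have rect (A B : set ln) n : measurable A -> measurable B ->
    shift_cont mu (fun n z => sub2 z (s n)) (\1_((A `*` B) `&` square n) : pl -> R).
  move=> mA mB.
  have := shift_cont_tensor (shift_cont_segm s1 n mA) (shift_cont_segm s2 n mB).
  congr shift_cont.
  apply/funext => z; rewrite !indicE -natrM mulnb; congr (nat_of_bool _)%:R.
  apply/idP/idP; first by move=> /andP[]; rewrite !inE => -[? ?] [? ?]; split; split.
  by rewrite inE => -[[? ?] [? ?]]; rewrite !mem_set.
apply: (@shift_cont_L2 _ _ _ _ _ (fun n => measurable_sub2 (s n) : measurable_fun setT _)
  (fun n F iF => rint_sub2 (s n) iF) [set A `*` B | A in measurable & B in measurable]
  _ _ square).
- move=> _ _ [A mA [B mB <-]] [A' mA' [B' mB' <-]].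
  exists (A `&` A'); first exact: measurableI.
  exists (B `&` B'); first exact: measurableI.
  by rewrite setXI.
- exact: measurable_prod_measurableType.
- exact: measurable_square.
- exact: area_square.
- exact: square_exhaust.
- by move=> n; have := rect setT setT n measurableT measurableT; rewrite setXTT setTI.
- by move=> n _ [A mA [B mB <-]]; exact: rect.
Qed.

End Translations.

(** * Summation over the scales *)

Section AutocorLimits.
Context {R : realType}.
Local Notation leb := (@lebesgue_measure R).
Local Notation mu := (@area R).
Local Notation ln := (measurableTypeR R).
Local Notation pl := (measurableTypeR R * measurableTypeR R)%type.
Local Notation sub2 := (@sub2 R).
Local Notation autocor := (@autocor R).
Local Notation square := (@square R).

Variable f : pl -> R.
Hypothesis mf : measurable_fun setT f.
Hypothesis f2 : rint mu (fun x => f x ^+ 2).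

Let F := \int[mu]_x f x ^+ 2.

Let F0 : 0 <= F. Proof. by apply: Rintegral_ge0 => x _; exact: sqr_ge0. Qed.

(** Expansion of the square turns continuity of translations in L2 into continuity of the
    autocorrelation at 0. *)
Lemma shift_dist_autocor (s : nat -> pl) n :
  shift_dist mu (fun n z => sub2 z (s n)) f n = 2 * F - 2 * autocor f (s n).
Proof.
have [i1 e1] := f2_sub2 f2 (s n); have [i2 _] := autocor_rint mf f2 (s n).
rewrite /shift_dist (_ : (fun x => (f x - _) ^+ 2) =
  (fun x => (f x ^+ 2 + f (sub2 x (s n)) ^+ 2) - 2 * (f x * f (sub2 x (s n))))); last first.
  by apply/funext => x; ring.
have i3 := rintZl 2 i2; have i4 := rintD f2 i1.
rewrite (RintegralB measurableT i4 i3) (RintegralD measurableT f2 i1) RintegralZl//.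
by rewrite e1 -/F /autocor; ring.
Qed.

Lemma autocor_cvg0 (s : nat -> pl) :
  (fun n => (s n).1) @ \oo --> (0 : R) -> (fun n => (s n).2) @ \oo --> (0 : R) ->
  (fun n => autocor f (s n)) @ \oo --> F.
Proof.
move=> s1 s2; have [_ c] := shift_cont_plane s1 s2 (conj mf f2).
rewrite (_ : (fun n => autocor f (s n)) =
  (fun n => F - 2^-1 * shift_dist mu (fun n z => sub2 z (s n)) f n)); last first.
  by apply/funext => n; rewrite shift_dist_autocor; field.
have E : F - 2^-1 * 0 = F by ring.
rewrite -[X in _ --> X]E; apply: cvgB; first exact: cvg_cst.
by apply: cvgM => //; exact: cvg_cst.
Qed.

(** A small [l] goes in front of the full norm, while the large [l^-1] is absorbed by a tail. *)
Lemma amgm_weighted (l a b : R) : 0 < l -> `|a * b| <= l * a ^+ 2 + l^-1 * b ^+ 2.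
Proof.
move=> l0; rewrite normrM.
have h : 0 <= l^-1 * (l * `|a| - `|b|) ^+ 2 by rewrite mulr_ge0 ?invr_ge0 ?sqr_ge0// ltW.
have E : l^-1 * (l * `|a| - `|b|) ^+ 2 = l * `|a| ^+ 2 - 2 * (`|a| * `|b|) + l^-1 * `|b| ^+ 2.
  by field; rewrite gt_eqF.
rewrite E !real_normK ?num_real// in h.
have := normr_ge0 a; have := normr_ge0 b => nb na.
by have := mulr_ge0 na nb; lra.
Qed.

Let w m x : R := \1_(~` square m) x.

Let iw m : rint mu (fun x => w m x * f x ^+ 2).
Proof.
apply: (rint_le _ f2) => [|x].
  apply: measurable_funM; last exact: measurable_funX.
  by apply: measurable_indic; apply: measurableC; exact: measurable_square.
rewrite /w indicE normrM ger0_norm// ger0_norm ?sqr_ge0//.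
by case: (_ \in _); rewrite ?mul1r ?mul0r ?sqr_ge0.
Qed.

Lemma tail_cvg0 : (fun m => \int[mu]_x (w m x * f x ^+ 2)) @ \oo --> (0 : R).
Proof.
have [||||_] := @rint_dct _ _ _ mu (fun m x => w m x * f x ^+ 2) (fun=> 0) (fun x => f x ^+ 2).
- by move=> m; exact: rint_measurable (iw m).
- move=> x; apply: cvg_near_cst; apply: filterS (square_exhaust x) => m sx.
  by rewrite /w indicE memNset ?mul0r// => /(_ sx).
- exact: f2.
- move=> m x; rewrite /w indicE normrM ger0_norm// ger0_norm ?sqr_ge0//.
  by case: (_ \in _); rewrite ?mul1r ?mul0r ?sqr_ge0.
by rewrite Rintegral_cst// mul0r.
Qed.

(* At every [x] one of the two factors of [f x * f (x - s)] lies in the tail of [f]. *)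
Lemma autocor_far (l : R) m s : 0 < l -> (forall x, square m x -> ~ square m (sub2 x s)) ->
  `|autocor f s| <= l * (2 * F) + l^-1 * (2 * \int[mu]_x (w m x * f x ^+ 2)).
Proof.
move=> l0 Hs; have [i1 e1] := f2_sub2 f2 s; have [i2 _] := autocor_rint mf f2 s.
have [i3 e3] := rint_sub2 s (iw m).
have j1 := rintD f2 i1; have j2 := rintD (iw m) i3.
have k := rintD (rintZl l j1) (rintZl l^-1 j2).
apply: le_trans (le_normr_Rintegral measurableT i2) _.
apply: le_trans (le_Rintegral measurableT (rint_norm i2) k _) _.
  move=> x _; set a := f x; set b := f (sub2 x s).
  have l1 : 0 < l^-1 by rewrite invr_gt0.
  have w0 y : 0 <= w m y by rewrite /w indicE.
  have P1 := mulr_ge0 (ltW l1) (mulr_ge0 (w0 x) (sqr_ge0 a)).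
  have P2 := mulr_ge0 (ltW l1) (mulr_ge0 (w0 (sub2 x s)) (sqr_ge0 b)).
  have P3 := mulr_ge0 (ltW l0) (sqr_ge0 a).
  have P4 := mulr_ge0 (ltW l0) (sqr_ge0 b).
  rewrite !mulrDr; have [sx|sx] := pselect (square m x).
    have -> : w m (sub2 x s) = 1 by rewrite /w indicE mem_set//; exact: Hs.
    by rewrite mul1r; have := amgm_weighted a b l0; lra.
  have E : w m x = 1 by rewrite /w indicE mem_set.
  by rewrite E mul1r in P1 *; have := amgm_weighted b a l0; rewrite mulrC; lra.
rewrite (RintegralD measurableT (rintZl l j1) (rintZl l^-1 j2)) !RintegralZl//.
rewrite (RintegralD measurableT f2 i1) (RintegralD measurableT (iw m) i3) e1 e3 -/F.
by lra.
Qed.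

Lemma autocor_cvg_oo (s : nat -> pl) :
  (forall m, \forall n \near \oo, forall x, square m x -> ~ square m (sub2 x (s n))) ->
  (fun n => autocor f (s n)) @ \oo --> (0 : R).
Proof.
move=> Hs; apply/cvgrPdist_le => e e0.
(* Here [F + 1] avoids division by 0 when [f] vanishes. The order of choice is [l], then [m] with
   tail at most [l * e / 4], then [n]; each of the two terms of [autocor_far] is then at most
   [e / 2]. *)
pose l := e / (4 * (F + 1)).
have F1 : 0 < F + 1 by rewrite ltr_wpDl.
have l0 : 0 < l by rewrite divr_gt0// mulr_gt0.
have lF : l * (2 * F) <= e / 2.
  have -> : l * (2 * F) = (e / 2) * (F / (F + 1)) by rewrite /l; field; rewrite gt_eqF.
  apply: ler_piMr; first by rewrite divr_ge0// ltW.
  by rewrite ler_pdivrMr// mul1r lerDl.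
have /cvgrPdist_le /(_ (l * e / 4)) := tail_cvg0.
case; first by rewrite divr_gt0// mulr_gt0.
move=> m _ /(_ m (leqnn m)) /= hm.
apply: filterS (Hs m) => n hn; rewrite sub0r normrN.
apply: le_trans (autocor_far l0 hn) _.
rewrite sub0r normrN in hm; have hm' := le_trans (ler_norm _) hm.
have : l^-1 * (2 * \int[mu]_x (w m x * f x ^+ 2)) <= l^-1 * (2 * (l * e / 4)).
  by apply: ler_wpM2l; [rewrite invr_ge0 ltW|lra].
have -> : l^-1 * (2 * (l * e / 4)) = e / 2 by field; rewrite gt_eqF.
by move: lF; lra.
Qed.

End AutocorLimits.

Section ScaledIntegral.
Context {R : realType}.
Local Notation leb := (@lebesgue_measure R).
Local Notation mu := (@area R).
Local Notation pl := (measurableTypeR R * measurableTypeR R)%type.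
Local Notation sub2 := (@sub2 R).
Local Notation autocor := (@autocor R).

Definition scale2 (c : R) (z : pl) : pl := (c * z.1, c * z.2).

Lemma scale2E c : scale2 c = affine2 c (0, 0).
Proof. by apply/funext => z; rewrite /scale2 /affine2 !addr0. Qed.

Lemma measurable_scale2 c : measurable_fun setT (scale2 c).
Proof. by rewrite scale2E; exact: measurable_affine2. Qed.

Lemma rint_scale2 c (g : pl -> R) : 0 < c -> rint mu g ->
  rint mu (fun x => g (scale2 c x)) /\
  \int[mu]_x g (scale2 c x) = c ^- 2 * \int[mu]_x g x.
Proof. by move=> c0; rewrite scale2E; exact: rint_affine2. Qed.

Lemma area_point (p : pl) : mu [set p] = 0%E.
Proof.
rewrite (_ : [set p] = [set p.1] `*` [set p.2]).
  by rewrite /area product_measure1E//= lebesgue_measure_set1 mul0e.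
by apply/seteqP; split=> [_ ->//|[x y] [/= -> ->]]; case: (p).
Qed.

Lemma int_point (g : pl -> R) (p : pl) : rint mu g -> (forall x, x <> p -> g x = 0) ->
  \int[mu]_x g x = 0.
Proof.
move=> ig g0.
have mp : measurable [set p : pl].
  rewrite (_ : [set p] = [set p.1] `*` [set p.2]); first exact: measurableX.
  by apply/seteqP; split=> [_ ->//|[x y] [/= -> ->]]; case: (p).
rewrite (_ : (fun x => g x) = (fun x => g p * \1_[set p] x)).
  have I0 : (\int[mu]_x (\1_[set p] x : R)%:E = 0)%E.
    by rewrite integral_indic// setIT /= area_point.
  have i1 : rint mu (\1_[set p] : pl -> R).
    by apply: rint_of_ge0 => [|x|]; [exact: measurable_indic|rewrite indicE|rewrite I0 ltry].
  by rewrite RintegralZl// /Rintegral I0 mulr0.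
apply/funext => x; rewrite indicE; have [->|xp] := eqVneq x p.
  by rewrite mem_set// mulr1.
by rewrite memNset ?mulr0 ?g0//; [exact/eqP|move=> /= /eqP; exact/negP].
Qed.

Lemma squareP m (x : pl) : square m x ->
  (- m%:R < x.1 <= m%:R) /\ (- m%:R < x.2 <= m%:R).
Proof. by rewrite /square /segm /= => -[]; rewrite !in_itv. Qed.

Variables (f H : pl -> R).
Hypothesis mf : measurable_fun setT f.
Hypothesis f2 : rint mu (fun x => f x ^+ 2).
Hypothesis iH : rint mu H.

Let F := \int[mu]_x f x ^+ 2.

Definition scaled_int c := \int[mu]_s (H s * autocor f (scale2 c s)).

Lemma measurable_scaled c : measurable_fun setT (fun s => autocor f (scale2 c s)).
Proof. exact: (measurableT_comp (measurable_autocor mf f2) (measurable_scale2 c)). Qed.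

Lemma scaled_le (G : pl -> R) c s : `|G s * autocor f (scale2 c s)| <= F * `|G s|.
Proof. by rewrite normrM mulrC ler_wpM2r// autocor_le. Qed.

Lemma rint_scaled (G : pl -> R) c : rint mu G -> rint mu (fun s => G s * autocor f (scale2 c s)).
Proof.
move=> iG; apply: rint_le (rintZl F (rint_norm iG)) (scaled_le G c).
by apply: measurable_funM (measurable_scaled c); exact: rint_measurable iG.
Qed.

Lemma scaled_int_cvg0 (c : nat -> R) : c @ \oo --> (0 : R) ->
  (fun n => scaled_int (c n)) @ \oo --> F * \int[mu]_s H s.
Proof.
move=> c0; have [||||_] := @rint_dct _ _ _ mu (fun n s => H s * autocor f (scale2 (c n) s))
  (fun s => F * H s) (fun s => F * `|H s|).
- by move=> n; exact: rint_measurable (rint_scaled _ iH).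
- move=> s; rewrite mulrC; apply: cvgM; first exact: cvg_cst.
  by apply: autocor_cvg0 => //=; [rewrite -[X in _ --> X](mul0r s.1)|rewrite -[X in _ --> X](mul0r s.2)];
    apply: cvgM => //; exact: cvg_cst.
- exact: rintZl (rint_norm iH).
- by move=> n s; exact: scaled_le.
by rewrite (RintegralZl _ _ iH).
Qed.

(** For [s] other than 0 the dilated point escapes to infinity, where the autocorrelation vanishes.
    At the origin it stays constant, so the pointwise limit [L] lives on a single point, which has
    measure 0. *)
Lemma scaled_int_cvg_oo (c : nat -> R) : (forall A, \forall n \near \oo, A <= c n) ->
  (fun n => scaled_int (c n)) @ \oo --> (0 : R).
Proof.
move=> coo.
pose L (s : pl) := H s * (\1_[set ((0, 0) : pl)] s * autocor f (0, 0)).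
have [||||iL] := @rint_dct _ _ _ mu (fun n s => H s * autocor f (scale2 (c n) s))
  L (fun s => F * `|H s|).
- by move=> n; exact: rint_measurable (rint_scaled _ iH).
- move=> s; apply: cvgM; first exact: cvg_cst.
  have [->|/eqP s0] := eqVneq s (0, 0).
    rewrite indicE mem_set// mul1r; apply: cvg_near_cst; apply: nearW => n.
    by rewrite /scale2 /= !mulr0.
  rewrite indicE memNset// mul0r; apply: autocor_cvg_oo => // m.
  have [s1|s1] := eqVneq s.1 0.
    have s2 : s.2 != 0 by apply/eqP => s2; apply: s0; case: s s1 s2 => ? ? /= -> ->.
    (* A translation by at least [2 * m + 1] in one coordinate exceeds the side [2 * m] of the
       square. *)
    apply: filterS (coo ((2 * m%:R + 1) / `|s.2|)) => n; rewrite ler_pdivrMr ?normr_gt0// => h.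
    move=> x /squareP[_ /andP[h1 h2]] /squareP[_ /= /andP[h3 h4]].
    have := le_trans h (ler_wpM2r (normr_ge0 _) (ler_norm (c n))).
    by rewrite -normrM leNgt ltr_norml => /negP; apply; apply/andP; split; lra.
  apply: filterS (coo ((2 * m%:R + 1) / `|s.1|)) => n; rewrite ler_pdivrMr ?normr_gt0// => h.
  move=> x /squareP[/andP[h1 h2] _] /squareP[/= /andP[h3 h4] _].
  have := le_trans h (ler_wpM2r (normr_ge0 _) (ler_norm (c n))).
  by rewrite -normrM leNgt ltr_norml => /negP; apply; apply/andP; split; lra.
- exact: rintZl (rint_norm iH).
- by move=> n s; exact: scaled_le.
rewrite (int_point (p := (0, 0)) iL) // => x xp.
by rewrite /L indicE memNset// mul0r mulr0.
Qed.

(** In the second term of [G] the substitution [s = 2 t] has Jacobian 4, which cancels [4^-1], and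
    it doubles the dilation factor of the autocorrelation. *)
Lemma scaled_int_diff (G : pl -> R) c :
  (forall s, G s = H s - 4^-1 * H (scale2 2^-1 s)) ->
  \int[mu]_s (G s * autocor f (scale2 c s)) = scaled_int c - scaled_int (2 * c).
Proof.
move=> GE; have h0 : 0 < (2^-1 : R) by rewrite invr_gt0.
have i1 := rint_scaled c iH; have i2 := rint_scaled (2 * c) iH.
have [i3 e3] := rint_scale2 h0 i2.
rewrite (_ : (fun s => G s * _) = (fun s => H s * autocor f (scale2 c s) -
   4^-1 * (H (scale2 2^-1 s) * autocor f (scale2 (2 * c) (scale2 2^-1 s))))); last first.
  apply/funext => s; rewrite GE.
  have -> : scale2 (2 * c) (scale2 2^-1 s) = scale2 c s.
    by rewrite /scale2 /=; congr (_, _); field.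
  by ring.
rewrite (RintegralB measurableT i1 (rintZl 4^-1 i3)) RintegralZl// e3.
by rewrite /scaled_int; congr (_ - _); field.
Qed.

(** For [c > 0] the factor [c] is the square root of the planar Jacobian [c ^+ 2], which makes the
    dilation isometric in L2. *)
Definition dilate (c : R) (x : pl) : R := c * f (scale2 c x).

Lemma measurable_dilate c : measurable_fun setT (dilate c).
Proof.
by apply: measurable_funM => //; exact: measurableT_comp mf (measurable_scale2 c).
Qed.

Lemma rint_dilate_sqr c : 0 < c -> rint mu (fun x => dilate c x ^+ 2).
Proof.
move=> c0; have [h _] := rint_scale2 c0 f2.
by have := rintZl (c ^+ 2) h; congr rint; apply/funext => x; rewrite exprMn.
Qed.

Lemma autocor_dilate c s : 0 < c -> autocor (dilate c) s = autocor f (scale2 c s).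
Proof.
move=> c0; have [i _] := autocor_rint mf f2 (scale2 c s).
have [i1 e1] := rint_scale2 c0 i.
rewrite {1}/autocor (_ : (fun x => _) = (fun x => c ^+ 2 *
  (f (scale2 c x) * f (sub2 (scale2 c x) (scale2 c s))))); last first.
  apply/funext => x; rewrite /dilate.
  have -> : scale2 c (sub2 x s) = sub2 (scale2 c x) (scale2 c s).
    by rewrite /scale2 /sub2 /=; congr (_, _); ring.
  by ring.
rewrite RintegralZl// e1 mulrA mulfV ?mul1r// expf_neq0// gt_eqF//.
Qed.

End ScaledIntegral.

(** * Telescoping over all integer scales *)

Section Telescoping.
Context {R : realType}.

Lemma esum_telescope (u : nat -> R) (l : R) : (forall k, 0 <= u k.+1 - u k) ->
  u @ \oo --> l ->
  (\esum_(k in [set: nat]) (u k.+1 - u k)%:E = (l - u 0%N)%:E)%E.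
Proof.
move=> u0 ul; rewrite -nneseries_esumT; last by move=> k; rewrite lee_fin.
apply/cvg_lim => //.
rewrite (_ : (fun n => _) = EFin \o (fun n => u n - u 0%N)).
  apply/fine_cvgP; split; first by apply: nearW => n.
  by apply: cvgB => //; exact: cvg_cst.
by apply/funext => n; rewrite sumEFin telescope_sumr.
Qed.

(** The sum is split at 0: the scales [n >= 0] give [l - J (-1)], the negative ones [J (-1)], and
    the intermediate value cancels. *)
Lemma esum_telescope_int (J : int -> R) (l : R) : (forall n, 0 <= J n - J (n - 1)) ->
  (fun k : nat => J (k%:Z - 1)) @ \oo --> l -> (fun k : nat => J (Negz k)) @ \oo --> (0 : R) ->
  (\esum_(n in [set: int]) (J n - J (n - 1))%:E = l%:E)%E.
Proof.
move=> J0 Jl Jo; have NE k : Negz k.+1 = Negz k - 1 by rewrite !NegzE -opprD -PoszD addn1.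
have SE (k : nat) : k.+1%:Z - 1 = k by rewrite -addn1 PoszD addrK.
rewrite esum_int => [|k]; last by rewrite lee_fin.
have -> : (\esum_(n in [set: nat]) (J (Posz n) - J (Posz n - 1))%:E = (l - J (0 - 1))%:E)%E.
  have /= <- := @esum_telescope (fun k : nat => J (k%:Z - 1)) l _ Jl.
    by apply: eq_esum => k _; rewrite SE.
  by move=> k; rewrite SE.
have -> : (\esum_(n in [set: nat]) (J (Negz n) - J (Negz n - 1))%:E = (J (0 - 1))%:E)%E.
  have Jo' : (fun k => - J (Negz k)) @ \oo --> (0 : R) by rewrite -oppr0; exact: cvgN.
  have := @esum_telescope (fun k : nat => - J (Negz k)) 0 _ Jo'.
  rewrite sub0r opprK => <-.
    by apply: eq_esum => k _; rewrite NE opprK addrC.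
  by move=> k; rewrite NE opprK addrC.
by rewrite -EFinD subrK.
Qed.

End Telescoping.

Section RealParseval.
Context {R : realType}.
Local Notation cnt := (@cnt R).
Local Notation mu := (@area R).
Local Notation pl := (measurableTypeR R * measurableTypeR R)%type.
Local Notation sub2 := (@sub2 R).
Local Notation lat := (@lat R).
Local Notation bump2 := (@bump2 R).

Variables (f psi G H : pl -> R) (C K : R).
Hypothesis mf : measurable_fun setT f.
Hypothesis f2 : rint mu (fun x => f x ^+ 2).
Hypothesis mpsi : measurable_fun setT psi.
Hypothesis C0 : 0 <= C.
Hypothesis psi_le : forall x, `|psi x| <= C * bump2 x.
Hypothesis iG : rint mu G.
Hypothesis GK : forall x, `|G x| <= K.
Hypothesis rep : forall x y, \int[cnt]_i (psi (sub2 x (lat (zz i))) * psi (sub2 y (lat (zz i)))) =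
  G (sub2 x y).
Hypothesis iH : rint mu H.
Hypothesis GH : forall s, G s = H s - 4^-1 * H (scale2 2^-1 s).

Let F := \int[mu]_x f x ^+ 2.

Definition wave (n : int) (k : int * int) (x : pl) : R :=
  2 ^ n * psi (2 ^ n * x.1 - k.1%:~R, 2 ^ n * x.2 - k.2%:~R).

Lemma waveE n k x : wave n k x = 2 ^ n * psi (sub2 (scale2 (2 ^ n) x) (lat k)).
Proof. by []. Qed.

Let ipsi : rint mu psi. Proof. exact: rint_le mpsi (rintZl C (@rint_bump2 R)) psi_le. Qed.

Let p2 (n : int) : 0 < (2 : R) ^ n. Proof. exact: exprz_gt0. Qed.

Lemma rint_wave n k : rint mu (wave n k).
Proof.
have [i1 _] := rint_sub2 (lat k) ipsi; have [i2 _] := rint_scale2 (p2 n) i1.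
have h := rintZl (2 ^ n) i2; exact: h.
Qed.

Lemma wave_le n k x : `|wave n k x| <= 2 ^ n * C.
Proof.
rewrite waveE normrM gtr0_norm// ler_wpM2l ?(ltW (p2 n))//.
by rewrite (le_trans (psi_le _))// ler_piMr// bump2_le1.
Qed.

Lemma rint_mul_wave n k : rint mu (fun x => f x * wave n k x).
Proof. exact: (rint_mul_bounded mf f2 (rint_wave n k) (wave_le n k)). Qed.

(** A change of variables moves the dilation from the wavelet to [f], so that the analysis of scale
    0 in [frame_scale] covers all scales. *)
Lemma int_mul_wave n k : \int[mu]_x (f x * wave n k x) =
  \int[mu]_x (dilate f (2 ^ (- n)) x * psi (sub2 x (lat k))).
Proof.
have ig := rint_mul_wave n k; have c0 := p2 (- n).
have [i1 e1] := rint_scale2 c0 ig.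
have cn : 2 ^ (- n) * 2 ^ n = 1 :> R by rewrite -invr_expz mulVf// gt_eqF.
transitivity ((2 ^ (- n)) ^+ 2 * \int[mu]_x (f (scale2 (2 ^ (- n)) x) * wave n k (scale2 (2 ^ (- n)) x))).
  by rewrite e1 mulrA mulfV ?mul1r// expf_neq0// gt_eqF.
rewrite -RintegralZl//; congr Rintegral; apply/funext => x; rewrite waveE /dilate.
have -> : scale2 (2 ^ n) (scale2 (2 ^ (- n)) x) = x.
  by rewrite /scale2 /=; case: x => x1 x2; rewrite /= !mulrA (mulrC (2 ^ n)) cn !mul1r.
transitivity ((2 ^ (- n) * 2 ^ n) * (2 ^ (- n) * f (scale2 (2 ^ (- n)) x) * psi (sub2 x (lat k)))).
  by ring.
by rewrite cn mul1r.
Qed.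

Let J n := scaled_int f H (2 ^ (- n)).

Lemma esum_scale n :
  (\esum_(k in [set: int * int]) ((\int[mu]_x (f x * wave n k x)) ^+ 2)%:E = (J n - J (n - 1))%:E)%E.
Proof.
have c0 := p2 (- n).
rewrite -integral_zz; last by move=> k; rewrite lee_fin sqr_ge0.
under eq_integral do rewrite int_mul_wave.
have [i1 e1] := frame_scale (measurable_dilate mf (2 ^ (- n))) (rint_dilate_sqr f2 c0) mpsi C0 psi_le iG GK rep.
rewrite (rint_fin i1) e1; congr EFin.
have -> : \int[mu]_s (G s * autocor (dilate f (2 ^ (- n))) s) =
    \int[mu]_s (G s * autocor f (scale2 (2 ^ (- n)) s)).
  by congr Rintegral; apply/funext => s; rewrite autocor_dilate.
rewrite (scaled_int_diff mf f2 iH _ GH) /J; congr (_ - scaled_int _ _ _).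
by rewrite opprB expfzDr ?pnatr_eq0// expr1z.
Qed.

Lemma esum_wave :
  (\esum_(j in [set: int * (int * int)]) ((\int[mu]_x (f x * wave j.1 j.2 x)) ^+ 2)%:E =
   (F * \int[mu]_x H x)%:E)%E.
Proof.
rewrite (_ : [set: int * (int * int)] = setXR [set: int] (fun=> [set: int * int])); last first.
  by apply/seteqP; split.
rewrite -(@esum_esum R int (int * int)%type setT (fun=> setT)
  (fun n k => ((\int[mu]_x (f x * wave n k x)) ^+ 2)%:E)%E); last first.
  by move=> n k _ _; rewrite lee_fin sqr_ge0.
under eq_esum do rewrite esum_scale.
apply: esum_telescope_int.
(* Monotonicity of [J] is read off the frame sums: its increments are sums of squares. *)
- move=> n; rewrite -lee_fin -esum_scale; apply: esum_ge0 => k _.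
  by rewrite lee_fin sqr_ge0.
- apply: (@scaled_int_cvg0 _ f H mf f2 iH (fun k : nat => 2 ^ (- (k%:Z - 1)))).
  rewrite (_ : (fun k : nat => _) = (fun k => 2 * (2^-1) ^+ k)).
    by rewrite -[X in _ --> X](mulr0 2); apply: cvgM; [exact: cvg_cst|apply: cvg_expr; rewrite ger0_norm ?invr_ge0// invf_lt1 ?ltr1n].
  by apply/funext => k; rewrite opprB expfzDr ?pnatr_eq0// expr1z -invr_expz exprVn.
- apply: (@scaled_int_cvg_oo _ f H mf f2 iH (fun k : nat => 2 ^ (- Negz k))) => A.
  near=> k; rewrite NegzE opprK; apply: (@le_trans _ _ k%:R).
    by apply: ltW; near: k; exact: nbhs_infty_gtr.
  by rewrite -exprnP -natrX ler_nat; apply: ltnW; apply: (leq_trans (ltnW (ltn_expl k.+1 (ltnSn 1)))).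
Unshelve. all: by end_near. Qed.

End RealParseval.

(** * The annular wavelet and complex-valued functions *)

Section Assembly.
Context {R : realType}.
Local Notation cnt := (@cnt R).
Local Notation mu := (@area R).
Local Notation pl := (measurableTypeR R * measurableTypeR R)%type.
Local Notation sub2 := (@sub2 R).
Local Notation lat := (@lat R).
Local Notation bump2 := (@bump2 R).

Lemma Lfun2P (f : pl -> R) : f \in Lfun mu 2%:E <->
  measurable_fun setT f /\ rint mu (fun x => f x ^+ 2).
Proof.
split=> [fL|[mf f2]].
  split; last exact: Lfun2_integrable_sqr.
  by move: fL; rewrite inE => /andP[+ _]; rewrite inE.
rewrite inE; apply/andP; split; rewrite inE//= /finite_norm unlock /=.
apply: poweR_lty.
rewrite (_ : (\int[_]_x _)%E = (\int[mu]_x f x ^+ 2)%:E) ?ltry//.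
rewrite -(rint_fin f2); apply: eq_integral => x _.
by rewrite /= powR_mulrn// real_normK ?num_real.
Qed.

Lemma int_mul_cos_scale (h : pl -> R) s : rint mu h ->
  cosft (fun z => h (scale2 2 z)) s = 4^-1 * cosft h (scale2 2^-1 s).
Proof.
move=> ih; have [_] := rint_scale2 (ltr0Sn R 1) (rint_mul_cos0 (2 * pi) (scale2 2^-1 s) ih).
have -> : (2 ^- 2 : R) = 4^-1 by field.
move=> <-; congr Rintegral; apply/funext => z; congr (_ * cos (_ * _)).
by rewrite /dot2 /scale2 /=; field.
Qed.

Variables (theta : R -> R) (a delta : R).
Hypothesis theta_smooth : smooth_line theta.
Hypothesis theta0 : forall x : R, x <= -1 -> theta x = 0.
Hypothesis theta1 : forall x : R, 1 <= x -> theta x = 1.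
Hypothesis theta_sq : forall x : R, theta x ^+ 2 + theta (- x) ^+ 2 = 1.
Hypothesis a_gt0 : 0 < a.
Hypothesis delta_gt0 : 0 < delta.
Hypothesis delta_a : 2 * delta < a.
Hypothesis b_half : 2 * a + delta < 1 / 2.

Local Notation b := (2 * a + delta).
Local Notation h := (psi_hat theta a delta : pl -> R).
Local Notation low := (low_pass theta a delta : pl -> R).

Let b0 : 0 < b. Proof. by rewrite addr_gt0// mulr_gt0. Qed.

Let ring_vanish t : b ^+ 2 < t -> ring_profile theta a delta (Num.sqrt t) = 0.
Proof. by move=> bt; apply: ring_profile_hi => //; exact: sqrt_hi. Qed.

Let low_vanish t : b ^+ 2 < t -> low_profile theta a delta (Num.sqrt t) = 0.
Proof. by move=> bt; apply: low_profile_hi => //; exact: sqrt_hi. Qed.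

Let sring : smooth_line (fun t => ring_profile theta a delta (Num.sqrt t)).
Proof. exact: smooth_ring_sqrt. Qed.

Let slow : smooth_line (fun t => low_profile theta a delta (Num.sqrt t)).
Proof. exact: smooth_low_sqrt. Qed.

Let rh : radial (fun t => ring_profile theta a delta (Num.sqrt t)) h.
Proof. exact: radial_psi_hat. Qed.

Let rl : radial (fun t => low_profile theta a delta (Num.sqrt t)) low.
Proof. exact: radial_low_pass. Qed.

Let h_even z : h (opp2 z) = h z.
Proof. by rewrite !(psi_hatE theta1)// /opp2 /= !sqrrN. Qed.

Let low_even z : low (opp2 z) = low z.
Proof. by rewrite /low_pass /opp2 /= !sqrrN. Qed.

Let mh := radial_measurable sring rh.
Let ml := radial_measurable slow rl.
Let ih := radial_rint sring b0 ring_vanish rh.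
Let il := radial_rint slow b0 low_vanish rl.

Lemma schwartz_psi_hat : schwartz (fun x => (psi_hat theta a delta x)%:C%C).
Proof.
split; first exact: (radial_schwartz sring b0 ring_vanish rh).
have := radial_schwartz sring b0 ring_vanish (lspan_scale 0 rh).
by congr real_schwartz; apply/funext => x; rewrite mul0r.
Qed.

Lemma psi_real x : psi theta a delta x = (cosft h x)%:C%C.
Proof.
have [M _ hM] := radial_bounded sring b0 ring_vanish rh.
have hs := radial_support b0 ring_vanish rh.
rewrite /psi /inv_fourier /Cintegral; congr (_ +i* _)%C.
  congr Rintegral; apply/funext => y; rewrite /expi /dot2 /=.
  by rewrite mul0r subr0.
rewrite -(int_mul_sin mh hM hs h_even x).
congr Rintegral; apply/funext => y; rewrite /expi /dot2 /=.
by rewrite mul0r addr0.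
Qed.

Lemma int_cosft_low : \int[mu]_x cosft low x = 1.
Proof.
have [M _ hM] := radial_bounded slow b0 low_vanish rl.
have hs := radial_support b0 low_vanish rl.
have [C _ hC] := cosft_decay slow b0 low_vanish rl.
rewrite -(low_pass0 theta1 a_gt0 delta_gt0 delta_a).
exact: (int_cosft ml hM (ltW b0) b_half hs (radial_continuous slow rl) low_even hC).
Qed.

Let iH : rint mu (cosft low).
Proof.
have [C _ hC] := cosft_decay slow b0 low_vanish rl.
apply: rint_le (rintZl C (@rint_bump2 R)) hC; exact: measurable_cosft.
Qed.

Lemma cosft_psi_hat_sqr s :
  cosft (fun z => h z ^+ 2) s = cosft low s - 4^-1 * cosft low (scale2 2^-1 s).
Proof.
have [i2 _] := rint_scale2 (ltr0Sn R 1) il.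
rewrite -int_mul_cos_scale// /cosft -RintegralB//; [|exact: rint_mul_cos0..].
congr Rintegral; apply/funext => z; rewrite (psi_hat_sq theta0 theta1)// mulrBl.
by congr (_ - _).
Qed.

Let G := cosft (fun z => h z ^+ 2).

(** Inherited from [cosft low] through [cosft_psi_hat_sqr], in place of a separate decay estimate
    for the square of [psi_hat]. *)
Let iG : rint mu G.
Proof.
have half0 : 0 < (2^-1 : R) by rewrite invr_gt0.
have [i1 _] := rint_scale2 half0 iH.
have := rintB iH (rintZl 4^-1 i1); congr rint; apply/funext => s.
by rewrite /G cosft_psi_hat_sqr.
Qed.

Lemma real_parseval (f : pl -> R) : measurable_fun setT f ->
  rint mu (fun x => f x ^+ 2) ->
  (\esum_(j in [set: int * (int * int)])
     ((\int[mu]_x (f x * wave (cosft h) j.1 j.2 x)) ^+ 2)%:E =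
   (\int[mu]_x f x ^+ 2)%:E)%E.
Proof.
move=> mf f2.
have [M _ hM] := radial_bounded sring b0 ring_vanish rh.
have hs := radial_support b0 ring_vanish rh.
have [C C0 hC] := cosft_decay sring b0 ring_vanish rh.
have hc := radial_continuous sring rh.
have i2 : rint mu (fun z => h z ^+ 2).
  apply: (rint_le _ (rintZl M (rint_norm ih))) => [|x]; first exact: measurable_funX.
  by rewrite normrX expr2 ler_wpM2r.
have GK x := cosft_le x i2.
rewrite (esum_wave mf f2 (measurable_cosft ih) C0 hC iG GK _ iH cosft_psi_hat_sqr).
  by rewrite int_cosft_low mulr1.
by move=> x y; case: (reproducing mh hM b_half hs hc h_even C0 hC x y).
Qed.

Lemma dyadic_wave j x : dyadic_wavelets (psi theta a delta) j x =
  (wave (cosft h) j.1 j.2 x)%:C%C.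
Proof. by rewrite /dyadic_wavelets psi_real /wave rmorphM. Qed.

Lemma L2_wave j : L2 (dyadic_wavelets (psi theta a delta) j).
Proof.
have [C C0 hC] := cosft_decay sring b0 ring_vanish rh.
have mw : measurable_fun setT (cosft h : pl -> R) := measurable_cosft ih.
have iw := rint_wave mw hC j.1 j.2.
have wl := wave_le C0 hC j.1 j.2.
split.
  have -> : (fun x => complex.Re (dyadic_wavelets (psi theta a delta) j x)) = wave (cosft h) j.1 j.2.
    by apply/funext => x; rewrite dyadic_wave.
  apply/Lfun2P; split; first exact: (rint_measurable iw).
  apply: (rint_le _ (rintZl (2 ^ j.1 * C) (rint_norm iw))) => [|x].
    exact: (measurable_funX 2 (rint_measurable iw)).
  by rewrite normrX expr2 ler_wpM2r.
have -> : (fun x => complex.Im (dyadic_wavelets (psi theta a delta) j x)) = fun=> 0.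
  by apply/funext => x; rewrite dyadic_wave.
by apply/Lfun2P; split=> //; rewrite expr0n; exact: rint0.
Qed.

Lemma normc_sqr (z : R[i]) : Normc.normc z ^+ 2 = complex.Re z ^+ 2 + complex.Im z ^+ 2.
Proof. by case: z => x y /=; rewrite sqr_sqrtr// addr_ge0// sqr_ge0. Qed.

Lemma parseval_dyadic : parseval_frame (dyadic_wavelets (psi theta a delta)).
Proof.
split; first exact: L2_wave.
move=> f [/Lfun2P[m1 i1] /Lfun2P[m2 i2]].
set f1 := fun x => complex.Re (f x); set f2 := fun x => complex.Im (f x).
rewrite /L2normsq.
have -> : (\int[area]_x (Normc.normc (f x) ^+ 2)%:E =
   (\int[mu]_x f1 x ^+ 2)%:E + (\int[mu]_x f2 x ^+ 2)%:E)%E.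
  rewrite -EFinD -RintegralD// -(rint_fin (rintD i1 i2)).
  by apply: eq_integral => x _; rewrite normc_sqr.
rewrite -(real_parseval m1 i1) -(real_parseval m2 i2).
rewrite -esumD; [|by move=> j _; rewrite lee_fin sqr_ge0..].
apply: eq_esum => j _; rewrite -EFinD normc_sqr /L2inner.
have -> : (fun x => f x * conjc (dyadic_wavelets (psi theta a delta) j x)) =
    (fun x => f1 x * wave (cosft h) j.1 j.2 x +i* (f2 x * wave (cosft h) j.1 j.2 x))%C.
  apply/funext => x; rewrite dyadic_wave /f1 /f2; case: (f x) => u v.
  by apply/eqP; rewrite eq_complex /= oppr0 !mulr0 subr0 add0r !eqxx.
by [].
Qed.

End Assembly.

Local Open Scope complex_scope.

Theorem proposition18 (R : realType) (theta : R -> R)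
  (theta_smooth : smooth_line theta)
  (theta0 : forall x : R, x <= -1 -> theta x = 0)
  (theta1 : forall x : R, 1 <= x -> theta x = 1)
  (theta_sq : forall x : R, theta x ^+ 2 + theta (- x) ^+ 2 = 1)
  (a : R) (a_gt0 : 0 < a) (a_lt : a < 1 / 4)
  (delta : R) (delta_gt0 : 0 < delta)
  (delta_lt : delta < 1 / 2 * Num.min (1 - 4 * a) a) :
  schwartz (fun x => (psi_hat theta a delta x)%:C) /\
  parseval_frame (dyadic_wavelets (psi theta a delta)).
Proof.
(* Each argument of the minimum has its own use: [1 - 4 * a] places the support inside the open
   square of side 1, [a] separates the two transitions of the window. *)
have m1 : Num.min (1 - 4 * a) a <= 1 - 4 * a by rewrite ge_min lexx.
have m2 : Num.min (1 - 4 * a) a <= a by rewrite ge_min lexx orbT.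
have delta_a : 2 * delta < a by lra.
have b_half : 2 * a + delta < 1 / 2 by lra.
by split; [exact: schwartz_psi_hat|exact: parseval_dyadic].
Qed.
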